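(* Let $(G,\sigma)$ be generated by the symmetric stochastic block model with parameters $c_{\mathrm{in}}$ and $c_{\mathrm{out}}$, and let $$d=\frac{c_{\mathrm{in}}+(q-1)c_{\mathrm{out}}}{q},\qquad \lambda=\frac{c_{\mathrm{in}}-c_{\mathrm{out}}}{qd},\qquad d_c^{\mathrm{upper}}=\frac{2q\log q}{(1+(q-1)\lambda)\log(1+(q-1)\lambda)+(q-1)(1-\lambda)\log(1-\lambda)}.$$ If $d>d_c^{\mathrm{upper}}$ then, with high probability, any good partition has overlap at least $\beta>0$ with the planted partition $\sigma$, where $\beta$ is the smallest root of $$d=\frac{2q\Big(h\big(\beta+\tfrac1q\big)+\big(1-\tfrac1q-\beta\big)\log(q-1)\Big)}{(1+(q-1)\lambda)\log\frac{1+(q-1)\lambda}{1+q\beta\lambda}+(q-1)(1-\lambda)\log\frac{(q-1)(1-\lambda)}{q-1-q\beta\lambda}}$$ and $h\big(\beta+\tfrac1q\big)=-\big(\beta+\tfrac1q\big)\log\big(\beta+\tfrac1q\big)-\big(1-\tfrac1q-\beta\big)\log\big(1-\tfrac1q-\beta\big)$ is the entropy function. Therefore, there exists an exponential-time algorithm that, given $G$, with high probability outputs a partition achieving overlap at least $\beta$ with $\sigma$.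
   Context: Symmetric stochastic block model: fix $q\ge 2$ and constants $c_{\mathrm{in}},c_{\mathrm{out}}\ge0$ (not both zero, independent of $n$). Each vertex $v\in[n]$ gets an independent uniform label $\sigma_v\in[q]=\{1,\dots,q\}$ ($\sigma$ is the planted partition). Given $\sigma$, each pair $\{u,v\}$ is an edge independently with probability $c_{\mathrm{in}}/n$ if $\sigma_u=\sigma_v$ and $c_{\mathrm{out}}/n$ otherwise. ''With high probability'' means with probability tending to $1$ as $n\to\infty$ ($n$ ranging over multiples of $q$). The convention $0\log 0=0$ is used, and $d_c^{\mathrm{upper}}=+\infty$ when $\lambda=0$. A partition $\tau\in[q]^n$ is balanced if it has $n/q$ vertices in each group. For a balanced partition $\tau$, let $m_{\mathrm{in}}$ and $m_{\mathrm{out}}$ be the numbers of edges $(u,v)$ of $G$ with $\tau_u=\tau_v$ and $\tau_u\ne\tau_v$ respectively. Then $\tau$ is good if it is balanced and $|m_{\mathrm{in}}-\overline{m}_{\mathrm{in}}|<n^{2/3}$ and $|m_{\mathrm{out}}-\overline{m}_{\mathrm{out}}|<n^{2/3}$, where $\overline{m}_{\mathrm{in}}=\frac{c_{\mathrm{in}}}{2q}n$ and $\overline{m}_{\mathrm{out}}=\frac{(q-1)c_{\mathrm{out}}}{2q}n$. Overlap: $\mathrm{overlap}(\sigma,\tau)=\frac1n\max_{\rho}\sum_{i=1}^q\big(|\sigma^{-1}(i)\cap\tau^{-1}(\rho(i))|-\frac1n|\sigma^{-1}(i)||\tau^{-1}(\rho(i))|\big)$, the maximum being over permutations $\rho$ of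 $[q]$. *)

(* Defs.v *)
From HB Require Import structures.
From mathcomp Require Import all_boot all_order all_algebra all_fingroup.
From mathcomp Require Import all_classical all_reals all_analysis.

Set Implicit Arguments.
Unset Strict Implicit.
Unset Printing Implicit Defensive.

Import Order.TTheory GRing.Theory Num.Theory.
Import numFieldNormedType.Exports.

Local Open Scope classical_set_scope.
Local Open Scope ring_scope.

(* The unordered pair {u, v} is represented by (u, v) with u < v. *)
Definition vpair (n : nat) : finType :=
  {e : 'I_n * 'I_n | (e.1 < e.2)%N}.

Definition graph (n : nat) : finType := {set vpair n}.

Definition labelling (n q : nat) : finType := {ffun 'I_n -> 'I_q}.

Definition adjacent (n : nat) (G : graph n) (u v : 'I_n) : bool :=
  [exists e in G, (val e == (u, v)) || (val e == (v, u))].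

Definition same_group (n q : nat) (s : labelling n q) (e : vpair n) : bool :=
  s (val e).1 == s (val e).2.

Section Model.
Variables (R : realType) (q : nat) (cin cout : R).

Definition edge_prob (n : nat) (s : labelling n q) (e : vpair n) : R :=
  (if same_group s e then cin else cout) / n%:R.

(* A probability mass function as soon as cin <= n and cout <= n; only the
   behaviour as n tends to infinity is used. *)
Definition sbm_weight (n : nat) (G : graph n) (s : labelling n q) : R :=
  (q%:R ^+ n)^-1 *
  \prod_(e : vpair n)
     (if e \in G then edge_prob s e else 1 - edge_prob s e).

Definition sbm_prob (n : nat) (A : graph n -> labelling n q -> Prop) : R :=
  \sum_(w : graph n * labelling n q | `[< A w.1 w.2 >]) sbm_weight w.1 w.2.

(* n ranges over the multiples m * q of q. *)
Definition whp (A : forall n, graph n -> labelling n q -> Prop) : Prop :=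
  (fun m : nat => sbm_prob (@A (m * q)%N)) @ \oo --> (1 : R).

Definition avg_degree : R := (cin + (q%:R - 1) * cout) / q%:R.

Definition snr : R := (cin - cout) / (q%:R * avg_degree).

Definition label_class (n : nat) (t : labelling n q) (i : 'I_q) : {set 'I_n} :=
  [set v | t v == i]%SET.

Definition balanced (n : nat) (t : labelling n q) : Prop :=
  forall i : 'I_q, #|label_class t i| = (n %/ q)%N.

Definition m_in (n : nat) (G : graph n) (t : labelling n q) : nat :=
  #|[set e in G | same_group t e]%SET|.

Definition m_out (n : nat) (G : graph n) (t : labelling n q) : nat :=
  #|[set e in G | ~~ same_group t e]%SET|.

Definition mbar_in (n : nat) : R := cin / (2 * q%:R) * n%:R.

Definition mbar_out (n : nat) : R :=
  (q%:R - 1) * cout / (2 * q%:R) * n%:R.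

Definition good (n : nat) (G : graph n) (t : labelling n q) : Prop :=
  [/\ balanced t,
      `|(m_in G t)%:R - mbar_in n| < n%:R `^ (2 / 3) &
      `|(m_out G t)%:R - mbar_out n| < n%:R `^ (2 / 3)].

Definition agreement (n : nat) (s t : labelling n q) (rho : 'S_q) : R :=
  \sum_(i < q)
     (#|label_class s i :&: label_class t (rho i)|%SET%:R
      - n%:R^-1 * (#|label_class s i|%:R * #|label_class t (rho i)|%:R)).

(* The default value of the iterated maximum is the term of the identity
   permutation, so this is the maximum over 'S_q. *)
Definition overlap (n : nat) (s t : labelling n q) : R :=
  n%:R^-1 *
  \big[Num.max/agreement s t 1%g]_(rho : 'S_q) agreement s t rho.

End Model.

Section Threshold.
Variables (R : realType) (q : nat).

(* [ln x = 0] for x <= 0, hence 0 log 0 = 0. *)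
Definition d_upper (l : R) : \bar R :=
  if l == 0 then +oo%E
  else (2 * q%:R * ln (q%:R : R) /
        ((1 + (q%:R - 1) * l) * ln (1 + (q%:R - 1) * l)
         + (q%:R - 1) * (1 - l) * ln (1 - l)))%:E.

Definition entropy (x : R) : R := - x * ln x - (1 - x) * ln (1 - x).

Definition root_num (b : R) : R :=
  2 * q%:R * (entropy (b + q%:R^-1)
              + (1 - q%:R^-1 - b) * ln (q%:R - 1)).

Definition root_den (l b : R) : R :=
  (1 + (q%:R - 1) * l)
    * ln ((1 + (q%:R - 1) * l) / (1 + q%:R * b * l))
  + (q%:R - 1) * (1 - l)
    * ln (((q%:R - 1) * (1 - l)) / (q%:R - 1 - q%:R * b * l)).

(* The entropy requires 0 <= b + 1/q <= 1; the right-hand side is 0/0 at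
   b = 1 - 1/q. *)
Definition is_root (d l b : R) : Prop :=
  [/\ 0 <= b + q%:R^-1 <= 1, root_den l b != 0 &
      d = root_num b / root_den l b].

Definition smallest_root (d l b : R) : Prop :=
  is_root d l b /\ forall b', is_root d l b' -> b <= b'.

End Threshold.

(* Algorithms are programs of a random-access machine over nat with addition
   and truncated subtraction, and no multiplication, so that unit-cost time is
   polynomially related to Turing-machine time. The memory consists of
   countably many unbounded arrays, of which a program names finitely many. *)
Definition memory := nat -> nat -> nat.

Inductive expr : Type :=
| Const of nat
| Read of nat & expr
| Plus of expr & expr
| Minus of expr & expr.

Inductive program : Type :=
| Skip
| Store of nat & expr & expr
| Seq of program & program
| If of expr & program & program
| While of expr & program.

Fixpoint eval (m : memory) (e : expr) : nat :=
  match e with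
  | Const k => k
  | Read a i => m a (eval m i)
  | Plus e1 e2 => (eval m e1 + eval m e2)%N
  | Minus e1 e2 => (eval m e1 - eval m e2)%N
  end.

Definition update (m : memory) (a i v : nat) : memory :=
  fun b j => if (b == a) && (j == i) then v else m b j.

(* [runs p m k m']: started in m, the program p halts in m' after k steps.
   Expressions have constant size in a fixed program, so each store and each
   test counts as one step. Nonzero values count as true. *)
Inductive runs : program -> memory -> nat -> memory -> Prop :=
| RunSkip m : runs Skip m 1%N m
| RunStore m a i e :
    runs (Store a i e) m 1%N (update m a (eval m i) (eval m e))
| RunSeq p1 p2 m k1 m1 k2 m2 :
    runs p1 m k1 m1 -> runs p2 m1 k2 m2 ->
    runs (Seq p1 p2) m (k1 + k2).+1 m2
| RunIfTrue e p1 p2 m k m' :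
    eval m e <> 0%N -> runs p1 m k m' -> runs (If e p1 p2) m k.+1 m'
| RunIfFalse e p1 p2 m k m' :
    eval m e = 0%N -> runs p2 m k m' -> runs (If e p1 p2) m k.+1 m'
| RunWhileTrue e p m k1 m1 k2 m2 :
    eval m e <> 0%N -> runs p m k1 m1 -> runs (While e p) m1 k2 m2 ->
    runs (While e p) m (k1 + k2).+1 m2
| RunWhileFalse e p m :
    eval m e = 0%N -> runs (While e p) m 1%N m.

(* Array 0 holds the number n of vertices in cell 0, array 1 the adjacency
   matrix in row-major order; all other cells are 0. *)
Definition input (n : nat) (G : graph n) : memory :=
  fun a j =>
    match a with
    | 0 => if j == 0%N then n else 0%N
    | 1 => nat_of_bool [exists u : 'I_n, exists v : 'I_n,
                 (j == u * n + v)%N && adjacent G u v]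
    | _ => 0%N
    end.

(* The label of vertex v is read in cell v of array 2. *)
Definition outputs (q n : nat) (p : program) (G : graph n)
    (t : labelling n q) : Prop :=
  exists k m, runs p (input G) k m /\ forall v : 'I_n, m 2%N v = t v :> nat.

(* Exponential in the number n of vertices, that is 2^O(n). *)
Definition exponential_time (p : program) : Prop :=
  exists C : nat, forall (n : nat) (G : graph n),
    exists k m, runs p (input G) k m /\ (k <= C * 2 ^ (C * n))%N.

(* Main.v *)
From Pilot Require Import Defs.
From HB Require Import structures.
From mathcomp Require Import all_boot all_order all_algebra all_fingroup.
From mathcomp Require Import all_classical all_reals all_analysis.
From mathcomp Require Import ring lra zify.

Set Implicit Arguments.
Unset Strict Implicit.
Unset Printing Implicit Defensive.

Import Order.TTheory GRing.Theory Num.Theory.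
Import numFieldNormedType.Exports.

Local Open Scope ring_scope.

(** Write n for the number of vertices, s for the planted labelling, t for a
    balanced one, N i j for the number of vertices labelled i by s and j by t,
    and S for q * sum (N i j / n)^2. Given s, the expected number of edges
    inside the groups of t depends on t only through S, while t has overlap
    b exactly when the largest of the sums sum_i N i (rho i) / n, over the
    permutations rho, is x = b + 1/q. The proof is a first moment computation
    over the t of given overlap b, conditionally on an almost balanced s.

    - Energy. A nonnegative matrix with constant row and column sums is a
      mixture of permutation matrices; pairing N with itself gives S <= x
      ([regular_pairing_le], [near_balanced_cell2_le]). A Chernoff bound on the
      edge counts then gives t a probability at most
      exp (- n d (root_den b) / 2q), up to a factor exp (o (n)), of having the edge counts of a good
      partition ([weakly_good_prob], [exists_tilt]).
    - Entropy. Draw labels independently, each vertex v taking rho (s v) with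
      probability x and every other label with probability (1 - x) / (q - 1).
      Every t with sum_i N i (rho i) = x n has weight
      exp (- n (root_num b) / 2q), so this bounds how many there are
      ([kernel_weight_ge]).

    Hence the exponent has the sign of root_num b - d root_den b. It is
    negative at b = 0 because d exceeds the threshold, and beta is its first
    zero ([exists_smallest_root]).

    These two bounds leave nothing to spare at b = beta, whereas the overlap
    is claimed to be at least beta and not only beta - o(1). The gain comes
    from playing them against each other: for most t the matrix N is close to
    its mean under the product measure, which has uniform off-diagonal
    entries, and there S is smaller than x by a constant
    ([typical_cell2], [uniform_collision_gap]); the other t are exponentially
    rare ([atypical_weight]). So the exponent is negative on all of
    [0, beta], and by compactness uniformly so ([local_first_moment],
    [low_overlap_rare]).

    The Chernoff bound uses only one side of the two conditions on edge
    counts ([weakly_good]): for a positive signal, that t has not too few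
    edges inside its groups and not too many between them. Some balanced
    labelling close to s satisfies this with high probability
    ([near_planted_weakly_good]); since the total number of edges is fixed, so
    does then a balanced labelling with the most edges inside its groups
    ([weakly_good_maximal]). The algorithm searches for such a maximiser among
    all q ^ n labellings ([search_correct]), which requires only the sign of
    the signal and not the real numbers cin and cout. *)

(** * Hall's theorem and pairings with doubly stochastic matrices *)

Section Hall.
Local Open Scope nat_scope.
Local Open Scope set_scope.

(** Rado's proof: as long as some set has two elements, one of them can be
    deleted without breaking Hall's condition; when all sets are singletons,
    the condition says that they are distinct. *)
Lemma hall_marriage (I J : finType) (A : I -> {set J}) :
  (forall K : {set I}, #|K| <= #|\bigcup_(i in K) A i|) ->
  exists2 f : I -> J, injective f & forall i, f i \in A i.
Proof.
have [N] := ubnP (\sum_i #|A i|); elim: N A => // N IH A leN hallA.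
have A_gt0 i : 0 < #|A i|.
  by have := hallA [set i]; rewrite big_set1 cards1.
case: (boolP [forall i, #|A i| <= 1]) => [/forallP A1|].
  have fP i : exists j, A i == [set j].
    have /cards1P[j ->] : #|A i| == 1 by rewrite eqn_leq A1 A_gt0.
    by exists j.
  pose f i := xchoose (fP i).
  have fE i : A i = [set f i] by apply/eqP; exact: (xchooseP (fP i)).
  exists f => [i1 i2 eq_f|i]; last by rewrite fE set11.
  apply/eqP/negP => /negP ne_i.
  have := hallA [set i1; i2]; rewrite cards2 ne_i finset.bigcup_setU !big_set1 !fE eq_f.
  by rewrite finset.setUid cards1.
case/forallPn=> i0; rewrite -ltnNge => /card_gt1P [j1 [j2 [Aj1 Aj2 ne_j]]].
pose B j i := if i == i0 then A i :\ j else A i.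
have Bsub j i : B j i \subset A i.
  by rewrite /B; case: eqP => // _; exact: subD1set.
have Blt j : j \in A i0 -> \sum_i #|B j i| < N.
  move=> Aj; rewrite -ltnS; apply: leq_ltn_trans leN.
  rewrite (bigD1 i0) // [X in _ < X](bigD1 i0) //= -addSn leq_add //.
    by rewrite /B eqxx [X in _ < X](cardsD1 j) Aj.
  by apply: leq_sum => i _; exact: subset_leq_card.
(* One of the two deletions keeps Hall's condition: families K1 and K2
   violating it both contain i0, and submodularity of the cardinal of a union
   would turn them into a violation by A. *)
case: (boolP [forall K : {set I}, #|K| <= #|\bigcup_(i in K) B j1 i|])
  => [/forallP h1|/forallPn[K1]].
  have [f f_inj fB] := IH _ (Blt _ Aj1) h1.
  by exists f => // i; have := fB i; exact: (fintype.subsetP (Bsub j1 i)).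
case: (boolP [forall K : {set I}, #|K| <= #|\bigcup_(i in K) B j2 i|])
  => [/forallP h2 _|/forallPn[K2]].
  have [f f_inj fB] := IH _ (Blt _ Aj2) h2.
  by exists f => // i; have := fB i; exact: (fintype.subsetP (Bsub j2 i)).
rewrite -!ltnNge => lt2 lt1.
have inK j (K : {set I}) : #|\bigcup_(i in K) B j i| < #|K| -> i0 \in K.
  move=> ltK; apply/negP => /negP i0K; move: ltK; rewrite ltnNge => /negP; apply.
  apply: leq_trans (hallA K) _; apply: eq_leq; congr #|pred_of_set _|.
  by apply: eq_bigr => i iK; rewrite /B; case: eqP => // ei; rewrite -ei iK in i0K.
have K1i := inK _ _ lt1; have K2i := inK _ _ lt2.
set U1 := \bigcup_(i in K1) _ in lt1; set U2 := \bigcup_(i in K2) _ in lt2.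
have subU : \bigcup_(i in K1 :|: K2) A i \subset U1 :|: U2.
  apply/bigcupsP => i; have [-> _|ne_i] := eqVneq i i0.
    apply/fintype.subsetP => j Aj; rewrite inE.
    have [ej|nj] := eqVneq j j1.
      apply/orP; right; apply/bigcupP; exists i0 => //.
      by rewrite /B eqxx in_setD1 Aj andbT ej.
    apply/orP; left; apply/bigcupP; exists i0 => //.
    by rewrite /B eqxx in_setD1 Aj nj.
  rewrite inE => /orP[] iK; apply/fintype.subsetP => j Aj; rewrite inE; apply/orP.
    by left; apply/bigcupP; exists i => //; rewrite /B (negPf ne_i).
  by right; apply/bigcupP; exists i => //; rewrite /B (negPf ne_i).
have subI : \bigcup_(i in (K1 :&: K2) :\ i0) A i \subset U1 :&: U2.
  apply/bigcupsP => i; rewrite !inE => /and3P[ne_i iK1 iK2].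
  apply/fintype.subsetP => j Aj; rewrite inE; apply/andP; split; apply/bigcupP;
    by exists i => //; rewrite /B (negPf ne_i).
have := leq_trans (hallA _) (subset_leq_card subU).
have := leq_trans (hallA _) (subset_leq_card subI).
have := cardsD1 i0 (K1 :&: K2); rewrite inE K1i K2i /=.
have := cardsUI K1 K2; have := cardsUI U1 U2.
move: lt1 lt2; move: #|U1| #|U2| #|K1| #|K2| => u1 u2 k1 k2.
move: #|U1 :|: U2| #|U1 :&: U2| #|K1 :|: K2| #|K1 :&: K2| => uu ui ku ki.
move: #|_ :\ i0| => k0.
by lia.
Qed.

(** Counting the entries in the rows of K two ways gives Hall's condition for
    the supports of the rows. *)
Lemma regular_perm (q m : nat) (N : 'I_q -> 'I_q -> nat) :
  (forall i, \sum_j N i j = m.+1) -> (forall j, \sum_i N i j = m.+1) ->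
  exists rho : 'S_q, forall i, 0 < N i (rho i).
Proof.
move=> rowN colN.
have [K|f f_inj fN] := @hall_marriage _ _ (fun i => [set j | 0 < N i j]).
  set U := \bigcup_(i in K) _; rewrite -(leq_pmul2r (ltn0Sn m)) -!sum_nat_const.
  have -> : \sum_(i in K) m.+1 = \sum_(i in K) \sum_(j in U) N i j.
    apply: eq_bigr => i iK; rewrite -(rowN i) [RHS]big_mkcond /=.
    apply: eq_bigr => j _; case: ifPn => // /bigcupP nU.
    by apply/eqP; rewrite -leqn0 leqNgt; apply/negP => N0; apply: nU; exists i; rewrite ?inE.
  rewrite exchange_big /=; apply: leq_sum => j _; rewrite -(colN j).
  by rewrite [X in _ <= X](bigID [in K]) leq_addr.
by exists (perm f_inj) => i; have := fN i; rewrite permE inE.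
Qed.
End Hall.

(** Birkhoff's theorem in dual form: N is a sum of m permutation matrices, so
    its pairing with M is at most m times the best permutation. *)
Lemma regular_pairing_le (R : realType) (q m : nat) (N : 'I_q -> 'I_q -> nat)
    (M : 'I_q -> 'I_q -> R) (c : R) :
  (forall i, \sum_j N i j = m)%N -> (forall j, \sum_i N i j = m)%N ->
  (forall rho : 'S_q, \sum_i M i (rho i) <= c) ->
  \sum_i \sum_j (N i j)%:R * M i j <= m%:R * c.
Proof.
move=> + + Mc; elim: m N => [|m IH] N rowN colN.
  rewrite mul0r big1 // => i _; rewrite big1 // => j _.
  by move/eqP: (rowN i); rewrite sum_nat_eq0 => /forallP/(_ j)/eqP ->; rewrite mul0r.
have [rho rhoN] := regular_perm rowN colN.
pose N' i j := (N i j - (j == rho i))%N.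
have NE i j : N i j = (N' i j + (j == rho i))%N.
  by rewrite /N'; case: eqP => [->|_]; rewrite ?subn0 ?addn0 // subnK.
have rowN' i : (\sum_j N' i j = m)%N.
  have := rowN i; under eq_bigr do rewrite NE.
  rewrite big_split /= [X in (_ + X)%N](bigD1 (rho i)) //= eqxx [X in (_ + (_ + X))%N]big1 => [|j /negPf -> //].
  by rewrite addn0 addn1 => -[].
have colN' j : (\sum_i N' i j = m)%N.
  have := colN j; under eq_bigr do rewrite NE.
  rewrite big_split /= [X in (_ + X)%N](bigD1 (rho^-1%g j)) //= permKV eqxx.
  rewrite [X in (_ + (_ + X))%N]big1 => [|i ne]; first by rewrite addn0 addn1 => -[].
  by case: eqP => // ej; rewrite ej permK eqxx in ne.
rewrite -natr1 mulrDl mul1r; apply: le_trans (lerD (IH N' rowN' colN') (Mc rho)).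
rewrite -big_split /=; apply: ler_sum => i _.
under eq_bigr do rewrite NE natrD mulrDl.
rewrite big_split /= lerD2l (bigD1 (rho i)) //= eqxx mul1r big1 ?addr0 // => j /negPf ->.
by rewrite mul0r.
Qed.

(** * Joint label counts of two labellings *)

Section Cells.
Variables (n q : nat).
Implicit Types s t : labelling n q.

Definition cell s t (i j : 'I_q) : nat :=
  #|label_class s i :&: label_class t j|%SET.

Definition hamming s t : nat := #|[set v | s v != t v]%SET|.

Lemma cellE s t i j : cell s t i j = (\sum_(v < n) ((s v == i) && (t v == j)))%N.
Proof.
rewrite /cell -sum1_card big_mkcond /=; apply: eq_bigr => v _.
by rewrite !inE; case: andP.
Qed.

Lemma card_classE s i : #|label_class s i| = (\sum_(v < n) (s v == i))%N.
Proof.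
by rewrite -sum1_card big_mkcond /=; apply: eq_bigr => v _; rewrite !inE; case: eqP.
Qed.

Lemma sum_eq_bool (T : finType) (x : T) : (\sum_(i : T) (x == i) = 1)%N.
Proof. by rewrite (bigD1 x) //= eqxx big1 // => i /negPf; rewrite eq_sym => ->. Qed.

Lemma sum_card_class s : (\sum_i #|label_class s i| = n)%N.
Proof.
under eq_bigr do rewrite card_classE.
rewrite exchange_big /=; under eq_bigr do rewrite sum_eq_bool.
by rewrite sum1_card card_ord.
Qed.

Lemma sum_cell_row s t i : (\sum_j cell s t i j = #|label_class s i|)%N.
Proof.
rewrite card_classE; under eq_bigr do rewrite cellE.
rewrite exchange_big /=; apply: eq_bigr => v _.
by case: eqP => _ /=; rewrite ?sum_eq_bool // big1.
Qed.

Lemma cellC s t i j : cell s t i j = cell t s j i.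
Proof. by rewrite /cell finset.setIC. Qed.

Lemma sum_cell_col s t j : (\sum_i cell s t i j = #|label_class t j|)%N.
Proof. by under eq_bigr do rewrite cellC; rewrite sum_cell_row. Qed.

Lemma sum_cell s t : (\sum_i \sum_j cell s t i j = n)%N.
Proof. by under eq_bigr do rewrite sum_cell_row; rewrite sum_card_class. Qed.

Lemma hammingE s t : hamming s t = (\sum_(v < n) (s v != t v))%N.
Proof.
by rewrite /hamming -sum1_card big_mkcond /=; apply: eq_bigr => v _; rewrite !inE; case: eqP.
Qed.

Lemma cell_hamming s s' t i j : (cell s t i j <= cell s' t i j + hamming s s')%N.
Proof.
rewrite !cellE hammingE -big_split /=; apply: leq_sum => v _.
case: (s v =P s' v) => [->|_]; rewrite ?addn0 //=.
exact: leq_trans (leq_b1 _) (leq_addl _ _).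
Qed.

Lemma trace_hamming s s' t (rho : 'S_q) :
  (\sum_i cell s t i (rho i) <= \sum_i cell s' t i (rho i) + hamming s s')%N.
Proof.
have E x : (\sum_i cell x t i (rho i) = \sum_(v < n) (rho (x v) == t v))%N.
  under eq_bigr do rewrite cellE.
  rewrite exchange_big /=; apply: eq_bigr => v _.
  rewrite (bigD1 (x v)) //= eqxx /= eq_sym big1 ?addn0 // => i /negPf.
  by rewrite eq_sym => ->.
rewrite !E hammingE -big_split /=; apply: leq_sum => v _.
case: (s v =P s' v) => [->|_]; rewrite ?addn0 //=.
exact: leq_trans (leq_b1 _) (leq_addl _ _).
Qed.

End Cells.

Lemma le_balanced (q m : nat) (s : labelling (m * q) q) :
  (forall i, #|label_class s i| <= m)%N -> balanced s.
Proof.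
move=> le_m i.
have q_gt0 : (0 < q)%N by case: (q) i => // -[].
rewrite mulnK //; apply/eqP; rewrite eqn_leq le_m /= leqNgt; apply/negP => lt_i.
have: (\sum_i #|label_class s i| < \sum_(i < q) m)%N.
  by rewrite (bigD1 i) // [X in (_ < X)%N](bigD1 i) //= -addSn leq_add // leq_sum.
by rewrite sum_card_class sum_nat_const card_ord mulnC ltnn.
Qed.

(** Moving one vertex from an overfull class to a deficient one decreases the
    total excess by one. *)
Lemma balanced_near (q m : nat) (s : labelling (m * q) q) :
  exists2 s' : labelling (m * q) q, balanced s' &
    (hamming s s' <= \sum_i (#|label_class s i| - m))%N.
Proof.
have [N] := ubnP (\sum_i (#|label_class s i| - m))%N.
elim: N s => // N IH s ltN.
have sumE : (\sum_(i < q) m = \sum_i #|label_class s i|)%N.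
  by rewrite sum_card_class sum_nat_const card_ord mulnC.
case: (boolP [forall i, #|label_class s i| <= m]%N) => [/forallP le_m|].
  exists s; last first.
    by rewrite hammingE big1 // => v _; rewrite eqxx.
  exact: le_balanced.
case/forallPn => a; rewrite -ltnNge => lt_a.
have [b lt_b] : exists b, (#|label_class s b| < m)%N.
  apply/existsP; apply: contraLR lt_a; rewrite negb_exists => /forallP ge_m.
  rewrite -leqNgt leqNgt; apply/negP => lt_a.
  have: (\sum_(i < q) m < \sum_i #|label_class s i|)%N.
    rewrite (bigD1 a) // [X in (_ < X)%N](bigD1 a) //= -addSn leq_add //.
    by apply: leq_sum => i _; rewrite leqNgt ge_m.
  by rewrite sumE ltnn.
have neab : a != b by apply: contraTneq lt_a => ->; rewrite -leqNgt ltnW.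
have [v va] : exists v, v \in label_class s a.
  by apply/card_gt0P; apply: leq_ltn_trans lt_a.
move: (va); rewrite inE => /eqP sva.
pose s1 : labelling (m * q) q := [ffun u => if u == v then b else s u].
have sd : (hamming s s1 <= 1)%N.
  rewrite hammingE (bigD1 v) //= big1 ?addn0 ?leq_b1 // => u /negPf nu.
  by rewrite ffunE nu eqxx.
have c1 i : #|label_class s1 i| = (#|label_class s i| - (i == a) + (i == b))%N.
  have -> : label_class s1 i = if i == b then v |: label_class s b
                               else label_class s i :\ v.
    apply/setP => u; rewrite !inE ffunE.
    case: (eqVneq i b) => [->|neb]; rewrite !inE;
      by case: (eqVneq u v) => [->|_] //=; rewrite ?eqxx // eq_sym (negPf neb).
  case: (eqVneq i b) => [->|neb]; rewrite ?addn0.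
    rewrite eq_sym (negPf neab) subn0 cardsU1 inE sva (negPf neab) addnC //.
  by rewrite (cardsD1 v (label_class s i)) inE sva eq_sym addKn.
have ltN1 : (\sum_i (#|label_class s1 i| - m) < \sum_i (#|label_class s i| - m))%N.
  rewrite (bigD1 a) // [X in (_ < X)%N](bigD1 a) //= -addSn leq_add //.
    by rewrite c1 eqxx (negPf neab) addn0; case: #|label_class s a| lt_a => // c; rewrite ltnS subn1 => le_mc; rewrite subSn.
  apply: leq_sum => i /negPf nea; rewrite c1 nea subn0; case: eqP => [->|_]; rewrite ?addn0 ?addn1 //.
  by have /eqP -> : (#|label_class s b|.+1 - m == 0)%N := lt_b.
have [s' bs' hs'] := IH s1 (leq_trans ltN1 ltN).
exists s' => //; apply: leq_trans ltN1; rewrite -add1n.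
apply: leq_trans (leq_add sd hs'); rewrite !hammingE -big_split /=.
apply: leq_sum => u _; case: (s u =P s1 u) => [->|_] //=.
exact: leq_trans (leq_b1 _) (leq_addr _ _).
Qed.

Section Reals.
Variable R : realType.

(** By [cell2E], the number of ordered pairs of vertices, equal or not, that
    are together in both labellings. *)
Definition cell2 (n q : nat) (s t : labelling n q) : nat :=
  (\sum_i \sum_j cell s t i j ^ 2)%N.

Lemma balanced_mul (m q : nat) (t : labelling (m * q) q) i :
  balanced t -> #|label_class t i| = m.
Proof. by move=> ->; rewrite mulnK //; case: (q) i => // -[]. Qed.

(** The matrix of cells is regular, so it can be paired with itself. *)
Lemma cell2_balanced_le (m q k : nat) (s t : labelling (m * q) q) :
  balanced s -> balanced t ->
  (forall rho : 'S_q, \sum_i cell s t i (rho i) <= k)%N ->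
  (cell2 s t <= m * k)%N.
Proof.
move=> bs bt le_k; rewrite -(ler_nat R) natrM /cell2 natr_sum.
under eq_bigr do rewrite natr_sum.
under eq_bigr do under eq_bigr do rewrite -mulnn natrM.
apply: regular_pairing_le => [i|j|rho].
- by rewrite sum_cell_row balanced_mul.
- by rewrite sum_cell_col balanced_mul.
- by rewrite -natr_sum ler_nat.
Qed.

Lemma cell2_le (m q k h : nat) (s s' t : labelling (m * q) q) :
  balanced s' -> balanced t -> (hamming s s' <= h)%N ->
  (forall rho : 'S_q, \sum_i cell s t i (rho i) <= k)%N ->
  (cell2 s t <= m * (k + h) + 2 * h * (m * q) + q ^ 2 * h ^ 2)%N.
Proof.
move=> bs' bt le_h le_k.
have hC : (hamming s' s <= h)%N.
  by rewrite hammingE; under eq_bigr do rewrite eq_sym; rewrite -hammingE.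
have le1 : (cell2 s' t <= m * (k + h))%N.
  apply: cell2_balanced_le => // rho.
  exact: leq_trans (trace_hamming _ _ _ _) (leq_add (le_k rho) hC).
rewrite -addnA; apply: leq_trans (leq_add le1 (leqnn _)).
have -> : (2 * h * (m * q) = \sum_i \sum_j 2 * h * cell s' t i j)%N.
  by under eq_bigr do rewrite -big_distrr; rewrite -big_distrr /= sum_cell.
have -> : (q ^ 2 * h ^ 2 = \sum_(i < q) \sum_(j < q) h ^ 2)%N.
  under eq_bigr do rewrite sum_nat_const card_ord.
  by rewrite sum_nat_const card_ord mulnA mulnn.
rewrite /cell2 -!big_split; apply: leq_sum => i _; rewrite -!big_split /=.
apply: leq_sum => j _.
have := leq_trans (cell_hamming s s' t i j) (leq_add (leqnn _) le_h).
move: (cell s t i j) (cell s' t i j) => x y le_x.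
have -> : (y ^ 2 + (2 * h * y + h ^ 2) = (y + h) ^ 2)%N by rewrite sqrnD; lia.
by rewrite leq_sqr.
Qed.

Lemma overlap_balanced (m q : nat) (s t : labelling (m * q) q) :
  (0 < m * q)%N -> balanced t ->
  exists rho : 'S_q,
    (forall rho' : 'S_q, \sum_i cell s t i (rho' i) <= \sum_i cell s t i (rho i))%N
    /\ overlap R s t = (\sum_i cell s t i (rho i))%:R / (m * q)%:R - q%:R^-1.
Proof.
move=> n_gt0 bt.
have agreeE rho : agreement R s t rho = (\sum_i cell s t i (rho i))%:R - m%:R.
  rewrite /agreement big_split /= natr_sum; congr (_ + _).
  rewrite sumrN; congr (- _).
  under eq_bigr do rewrite (balanced_mul _ bt).
  rewrite -big_distrr -big_distrl /= -natr_sum sum_card_class mulrA mulVf ?mul1r //.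
  by rewrite pnatr_eq0 -lt0n.
exists [arg max_(rho > (1%g : 'S_q)) \sum_i cell s t i (rho i)]%N.
case: arg_maxnP => // rho _ max_rho; split => [rho'|]; first exact: max_rho.
rewrite /overlap.
have -> : \big[Num.max/agreement R s t 1%g]_(rho0 : 'S_q) agreement R s t rho0
  = agreement R s t rho.
  apply/le_anti/andP; split.
    apply/bigmax_leP; split => [|rho' _]; rewrite !agreeE lerD2r ler_nat; exact: max_rho.
  by apply: (@bigmax_sup _ _ _ _ rho).
rewrite agreeE mulrBr mulrC; congr (_ - _).
rewrite natrM invfM mulrAC mulVf ?mul1r // pnatr_eq0.
by move: n_gt0; rewrite muln_gt0 lt0n => /andP[].
Qed.

(** Pairing the cells with the all-ones matrix: overlaps are nonnegative. *)
Lemma max_trace_ge (n q : nat) (s t : labelling n q) (k : nat) :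
  (forall rho : 'S_q, \sum_i cell s t i (rho i) <= k)%N -> (n <= q * k)%N.
Proof.
move=> le_k; rewrite -(ler_nat R) natrM.
have := @regular_pairing_le R q q (fun _ _ => 1%N) (fun i j => (cell s t i j)%:R) k%:R.
rewrite (_ : \sum_i _ = n%:R); last first.
  rewrite -[in RHS](sum_cell s t) natr_sum; apply: eq_bigr => i _.
  by rewrite natr_sum; apply: eq_bigr => j _; rewrite mul1r.
apply => [i|j|rho]; rewrite ?sum1_card ?card_ord //.
by rewrite -natr_sum ler_nat.
Qed.

End Reals.

(** * Chernoff bounds for product measures *)

Section Chernoff.
Variable R : realType.

(** From exp (- s) >= 1 - s and (1 - s) (1 + s + 2 s^2) >= 1. *)
Lemma expR_le_quad (s : R) : s <= 1 / 2 -> expR s <= 1 + s + 2 * s ^+ 2.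
Proof.
move=> s_le; have e0 := expR_gt0 s.
have h1 : (1 - s) * expR s <= 1.
  have := expR_ge1Dx (- s); rewrite expRN -(ler_pM2r e0) mulVf ?gt_eqF //; lra.
have h2 : 1 <= (1 - s) * (1 + s + 2 * s ^+ 2) by nra.
have s1 : 0 < 1 - s by lra.
by rewrite -(ler_pM2l s1) (le_trans h1).
Qed.

Lemma bernoulli_mgf (p s : R) : 0 <= p <= 1 -> `|s| <= 1 / 2 ->
  1 + p * (expR s - 1) <= expR (p * s + 2 * s ^+ 2).
Proof.
move=> /andP[p0 p1]; rewrite ler_norml => /andP[s0 s1].
apply: le_trans (expR_ge1Dx _); rewrite lerD2l.
have h : p * (expR s - 1) <= p * (s + 2 * s ^+ 2).
  by rewrite ler_wpM2l //; have := expR_le_quad s1; lra.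
have s2 : 0 <= s ^+ 2 by exact: sqr_ge0.
have : p * s ^+ 2 <= s ^+ 2 by rewrite ler_piMl.
by lra.
Qed.

Section Product.
Variables (n q : nat) (w : 'I_n -> 'I_q -> R).
Hypothesis w_ge0 : forall v j, 0 <= w v j.
Hypothesis w_sum : forall v, \sum_j w v j = 1.

Definition prod_weight (t : labelling n q) : R := \prod_v w v (t v).

Lemma prod_weight_ge0 t : 0 <= prod_weight t.
Proof. exact: prodr_ge0. Qed.

Lemma sum_prod_weight : \sum_t prod_weight t = 1.
Proof.
by rewrite -(bigA_distr_bigA (fun v j => w v j)) big1.
Qed.

Definition label_dev (D : {set 'I_n}) (j : 'I_q) (t : labelling n q) : R :=
  (#|D :&: label_class t j|%SET)%:R - \sum_(v in D) w v j.

Lemma prod_weight_mgf (D : {set 'I_n}) (j : 'I_q) (s : R) : `|s| <= 1 / 2 ->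
  \sum_t prod_weight t * expR (s * label_dev D j t) <= expR (2 * s ^+ 2 * n%:R).
Proof.
move=> s_le.
pose F v i := w v i * (if v \in D then expR (s * ((i == j)%:R - w v j)) else 1).
have -> : \sum_t prod_weight t * expR (s * label_dev D j t)
   = \sum_(t : labelling n q) \prod_v F v (t v).
  apply: eq_bigr => t _; rewrite big_split; congr (_ * _) => /=.
  have -> : label_dev D j t = \sum_(v in D) ((t v == j)%:R - w v j).
    rewrite sumrB; congr (_ - _).
    rewrite -sum1_card natr_sum big_mkcond [RHS]big_mkcond /=; apply: eq_bigr => v _.
    by rewrite !inE; case: (v \in D) => //=; case: eqP.
  by rewrite big_distrr expR_sum big_mkcond.
rewrite -(bigA_distr_bigA F) mulrC -[n in n%:R]card_ord -sum1_card natr_sum big_distrl /= expR_sum.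
apply: ler_prod => v _; apply/andP; split.
  apply: sumr_ge0 => i _.
  by rewrite /F mulr_ge0 //; case: ifP => // _; rewrite expR_ge0.
rewrite mul1r /F; case: (v \in D); last first.
  under eq_bigr do rewrite mulr1.
  by rewrite w_sum -expR0 ler_expR mulr_ge0 // sqr_ge0.
under eq_bigr do rewrite mulrBr expRB mulrA.
rewrite -big_distrl /= ler_pdivrMr ?expR_gt0 // -expRD.
rewrite [X in _ <= expR X](_ : _ = w v j * s + 2 * s ^+ 2); last by ring.
have p01 : 0 <= w v j <= 1.
  by rewrite w_ge0 -(w_sum v) (bigD1 j) //= lerDl sumr_ge0.
apply: le_trans (bernoulli_mgf p01 s_le).
rewrite (bigD1 j) //= eqxx mulr1.
rewrite (eq_bigr (fun i => w v i)) => [|i /negPf ->]; last by rewrite mulr0 expR0 mulr1.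
by have := w_sum v; rewrite (bigD1 j) //= => H; lra.
Qed.

(** Markov's inequality for the exponential moments of order g / 4 and - g / 4:
    s = g / 4 minimises 2 s^2 - s g. *)
Lemma chernoff_tail (D : {set 'I_n}) (j : 'I_q) (g : R) : 0 < g <= 1 ->
  \sum_(t | g * n%:R < `|label_dev D j t|) prod_weight t
    <= 2 * expR (- (g ^+ 2 / 8 * n%:R)).
Proof.
move=> /andP[g0 g1].
have H (s : R) : `|s| = g / 4 ->
   \sum_t prod_weight t * expR (s * label_dev D j t - g ^+ 2 / 4 * n%:R)
    <= expR (- (g ^+ 2 / 8 * n%:R)).
  move=> sE; under eq_bigr do rewrite expRD mulrA.
  rewrite -big_distrl /= expRN ler_pdivrMr ?expR_gt0 // -expRD.
  apply: le_trans (prod_weight_mgf _ _ _) _; first by rewrite sE; lra.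
  rewrite ler_expR.
  have -> : s ^+ 2 = (g / 4) ^+ 2 by rewrite -sE -normrX ger0_norm // sqr_ge0.
  by rewrite (_ : 2 * (g / 4) ^+ 2 * n%:R = - (g ^+ 2 / 8 * n%:R) + g ^+ 2 / 4 * n%:R) //; field.
have Hp := H (g / 4); have Hn := H (- (g / 4)).
rewrite mulr_natl mulr2n.
apply: le_trans (lerD (Hp _) (Hn _)); rewrite ?normrN ?gtr0_norm ?divr_gt0 //.
rewrite -big_split [X in X <= _]big_mkcond /=; apply: ler_sum => t _.
case: ifP => [dev|_]; last by rewrite addr_ge0 // mulr_ge0 ?prod_weight_ge0 ?expR_ge0.
rewrite -mulrDr ler_peMr ?prod_weight_ge0 //.
have h : 0 <= g / 4 * (`|label_dev D j t| - g * n%:R) by rewrite mulr_ge0; lra.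
move: h; case: (ger0P (label_dev D j t)) => _ h.
  apply: ler_wpDr; rewrite ?expR_ge0 // -[leLHS]expR0 ler_expR; lra.
apply: ler_wpDl; rewrite ?expR_ge0 // -[leLHS]expR0 ler_expR; lra.
Qed.

End Product.

Section RandomGraph.
Variables (E : finType) (p : E -> R).
Hypothesis p01 : forall e, 0 <= p e <= 1.

Definition graph_weight (G : {set E}) : R :=
  \prod_e (if e \in G then p e else 1 - p e).

Lemma graph_weight_ge0 G : 0 <= graph_weight G.
Proof. by apply: prodr_ge0 => e _; case/andP: (p01 e) => ? ?; case: ifP => _; lra. Qed.

(** The edges are independent, so the generating function factorises. *)
Lemma graph_weight_mgf (z : E -> R) :
  \sum_G graph_weight G * \prod_(e in G) z e = \prod_e (1 + p e * (z e - 1)).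
Proof.
rewrite [RHS](eq_bigr (fun e => p e * z e + (1 - p e))) => [|e _]; last by ring.
rewrite (bigA_distr 1 _ (fun e => p e * z e) (fun e => 1 - p e)).
apply: eq_big => // G _; rewrite /graph_weight [X in _ * X]big_mkcond -big_split /=.
by apply: eq_bigr => e _; case: ifP; rewrite ?mulr1.
Qed.

Lemma sum_graph_weight : \sum_G graph_weight G = 1.
Proof.
transitivity (\sum_G graph_weight G * \prod_(e in G) (1 : R)).
  by apply: eq_bigr => G _; rewrite big1 // mulr1.
by rewrite (graph_weight_mgf (fun=> 1)) big1 // => e _; rewrite subrr mulr0 addr0.
Qed.

Lemma graph_weight_mgf_le (z : E -> R) : (forall e, 0 <= z e) ->
  \sum_G graph_weight G * \prod_(e in G) z e <= expR (\sum_e p e * (z e - 1)).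
Proof.
move=> z0; rewrite graph_weight_mgf expR_sum; apply: ler_prod => e _.
rewrite expR_ge1Dx andbT; have /andP[? ?] := p01 e; have := z0 e; nra.
Qed.

End RandomGraph.
End Chernoff.

(** * Mean numbers of edges inside and between groups *)

Lemma sum_sym_pairs (n : nat) (r : 'I_n -> 'I_n -> nat) :
  (forall u v, r u v = r v u) ->
  (\sum_u \sum_v r u v
   = \sum_u r u u + 2 * \sum_(e : vpair n) r (val e).1 (val e).2)%N.
Proof.
move=> rC; pose F (p : 'I_n * 'I_n) := r p.1 p.2.
have EV : (\sum_(e : vpair n) r (val e).1 (val e).2
           = \sum_(p : 'I_n * 'I_n | (p.1 < p.2)%N) F p)%N.
  by rewrite (big_sub (fun p : 'I_n * 'I_n => p.1 < p.2)%N F).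
have EG : (\sum_(p : 'I_n * 'I_n | (p.2 < p.1)%N) F p
           = \sum_(p : 'I_n * 'I_n | (p.1 < p.2)%N) F p)%N.
  pose sw (p : 'I_n * 'I_n) := (p.2, p.1).
  rewrite (reindex_inj (h := sw)) /=; last by move=> [a b] [c d] [-> ->].
  by apply: eq_bigr => p _; rewrite /F /= rC.
have ED : (\sum_u r u u = \sum_(p : 'I_n * 'I_n | p.1 == p.2) F p)%N.
  rewrite -(pair_big_dep xpredT (fun u v => u == v) (fun u v => r u v)) /=.
  by apply: eq_bigr => u _; rewrite (big_pred1 u) // => v; rewrite eq_sym.
rewrite pair_bigA ED EV mul2n -addnn -[X in (_ + (X + _))%N]EG.
rewrite [X in (_ = X + _)%N]big_mkcond [X in (_ + (X + _))%N]big_mkcond.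
rewrite [X in (_ + (_ + X))%N]big_mkcond -!big_split /=.
apply: eq_bigr => -[u v] _ /=; rewrite -(inj_eq val_inj) /=.
by case: (ltngtP u v); rewrite ?addn0.
Qed.

Lemma cell2E (n q : nat) (s t : labelling n q) :
  cell2 s t = (\sum_u \sum_v ((s u == s v) && (t u == t v)))%N.
Proof.
rewrite /cell2; under eq_bigr do under eq_bigr do rewrite -mulnn !cellE big_distrl /=.
under eq_bigr do rewrite exchange_big /=.
rewrite exchange_big /=; apply: eq_bigr => u _.
rewrite (bigD1 (s u)) //= [X in (_ + X)%N]big1 => [|i /negPf ne]; last first.
  by apply: big1 => j _; rewrite eq_sym ne.
rewrite addn0 (bigD1 (t u)) //= [X in (_ + X)%N]big1 => [|j /negPf ne]; last first.
  by rewrite [t u == _]eq_sym ne andbF.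
by rewrite addn0 !eqxx mul1n; apply: eq_bigr => v _; rewrite [s v == _]eq_sym [t v == _]eq_sym.
Qed.

Lemma cell2_self (n q : nat) (s : labelling n q) :
  cell2 s s = (\sum_i #|label_class s i| ^ 2)%N.
Proof.
rewrite /cell2; apply: eq_bigr => i _.
rewrite (bigD1 i) //= /cell finset.setIid big1 ?addn0 // => j ne.
rewrite (_ : _ :&: _ = finset.set0) ?cards0 //; apply/setP => v; rewrite !inE.
by case: eqP => // ->; rewrite eq_sym (negPf ne).
Qed.

Lemma cell2_diag (q m : nat) (t : labelling (m * q) q) :
  balanced t -> cell2 t t = (q * m ^ 2)%N.
Proof.
move=> bt; rewrite cell2_self; under eq_bigr do rewrite (balanced_mul _ bt).
by rewrite sum_nat_const card_ord.
Qed.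

Lemma cell2_pairs (n q : nat) (s t : labelling n q) :
  (cell2 s t = n + 2 * \sum_(e : vpair n) (same_group s e && same_group t e))%N.
Proof.
rewrite cell2E sum_sym_pairs => [|u v]; last by rewrite eq_sym [t u == _]eq_sym.
by under eq_bigr do rewrite !eqxx; rewrite sum1_card card_ord.
Qed.

Lemma card_vpair n : (n ^ 2 = n + 2 * #|{: vpair n}|)%N.
Proof.
have := @sum_sym_pairs n (fun _ _ => 1%N) (fun _ _ => erefl).
by rewrite !sum1_card card_ord sum_nat_const card_ord mulnn => ->.
Qed.

Section Means.
Variables (R : realType) (q : nat) (cin cout : R).

Lemma cell2_pairsR n (s t : labelling n q) :
  (cell2 s t)%:R
  = n%:R + 2 * \sum_(e : vpair n) (same_group s e && same_group t e)%:R :> R.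
Proof. by rewrite cell2_pairs natrD natrM natr_sum. Qed.

(** Mean number of edges inside the groups of t when s is planted. *)
Definition mu_in n (s t : labelling n q) : R :=
  \sum_(e | same_group t e) edge_prob cin cout s e.
Definition mu_out n (s t : labelling n q) : R :=
  \sum_(e | ~~ same_group t e) edge_prob cin cout s e.

Lemma mu_inE n (s t : labelling n q) : (0 < n)%N ->
  mu_in s t = ((cin - cout) * ((cell2 s t)%:R - n%:R)
               + cout * ((cell2 t t)%:R - n%:R)) / (2 * n%:R).
Proof.
move=> n_gt0; have n0 : (n%:R : R) != 0 by rewrite pnatr_eq0 -lt0n.
rewrite !cell2_pairsR.
have -> : mu_in s t = (cin - cout) / n%:R * (\sum_(e : vpair n) (same_group s e && same_group t e)%:R)
       + cout / n%:R * (\sum_(e : vpair n) (same_group t e && same_group t e)%:R).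
  rewrite /mu_in big_mkcond !big_distrr -big_split /=; apply: eq_bigr => e _.
  by rewrite /edge_prob; case: (same_group t e); case: (same_group s e) => /=; field.
by field.
Qed.

Lemma mu_totE n (s t : labelling n q) : (0 < n)%N ->
  mu_in s t + mu_out s t = ((cin - cout) * ((cell2 s s)%:R - n%:R)
               + cout * ((n ^ 2)%:R - n%:R)) / (2 * n%:R).
Proof.
move=> n_gt0; have n0 : (n%:R : R) != 0 by rewrite pnatr_eq0 -lt0n.
rewrite cell2_pairsR card_vpair -sum1_card natrD natrM natr_sum.
rewrite /mu_in /mu_out.
rewrite -(bigID (fun e => same_group t e) xpredT) /=.
have -> : \sum_(e : vpair n) edge_prob cin cout s e
     = (cin - cout) / n%:R * (\sum_(e : vpair n) (same_group s e && same_group s e)%:R)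
       + cout / n%:R * (\sum_(e : vpair n) 1).
  rewrite !big_distrr -big_split /=; apply: eq_bigr => e _.
  by rewrite /edge_prob; case: (same_group s e) => /=; field.
by field.
Qed.

Lemma edge_prob01 n (s : labelling n q) :
  0 <= cin -> 0 <= cout -> cin <= n%:R -> cout <= n%:R ->
  forall e, 0 <= edge_prob cin cout s e <= 1.
Proof.
move=> ci0 co0 ci1 co1 e.
have n_gt0 : (0 < n)%N by case: e => -[u v] _; exact: leq_ltn_trans (ltn_ord u).
rewrite /edge_prob; have np : 0 < n%:R :> R by rewrite ltr0n.
by case: ifP => _; rewrite divr_ge0 ?(ltW np) //= ler_pdivrMr // mul1r.
Qed.

(** Markov's inequality for exp (ti m_in + to m_out), with the bound
    1 + p (z - 1) <= exp (p (z - 1)) on each edge. The two counts are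
    exponentiated together because t is judged on both. *)
Lemma edge_count_tail n (s t : labelling n q) (ti to a : R) :
  0 <= cin -> 0 <= cout -> cin <= n%:R -> cout <= n%:R ->
  \sum_(G : graph n | a <= ti * (m_in G t)%:R + to * (m_out G t)%:R)
     graph_weight (edge_prob cin cout s) G
  <= expR ((expR ti - 1) * mu_in s t + (expR to - 1) * mu_out s t - a).
Proof.
move=> ci0 co0 ci1 co1.
have p01 := edge_prob01 s ci0 co0 ci1 co1.
pose z e : R := if same_group t e then expR ti else expR to.
have z0 e : 0 <= z e by rewrite /z; case: ifP; rewrite expR_ge0.
have zE (G : graph n) : \prod_(e in G) z e = expR (ti * (m_in G t)%:R + to * (m_out G t)%:R).
  rewrite expRD !expRM_natr /m_in /m_out (bigID (same_group t)) /=; congr (_ * _).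
    rewrite -prodr_const; apply: eq_big => [e|e /andP[_]]; first by rewrite inE.
    by rewrite /z => ->.
  rewrite -prodr_const; apply: eq_big => [e|e /andP[_]]; first by rewrite inE.
  by rewrite /z => /negPf ->.
rewrite expRB ler_pdivlMr ?expR_gt0 // big_distrl /=.
have -> : (expR ti - 1) * mu_in s t + (expR to - 1) * mu_out s t
     = \sum_e edge_prob cin cout s e * (z e - 1).
  rewrite /mu_in /mu_out [RHS](bigID (same_group t)) !big_distrr /=.
  by congr (_ + _); apply: eq_bigr => e; rewrite /z; [move=> ->|move=> /negPf ->]; rewrite mulrC.
apply: le_trans (graph_weight_mgf_le p01 z0).
rewrite [leLHS]big_mkcond; apply: ler_sum => G _; rewrite zE.
case: ifP => le_a; last by rewrite mulr_ge0 ?graph_weight_ge0 ?expR_ge0.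
by rewrite ler_wpM2l ?graph_weight_ge0 // ler_expR.
Qed.
End Means.

(** * The smallest root *)

Section RelativeEntropy.
Variable R : realType.

Lemma mul_ln_div (a b : R) : 0 <= a -> 0 < b -> a * ln (a / b) = a * ln a - a * ln b.
Proof.
rewrite le_eqVlt => /predU1P[<-|a0] b0; first by rewrite !mul0r subr0.
by rewrite ln_div ?posrE // mulrBr.
Qed.

Lemma ln_le_sub1 (x : R) : 0 < x -> ln x <= x - 1.
Proof. by move=> x0; rewrite -[x in ln x](subrKC 1) le_ln1Dx // ltrBrDl addrN. Qed.

Lemma ln_lt_sub1 (x : R) : 0 < x -> x != 1 -> ln x < x - 1.
Proof.
move=> x0 x1; have := @expR_gt1Dx R (ln x); rewrite lnK ?posrE // => H.
by have := H _; rewrite ln_eq0 // => /(_ x1); lra.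
Qed.

Lemma mul_ln_div_ge (a b : R) : 0 <= a -> 0 < b -> a - b <= a * ln (a / b).
Proof.
rewrite le_eqVlt => /predU1P[<-|a0] b0; first by rewrite mul0r; lra.
have h := ln_le_sub1 (divr_gt0 b0 a0).
have -> : ln (a / b) = - ln (b / a) by rewrite !ln_div ?posrE // opprB.
have : a * ln (b / a) <= a * (b / a - 1) by rewrite ler_pM2l.
rewrite mulrBr mulrCA divff ?gt_eqF //; lra.
Qed.

Lemma mul_ln_div_gt (a b : R) : 0 <= a -> 0 < b -> a != b -> a - b < a * ln (a / b).
Proof.
rewrite le_eqVlt => /predU1P[<-|a0] b0 ab; first by rewrite mul0r; lra.
have ba1 : b / a != 1.
  by apply: contra ab => /eqP e; rewrite -(divfK (lt0r_neq0 a0) b) e mul1r.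
have h := ln_lt_sub1 (divr_gt0 b0 a0) ba1.
have -> : ln (a / b) = - ln (b / a) by rewrite !ln_div ?posrE // opprB.
have : a * ln (b / a) < a * (b / a - 1) by rewrite ltr_pM2l.
rewrite mulrBr mulrCA divff ?gt_eqF //; lra.
Qed.

Lemma mul_ln_div_le (a b : R) : 0 <= a -> 0 < b -> a * ln (a / b) <= a * (a / b - 1).
Proof.
rewrite le_eqVlt => /predU1P[<-|a0] b0; first by rewrite !mul0r.
by rewrite ler_pM2l // ln_le_sub1 // divr_gt0.
Qed.

End RelativeEntropy.

Section Root.
Variables (R : realType) (q : nat) (l d : R).
Hypothesis q_ge2 : (2 <= q)%N.
Hypothesis l_neq0 : l != 0.
Hypothesis l_le1 : l <= 1.
Hypothesis l_ge : 0 <= 1 + (q%:R - 1) * l.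
Hypothesis d_gt0 : 0 < d.

(** A / q and A' / q are the expected fractions of edges inside and between the
    planted groups, B b / q and B' b / q those for a partition of collision
    b + 1 / q; root_den is q times the relative entropy of the first pair of
    fractions from the second. *)
Variables (Q A A' : R) (B B' : R -> R).
Hypothesis QE : Q = q%:R.
Hypothesis AE : A = 1 + (Q - 1) * l.
Hypothesis A'E : A' = (Q - 1) * (1 - l).
Hypothesis BE : forall b, B b = 1 + Q * b * l.
Hypothesis B'E : forall b, B' b = Q - 1 - Q * b * l.

Lemma Q_ge2 : 2 <= Q. Proof. by rewrite QE ler_nat. Qed.
Lemma Q_gt0 : 0 < Q. Proof. exact: lt_le_trans Q_ge2. Qed.
Lemma A_ge0 : 0 <= A. Proof. by rewrite AE QE. Qed.
Lemma A'_ge0 : 0 <= A'. Proof. by rewrite A'E mulr_ge0 //; have := Q_ge2; have := l_le1; lra. Qed.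

#[local] Hint Resolve Q_gt0 A_ge0 A'_ge0 : core.

Lemma l_geN1 : -1 <= l.
Proof. have := Q_ge2; have := A_ge0; rewrite !AE; nra. Qed.

Lemma B_gap b : B b - A = - (Q * l * (1 - Q^-1 - b)).
Proof. by rewrite !BE !AE; field; rewrite gt_eqF. Qed.

Lemma B'_gap b : B' b - A' = Q * l * (1 - Q^-1 - b).
Proof. by rewrite !B'E !A'E; field; rewrite gt_eqF. Qed.

Lemma B_gt0 b : 0 <= b < 1 - Q^-1 -> 0 < B b.
Proof.
move=> /andP[b0 b1]; case: (ltrP l 0) => l0.
  have y0 : 0 < - (Q * l * (1 - Q^-1 - b)).
    by rewrite oppr_gt0 mulrC pmulr_rlt0 ?pmulr_rlt0 //; lra.
  by have := B_gap b; have := A_ge0; lra.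
by rewrite !BE; have : 0 <= Q * b * l; [rewrite !mulr_ge0 // ltW|lra].
Qed.

Lemma B'_gt0 b : 0 <= b < 1 - Q^-1 -> 0 < B' b.
Proof.
move=> /andP[b0 b1]; case: (lerP l 0) => l0.
  have : 0 <= - (Q * b * l) by rewrite -mulrN !mulr_ge0 ?oppr_ge0 // ltW.
  by rewrite !B'E; have := Q_ge2; lra.
have y0 : 0 < Q * l * (1 - Q^-1 - b) by rewrite !mulr_gt0 //; lra.
by have := B'_gap b; have := A'_ge0; lra.
Qed.

Lemma root_denE b : 0 < B b -> 0 < B' b ->
  root_den q l b = A * ln A + A' * ln A' - A * ln (B b) - A' * ln (B' b).
Proof.
by move=> B0 B'0; rewrite /root_den -QE -AE -A'E -BE -B'E !mul_ln_div //; ring.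
Qed.

Lemma root_den_gt0 b : 0 <= b < 1 - Q^-1 -> 0 < root_den q l b.
Proof.
move=> hb; have b1 := B_gt0 hb; have b'1 := B'_gt0 hb.
rewrite /root_den -QE -AE -A'E -BE -B'E.
have ne : A != B b.
  rewrite -subr_eq0 -oppr_eq0 opprB B_gap oppr_eq0 !mulf_neq0 ?(gt_eqF Q_gt0) //.
  by rewrite gt_eqF //; case/andP: hb => h1 h2; lra.
have := mul_ln_div_gt A_ge0 b1 ne; have := mul_ln_div_ge A'_ge0 b'1.
by have := B_gap b; have := B'_gap b; lra.
Qed.

(** Up to the factor 2q, root_num is the entropy of a distribution on q labels
    with one probability b + 1/q and the others equal, hence at most log q. *)
Lemma root_num_le b : 0 <= b + Q^-1 <= 1 -> root_num q b <= 2 * Q * ln Q.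
Proof.
move=> /andP[x0 x1]; rewrite /root_num /entropy -QE ler_pM2l ?mulr_gt0 //.
have -> : 1 - Q^-1 - b = 1 - (b + Q^-1) by ring.
move: (b + Q^-1) x0 x1 => x x0 x1.
have iQ : 0 < Q^-1 by rewrite invr_gt0.
have Qm : 0 < (Q - 1) / Q by rewrite divr_gt0 //; have := Q_ge2; lra.
have x1' : 0 <= 1 - x by lra.
have := mul_ln_div_ge x0 iQ; have := mul_ln_div_ge x1' Qm.
rewrite !mul_ln_div // ln_div ?posrE //; last by have := Q_ge2; lra.
rewrite lnV ?posrE //.
have : (Q - 1) / Q = 1 - Q^-1 by field; rewrite gt_eqF.
by move=> ->; lra.
Qed.

Lemma root_num0 : root_num q (0 : R) = 2 * Q * ln Q.
Proof.
rewrite /root_num /entropy -QE; congr (_ * _); rewrite add0r subr0.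
have -> : 1 - Q^-1 = (Q - 1) / Q by field; rewrite gt_eqF.
rewrite ln_div ?posrE //; last by have := Q_ge2; lra.
by rewrite lnV ?posrE //; field; rewrite gt_eqF.
Qed.

Lemma root_den0 :
  root_den q l 0 = (1 + (q%:R - 1) * l) * ln (1 + (q%:R - 1) * l)
         + (q%:R - 1) * (1 - l) * ln (1 - l).
Proof.
rewrite /root_den mulr0 mul0r addr0 subr0 divr1; congr (_ + _ * ln _).
rewrite mulrAC divff ?mul1r // gt_eqF //; have := Q_ge2; rewrite !QE; lra.
Qed.

(** For negative b the pair (B b, B' b) lies further away from (A, A') than at
    b = 0, so no root is negative. The hypothesis excludes the endpoint
    b = - 1/q when the logarithms there degenerate. *)
Lemma root_den_neg (b : R) : - Q^-1 <= b <= 0 -> root_den q l b != 0 ->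
  root_den q l 0 <= root_den q l b.
Proof.
move=> /andP[b1 b0] den0.
have Qb : -1 <= Q * b.
  by rewrite -(ler_pM2l Q_gt0) mulrN divff ?gt_eqF // in b1.
have Qb0 : Q * b <= 0 by rewrite pmulr_rle0.
have [lB lB'] : 0 <= B b /\ 0 <= B' b.
  have lN1 := l_geN1; have q2 := Q_ge2; have l1 := l_le1; rewrite !BE !B'E.
  case: (lerP 0 l) => l0.
    have h1 : 0 <= (Q * b + 1) * l by rewrite mulr_ge0 //; lra.
    have h2 : 0 <= - (Q * b) * l by rewrite mulr_ge0 // oppr_ge0.
    by split; lra.
  have h1 : 0 <= (Q * b + 1) * - l by rewrite mulr_ge0 //; lra.
  have h2 : 0 <= Q * b * l by rewrite mulr_le0 // ltW.
  by split; lra.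
have B0 : 0 < B b.
  rewrite lt_neqAle lB andbT eq_sym; apply: contra den0 => /eqP Bb0.
  have l1 : l = 1.
    apply/le_anti; rewrite l_le1 leNgt /=; apply/negP => lt1.
    move: Bb0; rewrite BE; case: (lerP 0 l) => l0.
      by have : 0 <= (Q * b + 1) * l; [rewrite mulr_ge0 //; lra|lra].
    by have : 0 <= Q * b * l; [rewrite mulr_le0 // ltW|lra].
  rewrite /root_den -QE -BE Bb0 invr0 mulr0 (@ln0 R 0) // mulr0 add0r.
  by rewrite l1 subrr mulr0 mul0r.
have B'0 : 0 < B' b.
  rewrite lt_neqAle lB' andbT eq_sym; apply: contra den0 => /eqP Bb0.
  have A0 : A = 0.
    apply/le_anti; rewrite A_ge0 andbT; move: Bb0; rewrite B'E AE => Bb0.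
    have q2 := Q_ge2; have lN1 := l_geN1.
    case: (lerP 0 l) => l0.
      by have : 0 <= - (Q * b) * l; [rewrite mulr_ge0 // oppr_ge0|lra].
    have h1 : 0 <= (Q * b + 1) * - l by rewrite mulr_ge0 //; lra.
    by have : 0 <= (Q - 2) * (- l - (Q - 1)); [rewrite mulr_ge0 //; lra|nra].
  rewrite /root_den -QE -B'E Bb0 invr0 mulr0 (@ln0 R 0) // mulr0 addr0.
  by rewrite -AE A0 mul0r.
have z01 : 0 <= (0 : R) < 1 - Q^-1.
  by rewrite lexx subr_gt0 invf_lt1 //; have := Q_ge2; lra.
rewrite (root_denE (B_gt0 z01) (B'_gt0 z01)) (root_denE B0) //.
have h1 : ln (B b) <= B b - 1 by exact: ln_le_sub1.
have Q1 : 0 < Q - 1 by have := Q_ge2; lra.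
have h2 : ln (B' b) - ln (Q - 1) <= B' b / (Q - 1) - 1.
  by rewrite -ln_div ?posrE // ln_le_sub1 // divr_gt0.
have -> : B 0 = 1 by rewrite !BE mulr0 mul0r addr0.
have -> : B' 0 = Q - 1 by rewrite !B'E mulr0 mul0r subr0.
rewrite ln1 mulr0.
have k1 : A * ln (B b) <= A * (B b - 1) by rewrite ler_wpM2l.
have k2 : A' * (ln (B' b) - ln (Q - 1)) <= A' * (B' b / (Q - 1) - 1) by rewrite ler_wpM2l.
have k3 : A * (B b - 1) + A' * (B' b / (Q - 1) - 1) = Q * b * (Q * l ^+ 2).
  by rewrite !AE !A'E !BE !B'E; field; rewrite gt_eqF.
have k4 : Q * b * (Q * l ^+ 2) <= 0.
  by rewrite mulr_le0_ge0 // mulr_ge0 ?sqr_ge0 // ltW.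
by lra.
Qed.

(** This is root_num - d * root_den with the quotients inside the logarithms
    separated, which makes continuity evident also when A or A' vanishes. *)
Let g b := root_num q b - d * (A * ln A + A' * ln A' - A * ln (B b) - A' * ln (B' b)).

Lemma g_continuous b : 0 <= b < 1 - Q^-1 -> {for b, continuous g}.
Proof.
move=> hb; have b1 := B_gt0 hb; have b'1 := B'_gt0 hb.
have iQ : 0 < Q^-1 by rewrite invr_gt0.
have x0 : 0 < b + Q^-1 by case/andP: hb; lra.
have x1 : 0 < 1 - (b + Q^-1) by case/andP: hb; lra.
have cl (f : R -> R) : {for b, continuous f} -> 0 < f b -> {for b, continuous (fun b => ln (f b))}.
  move=> cf f0; apply: continuous_comp => //; exact: continuous_ln.
have cc (c : R) : {for b, continuous (fun _ : R => c)} by exact: cvg_cst.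
have ci : {for b, continuous (fun x : R => x)} by exact: cvg_id.
have cX : {for b, continuous (fun b : R => b + q%:R^-1)} by exact: (cvgD ci (cc _)).
have cY : {for b, continuous (fun b : R => 1 - (b + q%:R^-1))} by exact: (cvgB (cc _) cX).
have cB : {for b, continuous B}.
  have -> : B = (fun b => 1 + Q * b * l) by apply/funext.
  exact: (cvgD (cc _) (cvgM (cvgM (cc _) ci) (cc _))).
have cB' : {for b, continuous B'}.
  have -> : B' = (fun b => Q - 1 - Q * b * l) by apply/funext.
  exact: (cvgB (cc _) (cvgM (cvgM (cc _) ci) (cc _))).
rewrite QE in x0 x1; have clX := cl _ cX x0; have clY := cl _ cY x1.
have clB := cl _ cB b1; have clB' := cl _ cB' b'1.
apply: (@cvgB _ _ _ _ _ _ (fun b => d * _)); last first.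
  exact: (cvgM (cc _) (cvgB (cvgB (cc _) (cvgM (cc _) clB)) (cvgM (cc _) clB'))).
apply: (cvgM (cc _)); apply: cvgD; last first.
  exact: (cvgM (cvgB (cc _) ci) (cc _)).
exact: (cvgB (cvgM (cvgN cX) clX) (cvgM cY clY)).
Qed.

Lemma gE b : 0 <= b < 1 - Q^-1 -> g b = root_num q b - d * root_den q l b.
Proof. by move=> hb; rewrite root_denE ?B_gt0 ?B'_gt0. Qed.

(** At distance y from the endpoint 1 - 1/q, the numerator is at least of order
    y log (1 / y) and the denominator at most of order y. *)
Lemma exists_g_ge0 : exists2 b, 0 <= b < 1 - Q^-1 & 0 <= g b.
Proof.
(* This makes - 2 Q y ln y larger than d times the bound Q^2 y of root_den. *)
pose y : R := expR (- (d * Q / 2 + 1)).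
have dQ : 0 <= d * Q / 2 by rewrite !mulr_ge0 // ltW.
have y0 : 0 < y by exact: expR_gt0.
have y12 : y < 1 / 2.
  have : 2 < expR (d * Q / 2 + 1) :> R.
    have : d * Q / 2 + 1 != 0 by rewrite gt_eqF //; lra.
    by move=> /expR_gt1Dx; lra.
  by rewrite /y expRN => h; rewrite div1r ltf_pV2 ?posrE ?expR_gt0.
have iQ : Q^-1 <= 1 / 2 by rewrite div1r lef_pV2 ?posrE ?Q_ge2.
pose b := 1 - Q^-1 - y.
have hb : 0 <= b < 1 - Q^-1 by rewrite /b; apply/andP; split; lra.
exists b => //; have b1 := B_gt0 hb; have b'1 := B'_gt0 hb.
have By := B_gap b; have B'y := B'_gap b.
have yE : 1 - Q^-1 - b = y by rewrite /b; ring.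
rewrite yE in By B'y.
have den_le : root_den q l b <= Q ^+ 2 * y.
  rewrite /root_den -QE -AE -A'E -BE -B'E.
  have AQ : A <= Q by have := A'_ge0; rewrite AE A'E; lra.
  have A'Q : A' <= Q by have := A_ge0; rewrite !AE !A'E; lra.
  have e1 : A * (A / B b - 1) = Q * l * y * (A / B b).
    have -> : Q * l * y = A - B b by lra.
    by field; rewrite gt_eqF.
  have e2 : A' * (A' / B' b - 1) = - (Q * l * y * (A' / B' b)).
    have -> : Q * l * y = B' b - A' by lra.
    by field; rewrite gt_eqF.
  have k1 := mul_ln_div_le A_ge0 b1; have k2 := mul_ln_div_le A'_ge0 b'1.
  rewrite e1 in k1; rewrite e2 in k2.
  have r1 : 0 <= A / B b by rewrite divr_ge0 // ltW.
  have r2 : 0 <= A' / B' b by rewrite divr_ge0 // ltW.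
  have Qy : 0 <= Q * y by rewrite mulr_ge0 // ltW.
  case: (lerP 0 l) => l0.
    have r1Q : A / B b <= Q.
      rewrite ler_pdivrMr // (le_trans AQ) // ler_peMr // ?(ltW Q_gt0) //.
      by rewrite !BE; have : 0 <= Q * b * l; [rewrite !mulr_ge0 // ?(ltW Q_gt0) //; case/andP: hb|lra].
    have t1 : Q * y * (l * (A / B b)) <= Q * y * Q.
      rewrite ler_wpM2l // -[leRHS]mul1r; apply: ler_pM => //.
    have t2 : 0 <= Q * y * (l * (A' / B' b)) by rewrite mulr_ge0 // mulr_ge0.
    by lra.
  have r2Q : A' / B' b <= Q.
    rewrite ler_pdivrMr // (le_trans A'Q) // ler_peMr // ?(ltW Q_gt0) //.
    rewrite !B'E; have : 0 <= - (Q * b * l).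
      by rewrite -mulrN !mulr_ge0 ?(ltW Q_gt0) ?oppr_ge0 ?(ltW l0) //; case/andP: hb.
    by have := Q_ge2; lra.
  have t1 : Q * y * (- l * (A' / B' b)) <= Q * y * Q.
    rewrite ler_wpM2l // -[leRHS]mul1r; apply: ler_pM => //; have := l_geN1; lra.
  have t2 : 0 <= Q * y * (- l * (A / B b)) by rewrite mulr_ge0 // mulr_ge0 // oppr_ge0 ltW.
  by lra.
rewrite gE // subr_ge0; apply: (@le_trans _ _ (d * (Q ^+ 2 * y))).
  by rewrite ler_wpM2l // ltW.
have -> : d * (Q ^+ 2 * y) = 2 * Q * (y * (d * Q / 2)) by field.
rewrite /root_num /entropy -QE ler_pM2l ?mulr_gt0 //.
have -> : 1 - Q^-1 - b = y by rewrite /b; ring.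
have -> : b + Q^-1 = 1 - y by rewrite /b; ring.
have -> : 1 - (1 - y) = y by ring.
have lny : ln y = - (d * Q / 2 + 1) by rewrite /y expRK.
rewrite lny.
have p1 : 0 <= - ((1 - y) * ln (1 - y)).
  by rewrite -mulrN mulr_ge0 ?oppr_ge0 ?ln_le0 //; lra.
have p2 : 0 <= y * ln (Q - 1).
  by rewrite mulr_ge0 ?(ltW y0) // ln_ge0 //; have := Q_ge2; lra.
by lra.
Qed.

(** By [root_num0] and [root_den0], the condition d > d_upper. *)
Hypothesis above : root_num q (0 : R) < d * root_den q l 0.

(** beta is the infimum of the b >= 0 with g b >= 0. *)
Lemma exists_smallest_root : exists beta,
  [/\ smallest_root q d l beta, 0 < beta, beta < 1 - q%:R^-1 &
      forall b, 0 <= b <= beta -> root_num q b <= d * root_den q l b].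
Proof.
have z01 : 0 <= (0 : R) < 1 - Q^-1.
  by rewrite lexx subr_gt0 invf_lt1 //; have := Q_ge2; lra.
have [b1 hb1 gb1] := exists_g_ge0.
pose Z : set R := [set b | 0 <= b <= b1 /\ 0 <= g b]%classic.
have Z1 : Z b1 by split => //; rewrite lexx andbT; case/andP: hb1.
have lbZ : lbound Z 0 by move=> b [/andP[]].
have infZ : has_inf Z by split; [exists b1|exists 0].
pose beta := inf Z.
have beta0 : 0 <= beta by apply: lb_le_inf => //; exists b1.
have beta1 : beta <= b1 by apply: ge_inf => //; exists 0.
have hbeta : 0 <= beta < 1 - Q^-1.
  by rewrite beta0 (le_lt_trans beta1) //; case/andP: hb1.
have cg := g_continuous hbeta.
have gbeta : 0 <= g beta.
  rewrite leNgt; apply/negP => gn.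
  have : \forall x \near beta, g x < 0.
    by have := cg; move/cvgr_lt => /(_ 0 gn).
  rewrite -nbhs_nearE => /nbhs_ballP[e /= e0 he].
  have [z Zz zlt] := inf_adherent e0 infZ.
  have bz : beta <= z by apply: ge_inf => //; exists 0.
  have := he z; rewrite /ball /= ler0_norm ?subr_le0 // => /(_ _).
  by case: Zz => _ gz; move=> H; have := H _; rewrite -/beta in zlt; move=> /(_ ltac:(lra)); lra.
have g0 : g 0 < 0 by rewrite gE // subr_lt0.
have beta_gt0 : 0 < beta.
  by rewrite lt_neqAle beta0 andbT; apply/eqP => e; rewrite -e in gbeta; lra.
have lt_beta b : 0 <= b < beta -> g b < 0.
  move=> /andP[b0 blt]; rewrite ltNge; apply/negP => gb.
  have : beta <= b by apply: ge_inf; [exists 0|split => //; rewrite b0 (le_trans (ltW blt))].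
  by lra.
have gbeta0 : g beta = 0.
  apply/le_anti; rewrite gbeta andbT leNgt; apply/negP => gp.
  have : \forall x \near beta, 0 < g x.
    by have := cg; move/cvgr_gt => /(_ 0 gp).
  rewrite -nbhs_nearE => /nbhs_ballP[e /= e0 he].
  pose m := Num.min e beta / 2.
  have m0 : 0 < m by rewrite divr_gt0 // lt_min e0 beta_gt0.
  have me : m < e /\ m < beta.
    have [h1 h2] : Num.min e beta <= e /\ Num.min e beta <= beta.
      by rewrite ge_min lexx ge_min lexx orbT.
    by rewrite /m; split; rewrite /m in m0; lra.
  have h0 : 0 <= beta - m < beta by apply/andP; split; lra.
  have := lt_beta _ h0; have := he (beta - m); rewrite /ball /= opprB addrC subrK gtr0_norm //.
  by move=> /(_ me.1); lra.
have beta_lt : beta < 1 - q%:R^-1 by rewrite -QE; case/andP: hbeta.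
exists beta; split => //; last first.
  move=> b /andP[b0]; rewrite le_eqVlt => /predU1P[->|blt].
    by rewrite -subr_le0 -gE // gbeta0.
  have := lt_beta b; rewrite b0 blt => /(_ isT) /ltW; rewrite gE ?subr_le0 //.
  by rewrite b0 (lt_trans blt) //; case/andP: hbeta.
have iQ : 0 < Q^-1 by rewrite invr_gt0.
split.
  have dp := root_den_gt0 hbeta.
  split; rewrite ?gt_eqF //.
    by rewrite -QE; case/andP: hbeta => h1 h2; apply/andP; split; lra.
  move: gbeta0; rewrite gE // => /eqP; rewrite subr_eq0 => /eqP ->.
  by rewrite mulfK // gt_eqF.
move=> b' [hb' den' dE]; rewrite leNgt; apply/negP => blt.
have numE : root_num q b' = d * root_den q l b' by rewrite dE divfK.
case: (lerP 0 b') => b'0.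
  have := lt_beta b'; rewrite b'0 blt => /(_ isT); rewrite gE ?numE ?subrr ?ltxx //.
  by rewrite b'0 (lt_trans blt) //; case/andP: hbeta.
have hb'' : - Q^-1 <= b' <= 0 by rewrite -QE in hb'; case/andP: hb' => h1 h2; apply/andP; split; lra.
have := root_den_neg hb'' den'; rewrite -(ler_pM2l d_gt0) -numE.
by have := @root_num_le b'; rewrite QE => /(_ hb'); have := above; rewrite root_num0 QE; lra.
Qed.

End Root.

(** * Probability that a fixed partition is weakly good *)

Section FirstMoment.
Variables (R : realType) (q : nat) (cin cout : R).
Local Notation d := (avg_degree q cin cout).
Local Notation l := (snr q cin cout).

(** The parametrisation of the model by average degree and signal. *)
Lemma sbm_params : (2 <= q)%N -> 0 <= cin -> 0 <= cout -> ~ (cin = 0 /\ cout = 0) ->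
  [/\ 0 < d, cin = d * (1 + (q%:R - 1) * l), cout = d * (1 - l) & cin - cout = d * q%:R * l].
Proof.
move=> q2 ci co hc; have Q2 : 2 <= q%:R :> R by rewrite ler_nat.
have N0 : 0 < cin + (q%:R - 1) * cout.
  rewrite lt_neqAle; apply/andP; split; last by rewrite addr_ge0 // mulr_ge0 //; lra.
  apply/eqP => e; apply: hc.
  have h : 0 <= (q%:R - 2) * cout by rewrite mulr_ge0 //; lra.
  by split; apply/le_anti/andP; split=> //; lra.
have q0 : 0 < q%:R :> R by lra.
split; rewrite ?divr_gt0 // /snr /avg_degree; field; by rewrite ?(gt_eqF N0) ?(gt_eqF q0).
Qed.

Definition near_balanced (delta : R) n (s : labelling n q) : Prop :=
  forall i, `|#|label_class s i|%:R - n%:R / q%:R| <= delta * n%:R.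

(** The sign of the signal turns these into one-sided conditions; they hold for
    good partitions ([good_weakly_good]) and pass from a labelling to one with
    more edges inside groups, or fewer for a negative signal
    ([weakly_good_maximal]). *)
Definition weakly_good (delta : R) n (G : graph n) (t : labelling n q) : Prop :=
  [/\ balanced t, - (delta * n%:R) <= l * ((m_in G t)%:R - mbar_in q cin n) &
      l * ((m_out G t)%:R - mbar_out q cout n) <= delta * n%:R].

(** Exponent per vertex of the bound [edge_count_tail] for partitions with
    q * cell2 s t = S * n^2. *)
Definition rate (ti to S : R) : R :=
  ((expR ti - expR to) * ((cin - cout) * S + cout) / q%:R + (expR to - 1) * d
   - (ti * cin + to * ((q%:R - 1) * cout)) / q%:R) / 2.

(** The difference is the sum of the squared deviations of the class sizes. *)
Lemma near_balanced_cell2 delta m (s : labelling (m * q) q) :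
  (2 <= q)%N -> near_balanced delta s ->
  `|(cell2 s s)%:R - (m * q)%:R ^+ 2 / q%:R| <= q%:R * (delta * (m * q)%:R) ^+ 2.
Proof.
move=> q2 nb; have Q0 : (q%:R : R) != 0 by rewrite pnatr_eq0; case: (q) q2.
rewrite cell2_self.
have -> : (\sum_i #|label_class s i| ^ 2)%:R - (m * q)%:R ^+ 2 / q%:R
   = \sum_(i < q) (#|label_class s i|%:R - (m * q)%:R / q%:R) ^+ 2 :> R.
  pose f i : R := #|label_class s i|%:R; pose c : R := (m * q)%:R / q%:R.
  have Ef : \sum_i f i = (m * q)%:R by rewrite -natr_sum sum_card_class.
  have -> : \sum_(i < q) (f i - c) ^+ 2 = \sum_(i < q) (f i ^+ 2 - 2 * c * f i + c ^+ 2).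
    by apply: eq_bigr => i _; ring.
  rewrite !big_split /= sumrN -big_distrr /= Ef sumr_const card_ord natr_sum.
  rewrite -[in RHS]mulr_natr /c; under eq_bigr do rewrite natrX.
  by rewrite -/(f _); field.
rewrite ger0_norm; last by apply: sumr_ge0 => i _; exact: sqr_ge0.
have -> y : q%:R * y = \sum_(i < q) y :> R by rewrite sumr_const card_ord mulr_natl.
apply: ler_sum => i _.
by rewrite -[leLHS]real_normK ?num_real // ler_sqr ?nnegrE // (le_trans _ (nb i)).
Qed.

(** The tilts ci * l and - co * l have signs such that both conditions of
    weak goodness push the exponent the same way. The mean number of inner
    edges enters with the sign of l, so an upper bound on the collision S
    suffices for either sign. *)
Lemma weakly_good_prob (ci co : R) : (2 <= q)%N -> 0 <= cin -> 0 <= cout ->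
  ~ (cin = 0 /\ cout = 0) -> 0 <= ci -> 0 <= co ->
  0 <= l * (expR (ci * l) - expR (- co * l)) ->
  exists K K' : R, [/\ 0 <= K, 0 <= K' & forall (delta S : R) m (s t : labelling (m * q) q),
    0 <= delta <= 1 -> (0 < m)%N -> cin <= (m * q)%:R -> cout <= (m * q)%:R ->
    near_balanced delta s -> balanced t ->
    q%:R * (cell2 s t)%:R <= S * (m * q)%:R ^+ 2 ->
    \sum_(G : graph (m * q) | `[< weakly_good delta G t >])
       graph_weight (edge_prob cin cout s) G
    <= expR ((m * q)%:R * (rate (ci * l) (- co * l) S + K * delta) + K')].
Proof.
move=> q2 hcin hcout hc ci0 co0; set ti := ci * l; set to := - co * l => hz.
have [d0 cinE coutE ccE] := sbm_params q2 hcin hcout hc.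
have Q0 : 0 < q%:R :> R by rewrite ltr0n; case: (q) q2.
pose K := ci + co + `|expR to - 1| * `|cin - cout| * q%:R / 2.
pose K' := (`|expR ti - expR to| + `|expR to - 1|) * cin / 2.
exists K, K'; split; rewrite /K /K'.
- by rewrite !addr_ge0 // !mulr_ge0 // ?invr_ge0 // ltW.
- by rewrite mulr_ge0 // mulr_ge0 // addr_ge0.
move=> delta S m s t /andP[de0 de1] m0 cin_n cout_n nb bt hS.
set n := (m * q)%N in s t nb bt hS cin_n cout_n *.
have n_gt0 : (0 < n)%N by rewrite muln_gt0 m0; case: (q) q2.
have np : 0 < n%:R :> R by rewrite ltr0n.
pose a := ti * mbar_in q cin n + to * mbar_out q cout n - (ci + co) * (delta * n%:R).
apply: (@le_trans _ _ (\sum_(G : graph n | a <= ti * (m_in G t)%:R + to * (m_out G t)%:R)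
     graph_weight (edge_prob cin cout s) G)).
  rewrite [leLHS]big_mkcond [leRHS]big_mkcond; apply: ler_sum => G _.
  have W0 := graph_weight_ge0 (edge_prob01 s hcin hcout cin_n cout_n) G.
  case: asboolP => [[_ h1 h2]|_]; last by case: ifP.
  rewrite ifT //.
  have k1 : 0 <= ci * (l * ((m_in G t)%:R - mbar_in q cin n) + delta * n%:R).
    by rewrite mulr_ge0 //; lra.
  have k2 : 0 <= co * (delta * n%:R - l * ((m_out G t)%:R - mbar_out q cout n)).
    by rewrite mulr_ge0 //; lra.
  by rewrite /a /ti /to; lra.
apply: le_trans (edge_count_tail s t ti to a hcin hcout cin_n cout_n) _.
rewrite ler_expR.
have mi := mu_inE cin cout s t n_gt0; have mt := mu_totE cin cout s t n_gt0.
have ctt : (cell2 t t)%:R = n%:R ^+ 2 / q%:R :> R.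
  by rewrite cell2_diag // /n !natrM; field; rewrite gt_eqF.
have css := near_balanced_cell2 q2 nb.
rewrite ctt in mi; rewrite natrX in mt.
have -> : (expR ti - 1) * mu_in cin cout s t + (expR to - 1) * mu_out cin cout s t - a
  = (expR ti - expR to) * mu_in cin cout s t
    + (expR to - 1) * (mu_in cin cout s t + mu_out cin cout s t) - a by ring.
rewrite mt mi.
set Z := expR ti - expR to; set Y := expR to - 1.
pose e := (cell2 s s)%:R - n%:R ^+ 2 / q%:R : R.
have Zc : 0 <= Z * (cin - cout).
  have -> : Z * (cin - cout) = d * q%:R * (l * Z) by rewrite ccE; ring.
  by rewrite mulr_ge0 // mulr_ge0 ?ltW.
have h1 : Z * (cin - cout) * (cell2 s t)%:R <= Z * (cin - cout) * (S * n%:R ^+ 2 / q%:R).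
  by rewrite ler_wpM2l // ler_pdivlMr // mulrC.
have h2 : Y * (cin - cout) * e <= `|Y| * `|cin - cout| * (q%:R * delta * n%:R ^+ 2).
  apply: le_trans (ler_norm _) _; rewrite !normrM ler_wpM2l ?mulr_ge0 //.
  apply: le_trans css _; rewrite exprMn mulrA ler_wpM2r ?sqr_ge0 // ler_wpM2l ?(ltW Q0) //.
  by rewrite expr2 ler_piMr.
have h3 : - (Z * cin) <= `|Z| * cin by rewrite -mulNr ler_wpM2r // -normrN ler_norm.
have h4 : - (Y * cin) <= `|Y| * cin by rewrite -mulNr ler_wpM2r // -normrN ler_norm.
have E : Z * (((cin - cout) * ((cell2 s t)%:R - n%:R)
               + cout * (n%:R ^+ 2 / q%:R - n%:R)) / (2 * n%:R)) +
   Y * (((cin - cout) * ((cell2 s s)%:R - n%:R) + cout * (n%:R ^+ 2 - n%:R)) / (2 * n%:R)) - a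
  = (Z * (cin - cout) * (cell2 s t)%:R + Y * (cin - cout) * e
     + Z * cout * n%:R ^+ 2 / q%:R + Y * d * n%:R ^+ 2 - (Z * cin + Y * cin) * n%:R) / (2 * n%:R) - a.
  by rewrite /e /avg_degree; field; rewrite !gt_eqF.
rewrite E.
have F : n%:R * (rate ti to S + (ci + co + `|Y| * `|cin - cout| * q%:R / 2) * delta)
     + (`|Z| + `|Y|) * cin / 2
  = (Z * (cin - cout) * (S * n%:R ^+ 2 / q%:R) + `|Y| * `|cin - cout| * (q%:R * delta * n%:R ^+ 2)
     + Z * cout * n%:R ^+ 2 / q%:R + Y * d * n%:R ^+ 2 + (`|Z| * cin + `|Y| * cin) * n%:R) / (2 * n%:R) - a.
  by rewrite /rate /a /mbar_in /mbar_out -/Z -/Y; field; rewrite !gt_eqF.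
rewrite F lerD2r ler_wpM2r ?invr_ge0 ?mulr_ge0 ?(ltW np) //.
have h5 : - (Z * cin + Y * cin) * n%:R <= (`|Z| * cin + `|Y| * cin) * n%:R.
  by rewrite ler_wpM2r ?(ltW np) //; lra.
by lra.
Qed.

End FirstMoment.

(** * Counting partitions with a given overlap *)

Section Kernel.
Variables (R : realType) (q : nat).

(** The product measure of these laws charges all labellings with the same
    agreement with rho \o s equally, and its entropy is kernel_entropy x. *)
Definition kernel (rho : 'S_q) (x : R) n (s : labelling n q) (v : 'I_n) (j : 'I_q) : R :=
  if j == rho (s v) then x else (1 - x) / (q%:R - 1).

Definition kernel_entropy (x : R) : R := - x * ln x - (1 - x) * ln ((1 - x) / (q%:R - 1)).

Lemma kernel_entropyE (b : R) : (2 <= q)%N -> 0 <= b < 1 - q%:R^-1 ->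
  kernel_entropy (b + q%:R^-1) = root_num q b / (2 * q%:R).
Proof.
move=> q2 /andP[b0 b1]; have Q2 : 2 <= q%:R :> R by rewrite ler_nat.
rewrite /kernel_entropy /root_num /entropy ln_div ?posrE; try lra.
by field; rewrite gt_eqF //; lra.
Qed.

Lemma kernel_ge0 (rho : 'S_q) (x : R) n (s : labelling n q) v j :
  (2 <= q)%N -> 0 < x < 1 -> 0 <= kernel rho x s v j.
Proof.
move=> q2 /andP[x0 x1]; have Q2 : 2 <= q%:R :> R by rewrite ler_nat.
by rewrite /kernel; case: ifP => _; [lra|rewrite divr_ge0 //; lra].
Qed.

Lemma kernel_sum (rho : 'S_q) (x : R) n (s : labelling n q) v :
  (2 <= q)%N -> \sum_j kernel rho x s v j = 1.
Proof.
move=> q2; have Q2 : 2 <= q%:R :> R by rewrite ler_nat.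
rewrite (bigD1 (rho (s v))) //= /kernel eqxx.
rewrite (eq_bigr (fun=> (1 - x) / (q%:R - 1))) => [|j /negPf -> //].
rewrite sumr_const cardC1 card_ord -[X in _ + X]mulr_natr.
have -> : q.-1%:R = q%:R - 1 :> R by rewrite -subn1 natrB // ltnW.
by field; rewrite gt_eqF //; lra.
Qed.

Lemma trace_label (rho : 'S_q) n (s t : labelling n q) :
  (\sum_i cell s t i (rho i) = \sum_v (t v == rho (s v)))%N.
Proof.
under eq_bigr do rewrite cellE.
rewrite exchange_big /=; apply: eq_bigr => v _.
rewrite (bigD1 (s v)) //= eqxx /= big1 ?addn0 // => i /negPf.
by rewrite eq_sym => ->.
Qed.

Lemma kernel_weight (rho : 'S_q) (x : R) n (s t : labelling n q) : (2 <= q)%N -> 0 < x < 1 ->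
  prod_weight (kernel rho x s) t
  = expR ((\sum_i cell s t i (rho i))%:R * (ln x - ln ((1 - x) / (q%:R - 1)))
          + n%:R * ln ((1 - x) / (q%:R - 1))).
Proof.
move=> q2 /andP[x0 x1]; have Q2 : 2 <= q%:R :> R by rewrite ler_nat.
have y0 : 0 < (1 - x) / (q%:R - 1) by rewrite divr_gt0 //; lra.
rewrite trace_label natr_sum -[X in _ + X%:R * _]card_ord -sum1_card natr_sum.
rewrite !big_distrl -big_split expR_sum /=; apply: eq_bigr => v _.
rewrite mul1r /kernel; case: eqP => _.
  by rewrite mul1r subrK lnK ?posrE.
by rewrite mul0r add0r lnK ?posrE.
Qed.

(** This turns counting into measuring: summed over a family of labellings of
    agreement close to x n, it bounds their number by the mass of the family
    times exp (n kernel_entropy x). *)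
Lemma kernel_weight_ge (rho : 'S_q) (x : R) n (s t : labelling n q) (k : nat) :
  (2 <= q)%N -> 0 < x < 1 -> (0 < n)%N -> (\sum_i cell s t i (rho i))%N = k ->
  1 <= prod_weight (kernel rho x s) t *
       expR (n%:R * (kernel_entropy x + `|ln x - ln ((1 - x) / (q%:R - 1))| * `|k%:R / n%:R - x|)).
Proof.
move=> q2 x01 n0 kE; rewrite kernel_weight // kE -expRD -[leLHS]expR0 ler_expR.
have np : 0 < n%:R :> R by rewrite ltr0n.
set L := ln x - _; set y := ln ((1 - x) / _).
have h : - (L * (k%:R / n%:R - x)) <= `|L| * `|k%:R / n%:R - x|.
  by rewrite -normrM -[X in _ <= X]normrN ler_norm.
have := ler_wpM2l (ltW np) h.
have -> : n%:R * - (L * (k%:R / n%:R - x)) = - (k%:R * L) + n%:R * (L * x).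
  by field; rewrite gt_eqF.
rewrite /kernel_entropy -/y [n%:R * (_ + `|L| * _)]mulrDr; have : L = ln x - y by [].
by clearbody L y; move: (n%:R * (`|L| * _)) => W ->; lra.
Qed.

Definition kernel_mean (rho : 'S_q) (x : R) (i j : 'I_q) : R :=
  if j == rho i then x else (1 - x) / (q%:R - 1).

(** The joint counts are within g n of their means under the product measure. *)
Definition typical (g : R) (rho : 'S_q) (x : R) n (s t : labelling n q) : bool :=
  [forall i, forall j,
     `|(cell s t i j)%:R - #|label_class s i|%:R * kernel_mean rho x i j| <= g * n%:R].

Lemma atypical_weight (g : R) (rho : 'S_q) (x : R) n (s : labelling n q) :
  (2 <= q)%N -> 0 < x < 1 -> 0 < g <= 1 ->
  \sum_(t | ~~ typical g rho x s t) prod_weight (kernel rho x s) t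
    <= (q ^ 2)%:R * (2 * expR (- (g ^+ 2 / 8 * n%:R))).
Proof.
move=> q2 x01 g01.
have k0 v j : 0 <= kernel rho x s v j by apply: kernel_ge0.
have k1 v : \sum_j kernel rho x s v j = 1 by apply: kernel_sum.
have devE i j t : label_dev (kernel rho x s) (label_class s i) j t
   = (cell s t i j)%:R - #|label_class s i|%:R * kernel_mean rho x i j.
  have Es : \sum_(v in label_class s i) kernel rho x s v j
      = #|label_class s i|%:R * kernel_mean rho x i j.
    transitivity (\sum_(v in label_class s i) kernel_mean rho x i j).
      by apply: eq_bigr => v; rewrite inE /kernel => /eqP ->.
    by rewrite sumr_const mulr_natl.
  by rewrite -Es.
apply: (@le_trans _ _ (\sum_(i < q) \sum_(j < q)
   \sum_t (if g * n%:R < `|label_dev (kernel rho x s) (label_class s i) j t|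
     then prod_weight (kernel rho x s) t else 0))); last first.
  have -> y : (q ^ 2)%:R * y = \sum_(i < q) \sum_(j < q) y :> R.
    by rewrite !sumr_const !card_ord -mulrnA mulnn mulr_natl.
  apply: ler_sum => i _; apply: ler_sum => j _.
  by rewrite -big_mkcond; apply: chernoff_tail.
rewrite pair_bigA /= exchange_big /= [leLHS]big_mkcond; apply: ler_sum => t _.
have F0 p : 0 <= (if g * n%:R < `|label_dev (kernel rho x s) (label_class s p.1) p.2 t|
     then prod_weight (kernel rho x s) t else 0) :> R.
  by case: ifP => // _; exact: prod_weight_ge0.
case: ifPn => [|_]; last by apply: sumr_ge0.
case/forallPn => i /forallPn[j]; rewrite -ltNge => lt_ij.
by rewrite (bigD1 (i, j)) //= devE lt_ij lerDl sumr_ge0.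
Qed.

(** The sum of squares is dominated by that of the mean matrix, with x / q on
    the diagonal rho and (1 - x) / (q (q - 1)) elsewhere. *)
Lemma typical_cell2 (g delta : R) (rho : 'S_q) (x : R) m (s t : labelling (m * q) q) :
  (2 <= q)%N -> 0 < x < 1 -> (0 < m)%N -> 0 <= g -> 0 <= delta -> g + delta <= 1 ->
  near_balanced delta s -> typical g rho x s t ->
  q%:R * (cell2 s t)%:R <=
   (x ^+ 2 + (1 - x) ^+ 2 / (q%:R - 1) + (2 * q%:R + q%:R ^+ 3) * (g + delta))
     * (m * q)%:R ^+ 2.
Proof.
move=> q2 /andP[x0 x1] m0 g0 de0 gd1 nb /forallP ty.
have Q2 : 2 <= q%:R :> R by rewrite ler_nat.
set n := (m * q)%N in s t nb ty *.
have np : 0 < n%:R :> R by rewrite ltr0n muln_gt0 m0; case: (q) q2.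
set e := g + delta.
have p01 i j : 0 <= kernel_mean rho x i j <= 1.
  rewrite /kernel_mean; case: ifP => _; first by apply/andP; split; lra.
  by rewrite divr_ge0 /= ?ler_pdivrMr; lra.
have cell_le i j : (cell s t i j)%:R <= n%:R * (kernel_mean rho x i j / q%:R + e).
  have /forallP/(_ j) := ty i; have := nb i; have /andP[p0 p1] := p01 i j.
  move: (kernel_mean _ _ _ _) p0 p1 => p p0 p1.
  rewrite !ler_norml => /andP[_ h1] /andP[_ h2].
  have h3 : (#|label_class s i|%:R - n%:R / q%:R) * p <= delta * n%:R.
    apply: le_trans (_ : delta * n%:R * p <= _); first by rewrite ler_wpM2r.
    by rewrite ler_piMr // mulr_ge0 // ltW.
  have -> : n%:R * (p / q%:R + e) = n%:R / q%:R * p + e * n%:R by ring.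
  by rewrite /e; lra.
have cst (y : R) : q%:R * y = \sum_(i < q) y.
  by rewrite sumr_const card_ord mulr_natl.
have sum_p : \sum_i \sum_j kernel_mean rho x i j = q%:R.
  rewrite -[RHS]mulr1 cst; apply: eq_bigr => i _.
  rewrite (bigD1 (rho i)) //= /kernel_mean eqxx.
  rewrite (eq_bigr (fun=> (1 - x) / (q%:R - 1))) => [|j /negPf -> //].
  rewrite sumr_const cardC1 card_ord -[X in _ + X]mulr_natr.
  have -> : q.-1%:R = q%:R - 1 :> R by rewrite -subn1 natrB // ltnW.
  by field; rewrite gt_eqF //; lra.
have sum_p2 : \sum_i \sum_j kernel_mean rho x i j ^+ 2
    = q%:R * (x ^+ 2 + (1 - x) ^+ 2 / (q%:R - 1)).
  rewrite cst; apply: eq_bigr => i _.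
  rewrite (bigD1 (rho i)) //= /kernel_mean eqxx.
  rewrite (eq_bigr (fun=> ((1 - x) / (q%:R - 1)) ^+ 2)) => [|j /negPf -> //].
  rewrite sumr_const cardC1 card_ord -[X in _ + X]mulr_natr.
  have -> : q.-1%:R = q%:R - 1 :> R by rewrite -subn1 natrB // ltnW.
  by field; rewrite gt_eqF //; lra.
apply: (@le_trans _ _ (q%:R * \sum_i \sum_j (n%:R * (kernel_mean rho x i j / q%:R + e)) ^+ 2)).
  rewrite ler_wpM2l // /cell2 natr_sum; apply: ler_sum => i _; rewrite natr_sum.
  apply: ler_sum => j _; rewrite natrX ler_sqr ?nnegrE //.
  by apply: le_trans (cell_le i j).
have -> : \sum_i \sum_j (n%:R * (kernel_mean rho x i j / q%:R + e)) ^+ 2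
   = n%:R ^+ 2 * ((\sum_i \sum_j kernel_mean rho x i j ^+ 2) / q%:R ^+ 2
       + 2 * e / q%:R * (\sum_i \sum_j kernel_mean rho x i j) + q%:R ^+ 2 * e ^+ 2).
  have -> : q%:R ^+ 2 * e ^+ 2 = \sum_(i < q) \sum_(j < q) e ^+ 2.
    by rewrite -!cst; ring.
  rewrite big_distrl big_distrr -!big_split big_distrr /=; apply: eq_bigr => i _.
  rewrite big_distrl big_distrr -!big_split big_distrr /=; apply: eq_bigr => j _.
  by field; rewrite gt_eqF //; lra.
rewrite sum_p sum_p2 mulrCA mulrC ler_wpM2r ?sqr_ge0 //.
have e0 : 0 <= e by rewrite /e addr_ge0.
have e2 : e ^+ 2 <= e by rewrite expr2 ler_piMr.
have -> : q%:R * (q%:R * (x ^+ 2 + (1 - x) ^+ 2 / (q%:R - 1)) / q%:R ^+ 2 +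
   2 * e / q%:R * q%:R + q%:R ^+ 2 * e ^+ 2) = 
   x ^+ 2 + (1 - x) ^+ 2 / (q%:R - 1) + 2 * q%:R * e + q%:R ^+ 3 * e ^+ 2.
  by field; rewrite !gt_eqF //; lra.
have : q%:R ^+ 3 * e ^+ 2 <= q%:R ^+ 3 * e by rewrite ler_wpM2l // exprn_ge0.
by lra.
Qed.

Lemma near_balanced_hamming (delta : R) m (s : labelling (m * q) q) :
  (2 <= q)%N -> 0 <= delta -> near_balanced delta s ->
  exists2 s' : labelling (m * q) q, balanced s' &
    (hamming s s')%:R <= q%:R * delta * (m * q)%:R :> R.
Proof.
move=> q2 de0 nb; have Q2 : 2 <= q%:R :> R by rewrite ler_nat.
have [s' bs' hs'] := balanced_near s; exists s' => //.
have hs'R : (hamming s s')%:R <= (\sum_i (#|label_class s i| - m))%:R :> R.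
  by rewrite ler_nat.
apply: le_trans hs'R _; rewrite natr_sum.
have -> : q%:R * delta * (m * q)%:R = \sum_(i < q) delta * (m * q)%:R :> R.
  by rewrite sumr_const card_ord -[RHS]mulr_natl mulrA.
apply: ler_sum => i _; have := nb i.
have -> : (m * q)%:R / q%:R = m%:R :> R by rewrite natrM; field; rewrite gt_eqF //; lra.
case: (leqP #|label_class s i| m) => [|/ltnW] cm; last by rewrite natrB // ler_norml => /andP[].
by move=> _; rewrite (eqP (_ : _ - m == 0)%N) // mulr_ge0.
Qed.

(** [cell2_le] for a balanced labelling close to s: the collision is at most
    k / n, up to a multiple of delta. *)
Lemma near_balanced_cell2_le (delta : R) m (s t : labelling (m * q) q) (k : nat) :
  (2 <= q)%N -> (0 < m)%N -> 0 <= delta <= 1 -> near_balanced delta s -> balanced t ->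
  (forall rho : 'S_q, \sum_i cell s t i (rho i) <= k)%N ->
  q%:R * (cell2 s t)%:R <=
   (k%:R / (m * q)%:R + (q%:R + 2 * q%:R ^+ 2 + q%:R ^+ 5) * delta) * (m * q)%:R ^+ 2.
Proof.
move=> q2 m0 /andP[de0 de1] nb bt le_k.
have Q2 : 2 <= q%:R :> R by rewrite ler_nat.
have np : 0 < (m * q)%:R :> R by rewrite ltr0n muln_gt0 m0; case: (q) q2.
have [s' bs' hle] := near_balanced_hamming q2 de0 nb.
set h := hamming s s' in hle.
have := cell2_le R bs' bt (leqnn h) le_k.
rewrite -(ler_nat R) => /(ler_wpM2l (_ : 0 <= q%:R)) => /(_ ltac:(lra)) hh.
apply: le_trans hh _.
rewrite !(natrD _ (_ + _)) !(natrD _ (m * _)) !natrM.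
rewrite natrD -[in leRHS]natrM.
have h0 : 0 <= h%:R :> R by [].
move: hle h0; set N := (m * q)%:R : R; move: (h%:R : R) => H hle h0.
have Np : 0 < N := np.
have NE : N = m%:R * q%:R by rewrite /N natrM.
clearbody N.
have HN : H * N <= q%:R * delta * N * N by rewrite ler_wpM2r // ltW.
have HH : H * H <= q%:R ^+ 2 * delta * N ^+ 2.
  apply: le_trans (ler_pM h0 h0 hle hle) _.
  have -> : q%:R * delta * N * (q%:R * delta * N) = q%:R ^+ 2 * N ^+ 2 * (delta * delta) by ring.
  have -> : q%:R ^+ 2 * delta * N ^+ 2 = q%:R ^+ 2 * N ^+ 2 * delta by ring.
  by apply: ler_wpM2l; [rewrite mulr_ge0 ?sqr_ge0|rewrite ler_piMr].
have -> : (k%:R / N + (q%:R + 2 * q%:R ^+ 2 + q%:R ^+ 5) * delta) * N ^+ 2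
   = k%:R * N + q%:R * delta * N * N + 2 * q%:R * (q%:R * delta * N * N)
     + q%:R ^+ 3 * (q%:R ^+ 2 * delta * N ^+ 2).
  by field; rewrite (gt_eqF Np).
have q30 : 0 <= q%:R ^+ 3 :> R by rewrite exprn_ge0.
have t1 : 2 * q%:R * (H * N) <= 2 * q%:R * (q%:R * delta * N * N).
  by rewrite ler_wpM2l // mulr_ge0 //; lra.
have t2 := ler_wpM2l q30 HH.
have -> : q%:R * (m%:R * (k%:R + H) + 2 * H * (m%:R * q%:R) + q%:R * q%:R * (H * H))
  = k%:R * N + H * N + 2 * q%:R * (H * N) + q%:R ^+ 3 * (H * H) by rewrite NE; ring.
by lra.
Qed.

End Kernel.

(** * The first moment near a given overlap *)

Lemma union_bound (R : realType) (T I : finType) (W : T -> R) (P : pred T) (A : I -> pred T) :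
  (forall x, 0 <= W x) -> (forall x, P x -> exists i, A i x) ->
  \sum_(x | P x) W x <= \sum_i \sum_(x | A i x) W x.
Proof.
move=> W0 PA; rewrite (exchange_big_dep xpredT) //= [leLHS]big_mkcond /=.
apply: ler_sum => x _; case: ifP => [/PA[i Ai]|_]; last by apply: sumr_ge0.
by rewrite (bigD1 i) //= lerDl sumr_ge0.
Qed.

(** The shift eta keeps the logarithms finite when A or A' vanishes. It is
    small enough for (A + eta, A' + eta) to remain on the side of (B, B')
    prescribed by the sign of l. *)
Lemma tilt_gap (R : realType) (Q l y eta A A' B B' : R) :
  l != 0 -> 0 < y -> 0 < Q -> 0 < B -> 0 < B' -> B + B' = Q -> 0 <= A -> 0 <= A' ->
  B - A = - (Q * l * y) -> B' - A' = Q * l * y ->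
  0 < eta -> eta <= `|l| * Q * y / 2 ->
  let zi := (A + eta) / B in let zo := (A' + eta) / B' in
  [/\ 0 <= ln zi / l, 0 <= - (ln zo / l) & l ^+ 2 * y / 2 <= l * (zi - zo)].
Proof.
move=> l0 y0 Q0 B0 B'0 BB A0 A'0 Bgap B'gap eta0 eta1 zi zo.
have zi0 : 0 < zi by rewrite divr_gt0 //; lra.
have zo0 : 0 < zo by rewrite divr_gt0 //; lra.
have Bq : B <= Q by lra.
have B'q : B' <= Q by lra.
case: (ltrP 0 l) => lp.
  rewrite gtr0_norm // in eta1.
  have z1 : 1 <= zi.
    rewrite /zi ler_pdivlMr // mul1r.
    have : 0 < Q * l * y by rewrite !mulr_gt0.
      lra.
  have z2 : zo <= 1 - l * y / 2.
    rewrite /zo ler_pdivrMr //.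
    have : l * y / 2 * B' <= l * y / 2 * Q by apply: ler_wpM2l => //; rewrite divr_ge0 // mulr_ge0 // ltW.
    by lra.
  have ly : 0 < l * y by rewrite mulr_gt0.
  split.
  - by rewrite divr_ge0 ?ln_ge0 // ltW.
  - by rewrite -mulNr divr_ge0 ?oppr_ge0 ?ln_le0 ?(ltW lp) //; lra.
  - have : l * (l * y / 2) <= l * (zi - zo) by rewrite ler_wpM2l ?(ltW lp) //; lra.
    by rewrite expr2; lra.
have ln' : l < 0 by rewrite lt_neqAle l0.
rewrite ltr0_norm // in eta1.
have ly : 0 < - l * y by rewrite mulr_gt0 // oppr_gt0.
have qly : 0 < - l * Q * y by rewrite !mulr_gt0 // oppr_gt0.
have z1 : 1 <= zo by rewrite /zo ler_pdivlMr // mul1r; lra.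
have z2 : zi <= 1 - - l * y / 2.
  rewrite /zi ler_pdivrMr //.
  have : - l * y / 2 * B <= - l * y / 2 * Q by rewrite ler_wpM2l // divr_ge0 // ltW.
  by lra.
split.
- by rewrite mulr_le0 ?invr_le0 // ln_le0 //; lra.
- by rewrite -mulrN mulr_ge0 ?ln_ge0 // -invrN invr_ge0 oppr_ge0.
- have : - l * (- l * y / 2) <= - l * (zo - zi) by rewrite ler_wpM2l ?oppr_ge0 //; lra.
  by rewrite expr2; lra.
Qed.

Section Local.
Variables (R : realType) (q : nat) (cin cout : R).
Local Notation d := (avg_degree q cin cout).
Local Notation l := (snr q cin cout).

(** With tilts log (A / B) and log (A' / B') the rate is exactly
    - d root_den / 2q. The constant c2, chosen before the error e, bounds from
    below the slope of the rate in the collision, up to the factor d / 2. *)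
Lemma exists_tilt (b0 : R) : (2 <= q)%N -> 0 <= cin -> 0 <= cout ->
  ~ (cin = 0 /\ cout = 0) -> l != 0 -> 0 <= b0 < 1 - q%:R^-1 ->
  exists2 c2 : R, 0 < c2 & forall e, 0 < e -> exists ci co : R,
    [/\ 0 <= ci, 0 <= co, c2 <= l * (expR (ci * l) - expR (- co * l)) &
        rate q cin cout (ci * l) (- co * l) (b0 + q%:R^-1)
          <= e - d * root_den q l b0 / (2 * q%:R)].
Proof.
move=> q2 hcin hcout hc l0 hb.
have [d0 cinE coutE ccE] := sbm_params q2 hcin hcout hc.
have Q2 : 2 <= q%:R :> R by rewrite ler_nat.
have Q0 : 0 < q%:R :> R by lra.
pose A := 1 + (q%:R - 1) * l; pose A' := (q%:R - 1) * (1 - l).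
pose B b := 1 + q%:R * b * l; pose B' b := q%:R - 1 - q%:R * b * l.
have l1 : l <= 1.
  by rewrite -subr_ge0 -(pmulr_rge0 _ d0) -coutE.
have lA : 0 <= 1 + (q%:R - 1) * l.
  by rewrite -(pmulr_rge0 _ d0) -cinE.
have A'0 : 0 <= A' by rewrite /A' mulr_ge0; lra.
have Bgap : B b0 - A = _ := B_gap q2 erefl erefl (fun=> erefl) b0.
have B'gap : B' b0 - A' = _ := B'_gap q2 erefl erefl (fun=> erefl) b0.
have B0 : 0 < B b0 := B_gt0 q2 lA erefl erefl (fun=> erefl) hb.
have B'0 : 0 < B' b0 := B'_gt0 q2 l1 erefl erefl (fun=> erefl) hb.
have denE : root_den q l b0 = A * ln (A / B b0) + A' * ln (A' / B' b0) by [].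
pose y := 1 - q%:R^-1 - b0.
have y0 : 0 < y by rewrite /y; case/andP: hb => h1 h2; lra.
have BB : B b0 + B' b0 = q%:R by rewrite /B /B'; ring.
have AA : A + A' = q%:R by rewrite /A /A'; ring.
have rateS : ((cin - cout) * (b0 + q%:R^-1) + cout) / q%:R = d * B b0 / q%:R.
  have -> : (cin - cout) * (b0 + q%:R^-1) + cout
     = d * q%:R * l * (b0 + q%:R^-1) + d * (1 - l) by rewrite ccE -coutE.
  by rewrite /B; field; rewrite gt_eqF.
have cqE : (q%:R - 1) * cout = d * A' 
  by have -> : (q%:R - 1) * cout = (q%:R - 1) * (d * (1 - l)); [rewrite -coutE|rewrite /A'; ring].
rewrite -/y in Bgap B'gap.
exists (l ^+ 2 * y / 2); first by rewrite divr_gt0 // mulr_gt0 // exprn_even_gt0.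
move=> e e0.
pose eta := Num.min (`|l| * q%:R * y / 2) (e * q%:R / d).
have eta0 : 0 < eta.
  by rewrite lt_min; apply/andP; split; apply: divr_gt0 => //; rewrite !mulr_gt0 ?normr_gt0.
have eta1 : eta <= `|l| * q%:R * y / 2 by rewrite ge_min lexx.
have eta2 : d * eta / q%:R <= e.
  rewrite ler_pdivrMr // mulrC -ler_pdivlMr //.
  by rewrite ge_min lexx orbT.
clearbody eta.
pose zi := (A + eta) / B b0; pose zo := (A' + eta) / B' b0.
have zi0 : 0 < zi by rewrite divr_gt0 //; rewrite /A; lra.
have zo0 : 0 < zo by rewrite divr_gt0 //; lra.
exists (ln zi / l), (- (ln zo / l)).
have -> : ln zi / l * l = ln zi by field.
have -> : - - (ln zo / l) * l = ln zo by field.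
rewrite !lnK ?posrE //.
have [ci0 co0 gap] : [/\ 0 <= ln zi / l, 0 <= - (ln zo / l) & l ^+ 2 * y / 2 <= l * (zi - zo)].
  by have := @tilt_gap R q%:R l y eta A A' (B b0) (B' b0) l0 y0 Q0 B0 B'0 BB lA A'0 Bgap B'gap eta0 eta1.
split=> //.
rewrite /rate !lnK ?posrE // -mulrA rateS cqE.
have -> : ln zi * cin = ln zi * (d * A) by congr (_ * _); exact: cinE.
have lz (a b : R) : 0 <= a -> 0 < b -> 0 < a + eta -> a * ln (a / b) <= a * ln ((a + eta) / b).
  rewrite le_eqVlt => /predU1P[<-|a0] b1 ae; first by rewrite !mul0r.
  rewrite ler_pM2l // ler_ln ?posrE ?divr_gt0 // ler_pM2r ?invr_gt0 //; lra.
have t1 : A * ln (A / B b0) <= A * ln zi by apply: lz => //; rewrite /A; lra.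
have t2 : A' * ln (A' / B' b0) <= A' * ln zo by apply: lz => //; lra.
have ziE : zi * B b0 = A + eta by rewrite divfK // gt_eqF.
have zoE : zo * B' b0 = A' + eta by rewrite divfK // gt_eqF.
have key : ((zi - zo) * (d * B b0 / q%:R) + (zo - 1) * d - (ln zi * (d * A) + ln zo * (d * A')) / q%:R) / 2
   = d / (2 * q%:R) * (zi * B b0 + zo * B' b0 - q%:R - (A * ln zi + A' * ln zo)).
  by rewrite -BB; field; rewrite BB gt_eqF.
rewrite key ziE zoE denE.
have dq : 0 <= d / (2 * q%:R) by apply: divr_ge0; [exact: ltW|rewrite mulr_ge0].
have := ler_wpM2l dq (lerD t1 t2).
have -> : d * (A * ln (A / B b0) + A' * ln (A' / B' b0)) / (2 * q%:R)
  = d / (2 * q%:R) * (A * ln (A / B b0) + A' * ln (A' / B' b0)) by ring.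
have -> : d / (2 * q%:R) * (A + eta + (A' + eta) - q%:R - (A * ln zi + A' * ln zo))
  = d * eta / q%:R - d / (2 * q%:R) * (A * ln zi + A' * ln zo).
  by rewrite -AA; field; rewrite AA gt_eqF.
by lra.
Qed.

Lemma rate_affine (ti to S S' : R) : (2 <= q)%N ->
  rate q cin cout ti to S' = rate q cin cout ti to S
     + (expR ti - expR to) * (cin - cout) / (2 * q%:R) * (S' - S).
Proof.
move=> q2; have Q2 : 2 <= q%:R :> R by rewrite ler_nat.
by rewrite /rate; field; rewrite gt_eqF //; lra.
Qed.

(** Collision of the mean matrix of the product measure. *)
Definition uniform_collision (x : R) : R := x ^+ 2 + (1 - x) ^+ 2 / (q%:R - 1).

Lemma uniform_collision_gap (b : R) : (2 <= q)%N ->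
  b + q%:R^-1 - uniform_collision (b + q%:R^-1) = b * q%:R * (1 - q%:R^-1 - b) / (q%:R - 1).
Proof.
move=> q2; have Q2 : 2 <= q%:R :> R by rewrite ler_nat.
by rewrite /uniform_collision; field; rewrite !gt_eqF //; lra.
Qed.

(** The first exponent is for atypical labellings, whose rarity contributes
    g^2 / 8; the second for typical ones. If the root condition is strict at
    b0, the bound S <= x already suffices; otherwise b0 > 0 and the gap between
    x and the collision of the mean matrix is positive. *)
Lemma exists_negative_exponents (b0 : R) : (2 <= q)%N -> 0 <= cin -> 0 <= cout ->
  ~ (cin = 0 /\ cout = 0) -> l != 0 -> 0 <= b0 < 1 - q%:R^-1 ->
  root_num q b0 <= d * root_den q l b0 ->
  0 < b0 \/ root_num q b0 < d * root_den q l b0 ->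
  exists ci co g S : R,
   [/\ [/\ 0 <= ci, 0 <= co & 0 <= l * (expR (ci * l) - expR (- co * l))],
       0 < g <= 1 / 2,
       S = b0 + q%:R^-1 \/ S = uniform_collision (b0 + q%:R^-1) + (2 * q%:R + q%:R ^+ 3) * g,
       kernel_entropy q (b0 + q%:R^-1) + rate q cin cout (ci * l) (- co * l) (b0 + q%:R^-1) < g ^+ 2 / 8 &
       kernel_entropy q (b0 + q%:R^-1) + rate q cin cout (ci * l) (- co * l) S < 0].
Proof.
move=> q2 hcin hcout hc l0 hb le_root strict.
have [d0 cinE coutE ccE] := sbm_params q2 hcin hcout hc.
have Q2 : 2 <= q%:R :> R by rewrite ler_nat.
have Q0 : 0 < q%:R :> R by lra.
have [c2 c20 tilt] := exists_tilt q2 hcin hcout hc l0 hb.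
pose g0 := (d * root_den q l b0 - root_num q b0) / (2 * q%:R).
have H0 : kernel_entropy q (b0 + q%:R^-1) = d * root_den q l b0 / (2 * q%:R) - g0.
  by rewrite kernel_entropyE // /g0; field; rewrite gt_eqF.
case: strict => [b00|lt_root]; last first.
  have g00 : 0 < g0 by rewrite divr_gt0 // ?mulr_gt0 // subr_gt0.
  have g02 : 0 < g0 / 2 by rewrite divr_gt0.
  have [ci [co [ci0 co0 h1 h2]]] := tilt _ g02.
  exists ci, co, (1 / 2), (b0 + q%:R^-1).
  have lt0 : kernel_entropy q (b0 + q%:R^-1) + rate q cin cout (ci * l) (- co * l) (b0 + q%:R^-1) < 0.
    by rewrite H0; move: (rate _ _ _ _ _ _) (d * _ / _) h2 => r D h2; clear -h2 g02; lra.
  split=> //; [by split=> //; lra| |by left|].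
    by apply/andP; split; lra.
  by apply: lt_trans lt0 _; rewrite divr_gt0 // exprn_gt0.
have g00 : 0 <= g0 by rewrite divr_ge0 // ?mulr_ge0 // subr_ge0.
(* g is small enough for typical labellings to keep half of the gap, and e for
   the tilt to lose less than either gain. *)
pose K3 := 2 * q%:R + q%:R ^+ 3 : R.
have K30 : 0 < K3 by rewrite addr_gt0 ?mulr_gt0 ?exprn_gt0.
pose gap := b0 + q%:R^-1 - uniform_collision (b0 + q%:R^-1).
have gap0 : 0 < gap.
  have y0 : 0 < 1 - q%:R^-1 - b0 by case/andP: hb => h1 h2; lra.
  have q10 : 0 < q%:R - 1 :> R by lra.
  by rewrite /gap uniform_collision_gap // divr_gt0 // !mulr_gt0.
pose g := Num.min (1 / 2) (gap / (2 * K3)).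
have gp : 0 < g by rewrite lt_min !divr_gt0 // mulr_gt0.
have g12 : g <= 1 / 2 by rewrite ge_min lexx.
have gK : K3 * g <= gap / 2.
  rewrite mulrC -ler_pdivlMr //.
  have -> : gap / 2 / K3 = gap / (2 * K3) by field; rewrite gt_eqF.
  by rewrite ge_min lexx orbT.
pose e := Num.min (g ^+ 2 / 16) (gap * (d * c2) / 16).
have e0 : 0 < e.
  rewrite lt_min; apply/andP; split; apply: divr_gt0 => //; first by rewrite exprn_gt0.
  by apply: mulr_gt0 => //; apply: mulr_gt0.
have e1 : e <= g ^+ 2 / 16 by rewrite ge_min lexx.
have e2 : e <= gap * (d * c2) / 16 by rewrite ge_min lexx orbT.
have [ci [co [ci0 co0 h1 h2]]] := tilt _ e0.
exists ci, co, g, (uniform_collision (b0 + q%:R^-1) + K3 * g).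
have g2 : 0 < g ^+ 2 by rewrite exprn_gt0.
have le_e : kernel_entropy q (b0 + q%:R^-1) + rate q cin cout (ci * l) (- co * l) (b0 + q%:R^-1) <= e.
  by rewrite H0; move: (rate _ _ _ _ _ _) (d * _ / _) h2 => r D h2; clear -h2 g00; lra.
split=> //; [split=> //; exact: ltW (lt_le_trans c20 h1)| by rewrite gp g12 |by right| | ].
  by apply: le_lt_trans le_e _; clear -e1 g2; lra.
rewrite (rate_affine _ _ (b0 + q%:R^-1)) // addrA.
have -> : (expR (ci * l) - expR (- co * l)) * (cin - cout) / (2 * q%:R)
   = d * (l * (expR (ci * l) - expR (- co * l))) / 2.
  by rewrite ccE; field; rewrite gt_eqF.
move: le_e; set r := kernel_entropy _ _ + _ => le_e.
have k1 : d * c2 <= d * (l * (expR (ci * l) - expR (- co * l))) by rewrite ler_pM2l.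
set Z := d * (l * _) in k1 *.
have k2 : gap / 2 <= b0 + q%:R^-1 - (uniform_collision (b0 + q%:R^-1) + K3 * g).
  by move: gK; rewrite /gap; clear; lra.
have k3 : d * c2 * (gap / 2) <= Z * (b0 + q%:R^-1 - (uniform_collision (b0 + q%:R^-1) + K3 * g)).
  by apply: ler_pM => //; [rewrite mulr_ge0 // ltW|rewrite divr_ge0 // ltW].
have k4 : 0 < gap * (d * c2) by apply: mulr_gt0 => //; apply: mulr_gt0.
move: k3; set x := b0 + _; set y := uniform_collision _ + _ => k3.
by clearbody r x y Z; clear -le_e k3 k4 e2; lra.
Qed.

(** Overlaps take finitely many values, so fixing the exact value costs only a
    factor n in the union bound. *)
Definition overlap_event (delta b : R) n (s : labelling n q) (G : graph n) : Prop :=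
  exists t : labelling n q, weakly_good cin cout delta G t /\ overlap R s t = b.

(** Union bound over the optimal permutation rho and over the labellings t for
    which it is optimal, each t weighted by the product measure. All error
    terms are Lipschitz in delta0, with total constant M. *)
Lemma local_first_moment (b0 : R) : (2 <= q)%N -> 0 <= cin -> 0 <= cout ->
  ~ (cin = 0 /\ cout = 0) -> l != 0 -> 0 <= b0 < 1 - q%:R^-1 ->
  root_num q b0 <= d * root_den q l b0 ->
  0 < b0 \/ root_num q b0 < d * root_den q l b0 ->
  exists kappa delta0 C : R, [/\ 0 < kappa, 0 < delta0 &
    forall (delta b : R) m (s : labelling (m * q) q),
      0 <= delta <= delta0 -> `|b - b0| <= delta0 -> (0 < m)%N ->
      cin <= (m * q)%:R -> cout <= (m * q)%:R -> near_balanced delta s ->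
      \sum_(G : graph (m * q) | `[< overlap_event delta b s G >])
         graph_weight (edge_prob cin cout s) G
      <= C * expR (- (kappa * (m * q)%:R))].
Proof.
move=> q2 hcin hcout hc l0 hb le_root strict.
have [ci [co [g [St [[ci0 co0 zz] g12 StE hx hS]]]]] :=
  exists_negative_exponents q2 hcin hcout hc l0 hb le_root strict.
have [K [K' [K0 K'0 wgp]]] := weakly_good_prob q2 hcin hcout hc ci0 co0 zz.
have [d0 cinE coutE ccE] := sbm_params q2 hcin hcout hc.
have Q2 : 2 <= q%:R :> R by rewrite ler_nat.
have Q0 : 0 < q%:R :> R by lra.
set x0 := b0 + q%:R^-1 in StE hx hS.
have x01 : 0 < x0 < 1.
  have iQ : 0 < q%:R^-1 :> R by rewrite invr_gt0.
  by rewrite /x0; case/andP: hb => h1 h2; apply/andP; split; lra.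
have Lam0 : 0 <= (expR (ci * l) - expR (- co * l)) * (cin - cout) / (2 * q%:R).
  have -> : (expR (ci * l) - expR (- co * l)) * (cin - cout) / (2 * q%:R)
   = d * (l * (expR (ci * l) - expR (- co * l))) / 2.
    by rewrite ccE; field; rewrite gt_eqF.
  by rewrite divr_ge0 // mulr_ge0 // ltW.
have raff S S' := rate_affine (ci * l) (- co * l) S S' q2.
set Lam := _ / _ in Lam0 raff.
pose rt := rate q cin cout (ci * l) (- co * l).
pose K2 := q%:R + 2 * q%:R ^+ 2 + q%:R ^+ 5 : R.
pose K3 := 2 * q%:R + q%:R ^+ 3 : R.
pose Lx : R := `|ln x0 - ln ((1 - x0) / (q%:R - 1))|.
have K20 : 0 <= K2 by rewrite !addr_ge0 ?mulr_ge0 ?exprn_ge0.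
have K30 : 0 <= K3 by rewrite !addr_ge0 ?mulr_ge0 ?exprn_ge0.
have Lx0 : 0 <= Lx by rewrite /Lx normr_ge0.
pose M := Lx + Lam * (1 + K2 + K3) + K + 1.
have M0 : 0 < M.
  have := mulr_ge0 Lam0 (addr_ge0 (addr_ge0 ler01 K20) K30).
  by rewrite /M; move: (Lam * _) => X; clear -Lx0 K0; lra.
pose kappa := Num.min (g ^+ 2 / 8 - (kernel_entropy q x0 + rt x0)) (- (kernel_entropy q x0 + rt St)) / 2.
have [kp kp1 kp2] : [/\ 0 < kappa, kernel_entropy q x0 + rt x0 - g ^+ 2 / 8 <= - (2 * kappa) &
    kernel_entropy q x0 + rt St <= - (2 * kappa)].
  have h1 : 0 < Num.min (g ^+ 2 / 8 - (kernel_entropy q x0 + rt x0)) (- (kernel_entropy q x0 + rt St)).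
    by rewrite lt_min subr_gt0 oppr_gt0 hx hS.
  have h2 : Num.min (g ^+ 2 / 8 - (kernel_entropy q x0 + rt x0)) (- (kernel_entropy q x0 + rt St))
     <= g ^+ 2 / 8 - (kernel_entropy q x0 + rt x0) by rewrite ge_min lexx.
  have h3 : Num.min (g ^+ 2 / 8 - (kernel_entropy q x0 + rt x0)) (- (kernel_entropy q x0 + rt St))
     <= - (kernel_entropy q x0 + rt St) by rewrite ge_min lexx orbT.
  rewrite /kappa; move: (Num.min _ _) h1 h2 h3 => k; move: (kernel_entropy _ _ + _) (_ + rt St) => u v.
  by clear; move=> h1 h2 h3; split; lra.
pose delta0 := Num.min (1 / 2) (kappa / M).
have dl0 : 0 < delta0 by rewrite lt_min divr_gt0 //= divr_gt0.
have dl1 : delta0 <= 1 / 2 by rewrite ge_min lexx.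
have dlM : M * delta0 <= kappa.
  by rewrite mulrC -ler_pdivlMr // ge_min lexx orbT.
exists kappa, delta0, (#|{: 'S_q}|%:R * (expR K' * (1 + (q ^ 2)%:R * 2))).
split=> // delta b m s /andP[de0 de1] hbb m0 cin_n cout_n nb.
have n_gt0 : (0 < m * q)%N by rewrite muln_gt0 m0; case: (q) q2.
have np : 0 < (m * q)%:R :> R by rewrite ltr0n.
pose W := graph_weight (edge_prob cin cout s).
have W0 G : 0 <= W G by exact: graph_weight_ge0 (edge_prob01 s hcin hcout cin_n cout_n) G.
pose tr (t : labelling (m * q) q) (rho : 'S_q) := (\sum_i cell s t i (rho i))%N.
pose Tr (rho : 'S_q) (t : labelling (m * q) q) : Prop :=
  [/\ balanced t, forall rho' : 'S_q, (tr t rho' <= tr t rho)%N &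
      (tr t rho)%:R / (m * q)%:R - q%:R^-1 = b].
pose A (p : 'S_q * labelling (m * q) q) (G : graph (m * q)) :=
  `[< Tr p.1 p.2 >] && `[< weakly_good cin cout delta G p.2 >].
apply: (@le_trans _ _ (\sum_p \sum_(G | A p G) W G)).
  apply: union_bound => // G /asboolP[t [wg ov]].
  have bt : balanced t by case: wg.
  have [rho [max_rho ovE]] := @overlap_balanced R m q s t n_gt0 bt.
  exists (rho, t); apply/andP; split; apply/asboolP => //.
  by split=> //; rewrite -ov ovE.
rewrite -(pair_bigA _ (fun rho t => \sum_(G | A (rho, t) G) W G)) /=.
rewrite -mulrA mulr_natl -sumr_const; apply: ler_sum => rho _.
pose Pt (t : labelling (m * q) q) := \sum_(G | `[< weakly_good cin cout delta G t >]) W G.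
have -> : \sum_(t : labelling (m * q) q) \sum_(G | A (rho, t) G) W G
   = \sum_(t : labelling (m * q) q | `[< Tr rho t >]) Pt t.
  rewrite [RHS]big_mkcond; apply: eq_bigr => t _; rewrite /A /=.
  by case: asboolP => _ //=; rewrite big_pred0.
pose w (t : labelling (m * q) q) := prod_weight (kernel rho x0 s) t.
have w0 t : 0 <= w t.
  by apply: prod_weight_ge0 => v j; apply: kernel_ge0.
have Tx t : Tr rho t -> `|(tr t rho)%:R / (m * q)%:R - x0| <= delta0.
  by case=> _ _ trE; have -> : (tr t rho)%:R / (m * q)%:R - x0 = b - b0; [rewrite -trE /x0; ring|].
have Lxd : Lx * delta0 <= Lx * delta0 by [].
have one_le t : Tr rho t -> 1 <= w t * expR ((m * q)%:R * (kernel_entropy q x0 + Lx * delta0)).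
  move=> T; apply: le_trans (@kernel_weight_ge R q rho x0 _ s t (tr t rho) q2 x01 n_gt0 erefl) _.
  rewrite ler_wpM2l // ler_expR ler_wpM2l ?(ltW np) // lerD2l ler_wpM2l //.
  exact: Tx.
have d1 : delta <= 1 by clear -de1 dl1; lra.
have Pgen t : Tr rho t ->
    Pt t <= expR ((m * q)%:R * (rt x0 + Lam * (1 + K2 + K3) * delta0 + K * delta0) + K').
  move=> T; case: (T) => bt max_rho trE.
  have hS' := near_balanced_cell2_le q2 m0 (introT andP (conj de0 d1)) nb bt max_rho.
  have P1 := wgp delta _ m s t (introT andP (conj de0 d1)) m0 cin_n cout_n nb bt hS'.
  apply: le_trans P1 _; rewrite ler_expR lerD2r ler_wpM2l ?(ltW np) //.
  apply: lerD; last by rewrite ler_wpM2l.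
  rewrite (raff x0) lerD2l -mulrA ler_wpM2l //.
  have := Tx t T; rewrite ler_norml => /andP[_ t1].
  have t2 : K2 * delta <= K2 * delta0 by rewrite ler_wpM2l.
  have t3 : 0 <= K3 * delta0 by rewrite mulr_ge0 // ltW.
  by move: t1 t2 t3; rewrite -/K2; move: (_ / _) => X; clear; lra.
have Ptyp t : Tr rho t -> typical g rho x0 s t ->
    Pt t <= expR ((m * q)%:R * (rt St + Lam * (1 + K2 + K3) * delta0 + K * delta0) + K').
  case: StE => [->|StE] T ty; first exact: Pgen.
  case: (T) => bt max_rho trE.
  have [g0 g1] : 0 <= g /\ g + delta <= 1.
    by case/andP: g12 => u v; split; [exact: ltW|clear -v de1 dl1; lra].
  have hS' := typical_cell2 q2 x01 m0 g0 de0 g1 nb ty.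
  have P1 := wgp delta _ m s t (introT andP (conj de0 d1)) m0 cin_n cout_n nb bt hS'.
  apply: le_trans P1 _; rewrite ler_expR lerD2r ler_wpM2l ?(ltW np) //.
  apply: lerD; last by rewrite ler_wpM2l.
  rewrite (raff St) lerD2l -mulrA ler_wpM2l //.
  have t2 : K3 * delta <= K3 * delta0 by rewrite ler_wpM2l.
  have t3 : 0 <= K2 * delta0 by rewrite mulr_ge0 // ltW.
  by rewrite StE /uniform_collision -/K3; move: t2 t3 dl0; move: (x0 ^+ 2) (_ / _) => X Y; clear; lra.
have wsum : \sum_(t : labelling (m * q) q) w t = 1.
  by apply: sum_prod_weight => v; apply: kernel_sum.
pose E := (m * q)%:R * (kernel_entropy q x0 + Lx * delta0).
pose X := Lam * (1 + K2 + K3) * delta0 + K * delta0.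
have XM : Lx * delta0 + X <= kappa.
  apply: le_trans dlM; rewrite /M /X; move: (Lam * _) => Y; move: dl0; clear; lra.
(* Each term is multiplied by w t * expR E >= 1, so that summing over t
   amounts to taking the mass of the typical and of the atypical t. *)
apply: (@le_trans _ _ (\sum_(t : labelling (m * q) q | `[< Tr rho t >])
    (if typical g rho x0 s t then w t * expR (E + ((m * q)%:R * (rt St + X) + K'))
     else w t * expR (E + ((m * q)%:R * (rt x0 + X) + K'))))).
  apply: ler_sum => t /asboolP T.
  have Pt0 : 0 <= Pt t by apply: sumr_ge0.
  have H (B : R) : Pt t <= expR B -> Pt t <= w t * expR (E + B).
    move=> PB; rewrite expRD mulrA; apply: le_trans PB _.
    by rewrite ler_peMl ?expR_ge0 // one_le.
  case: ifP => ty; apply: H; rewrite /X addrA; [exact: Ptyp|exact: Pgen].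
rewrite (bigID (typical g rho x0 s)) /= [expR K' * (1 + _)]mulrDr mulr1 [(_ + _) * expR (- _)]mulrDl; apply: lerD.
  apply: (@le_trans _ _ (\sum_(t : labelling (m * q) q) w t * expR (E + ((m * q)%:R * (rt St + X) + K')))).
    rewrite [leLHS]big_mkcond; apply: ler_sum => t _.
    case: ifP => [/andP[_ ->] //|_]; by rewrite mulr_ge0 ?expR_ge0.
  rewrite -big_distrl /= wsum mul1r -expRD ler_expR.
  have h : (m * q)%:R * (kernel_entropy q x0 + rt St + (Lx * delta0 + X)) <= (m * q)%:R * - kappa.
    by rewrite ler_wpM2l ?(ltW np) //; move: kp2 XM; move: (_ + rt St) (_ + X) => u v; clear; lra.
  by rewrite /E; move: h; move: (kernel_entropy _ _) (rt St) (Lx * _) => u v z; clear; lra.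
apply: (@le_trans _ _ (\sum_(t : labelling (m * q) q | ~~ typical g rho x0 s t)
     w t * expR (E + ((m * q)%:R * (rt x0 + X) + K')))).
  rewrite [leLHS]big_mkcond [leRHS]big_mkcond; apply: ler_sum => t _.
  case: ifP => [/andP[_ /negPf ->] //|_].
  by case: ifP => // _; rewrite mulr_ge0 ?expR_ge0.
rewrite -big_distrl /=.
have g1 : 0 < g <= 1 by case/andP: g12 => -> /= u; clear -u; lra.
apply: le_trans (ler_wpM2r (expR_ge0 _) (atypical_weight rho s q2 x01 g1)) _.
have -> : expR K' * ((q ^ 2)%:R * 2) * expR (- (kappa * (m * q)%:R))
   = (q ^ 2)%:R * 2 * expR (K' - kappa * (m * q)%:R) by rewrite expRD; ring.
rewrite mulrA -[leLHS]mulrA -expRD ler_wpM2l ?mulr_ge0 // ler_expR.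
have h : (m * q)%:R * (kernel_entropy q x0 + rt x0 - g ^+ 2 / 8 + (Lx * delta0 + X)) <= (m * q)%:R * - kappa.
  by rewrite ler_wpM2l ?(ltW np) //; move: kp1 XM; move: (_ - _ / 8) (_ + X) => u v; clear; lra.
by rewrite /E; move: h; move: (kernel_entropy _ _) (rt x0) (Lx * _) (g ^+ 2 / 8) => u v z y; clear; lra.
Qed.
End Local.

(** * Compactness over the overlaps below the root *)

Section Global.
Variables (R : realType) (q : nat) (cin cout : R).
Local Notation d := (avg_degree q cin cout).
Local Notation l := (snr q cin cout).

Lemma expRN_le_inv (x : R) : 0 < x -> expR (- x) <= x^-1.
Proof.
move=> x0; rewrite expRN lef_pV2 ?posrE ?expR_gt0 //.
by have := expR_ge1Dx x; lra.
Qed.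

Lemma expRN_le_cube (x : R) : 0 < x -> expR (- x) <= 6 / x ^+ 3.
Proof.
move=> x0; rewrite expRN -[leRHS]invrK lef_pV2 ?posrE ?expR_gt0 ?invr_gt0 ?divr_gt0 ?exprn_gt0 //.
rewrite invf_div; have := expR_ge1Dxn 2 (ltW x0).
by rewrite (_ : 3`!%:R = 6 :> R) //; lra.
Qed.

Definition low_overlap (delta beta : R) n (s : labelling n q) (G : graph n) : Prop :=
  exists t : labelling n q, weakly_good cin cout delta G t /\ overlap R s t < beta.

(** The constants of [local_first_moment] depend on b0. The property P k holds
    near each b0 for large k, hence for one k on the whole of [0, beta]; the
    slack delta is tied to k as 1 / (k + 1). *)
Lemma low_overlap_rare (beta : R) : (2 <= q)%N -> 0 <= cin -> 0 <= cout ->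
  ~ (cin = 0 /\ cout = 0) -> l != 0 -> 0 < beta -> beta < 1 - q%:R^-1 ->
  (forall b, 0 <= b <= beta -> root_num q b <= d * root_den q l b) ->
  root_num q (0 : R) < d * root_den q l 0 ->
  exists delta : R, exists M : nat, [/\ 0 < delta, (0 < M)%N &
    forall m (s : labelling (m * q) q), (M <= m)%N -> near_balanced delta s ->
      [/\ cin <= (m * q)%:R, cout <= (m * q)%:R &
      \sum_(G : graph (m * q) | `[< low_overlap delta beta s G >])
         graph_weight (edge_prob cin cout s) G <= 2 / m%:R]].
Proof.
move=> q2 hcin hcout hc l0 beta0 beta1 le_root root0.
pose P (k : nat) (b : R) : Prop :=
  forall m (s : labelling (m * q) q), (k.+1 <= m)%N -> near_balanced (k.+1%:R^-1 : R) s ->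
   [/\ cin <= (m * q)%:R, cout <= (m * q)%:R &
    \sum_(G : graph (m * q) | `[< overlap_event cin cout (k.+1%:R^-1) b s G >])
         graph_weight (edge_prob cin cout s) G <= ((m * q)%:R ^+ 2)^-1].
have cpt : compact `[0, beta]%classic by exact: segment_compact.
have /compact_near_coveringP nc := cpt.
have [k0 _ Pk0] : (\forall k \near \oo, `[0, beta]%classic `<=` P k)%classic.
  apply: nc => b0 /=; rewrite in_itv /= => /andP[b00 b01].
  have hb0 : 0 <= b0 < 1 - q%:R^-1 by rewrite b00 (le_lt_trans b01).
  have strict : 0 < b0 \/ root_num q b0 < d * root_den q l b0.
    by move: b00; rewrite le_eqVlt => /predU1P[<-|]; [right|left].
  have le0 : root_num q b0 <= d * root_den q l b0 by apply: le_root; rewrite b00.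
  have [kappa [delta0 [C [kp dp H]]]] :=
    local_first_moment q2 hcin hcout hc l0 hb0 le0 strict.
  exists ([set b | `|b - b0| <= delta0]%classic,
    [set k : nat | k.+1%:R^-1 <= delta0 /\ cin + cout + `|C| * 6 / kappa ^+ 3 <= k.+1%:R]%classic).
    split => /=.
      apply/nbhs_ballP; exists delta0 => //= b; rewrite /ball /= distrC => /ltW //.
    have [N1 hN1] : exists N : nat, delta0^-1 <= N%:R.
      by exists (Num.truncn delta0^-1).+1; apply/ltW/truncnS_gt.
    have [N2 hN2] : exists N : nat, cin + cout + `|C| * 6 / kappa ^+ 3 <= N%:R.
      by exists (Num.truncn (cin + cout + `|C| * 6 / kappa ^+ 3)).+1; apply/ltW/truncnS_gt.
    exists (maxn N1 N2) => //= k kmax.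
    have k1 : (N1 <= k)%N by exact: leq_trans (leq_maxl _ _) kmax.
    have k2 : (N2 <= k)%N by exact: leq_trans (leq_maxr _ _) kmax.
    split.
      rewrite -[leRHS]invrK lef_pV2 ?posrE ?invr_gt0 //.
      by rewrite (le_trans hN1) // ler_nat leqW.
    by rewrite (le_trans hN2) // ler_nat leqW.
  move=> [b k] /= [hb [k1 k2]] m s km nb.
  have q1 : (0 < q)%N by case: (q) q2.
  have m_gt0 : (0 < m)%N by apply: leq_trans km.
  have kn : k.+1%:R <= (m * q)%:R :> R by rewrite ler_nat (leq_trans km) // leq_pmulr.
  have C0 : 0 <= `|C| * 6 / kappa ^+ 3 by apply: divr_ge0; [exact: mulr_ge0|apply: exprn_ge0; exact: ltW].
  have n1 : cin + cout + `|C| * 6 / kappa ^+ 3 <= (m * q)%:R by apply: le_trans kn.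
  have ci : cin <= (m * q)%:R by move: n1; move: (_ * 6 / _) C0; clear -hcin hcout => *; lra.
  have co : cout <= (m * q)%:R by move: n1; move: (_ * 6 / _) C0; clear -hcin hcout => *; lra.
  have nC : `|C| * 6 / kappa ^+ 3 <= (m * q)%:R.
    by move: n1; move: (_ * 6 / _) C0; clear -hcin hcout => *; lra.
  split=> //.
  have np : 0 < (m * q)%:R :> R by rewrite ltr0n muln_gt0 m_gt0.
  have kk : 0 <= (k.+1%:R^-1 : R) <= delta0 by rewrite invr_ge0 ler0n.
  apply: le_trans (H _ b m s kk hb m_gt0 ci co nb) _.
  apply: (@le_trans _ _ (`|C| * (6 / (kappa * (m * q)%:R) ^+ 3))).
    apply: (@le_trans _ _ (`|C| * expR (- (kappa * (m * q)%:R)))).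
      by rewrite ler_wpM2r ?expR_ge0 // ler_norm.
    by rewrite ler_wpM2l // expRN_le_cube // mulr_gt0.
  have -> : `|C| * (6 / (kappa * (m * q)%:R) ^+ 3) = `|C| * 6 / kappa ^+ 3 * ((m * q)%:R ^+ 3)^-1.
    move: `|C| ((m * q)%:R) np => c N Np; field.
    by rewrite ?(gt_eqF kp) ?(gt_eqF Np).
  apply: le_trans (ler_wpM2r _ nC) _; first by rewrite invr_ge0 exprn_ge0 // ltW.
  by rewrite [in (m * q)%:R ^+ 3]exprS invfM mulrA divff ?mul1r // gt_eqF.
exists (k0.+1%:R^-1), k0.+1; split => // m s km nb.
have P0 b : 0 <= b <= beta -> P k0 b by move=> hb; apply: Pk0 => //=; rewrite in_itv.
have q1 : (0 < q)%N by case: (q) q2.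
have m_gt0 : (0 < m)%N by apply: leq_trans km.
have n_gt0 : (0 < m * q)%N by rewrite muln_gt0 m_gt0.
have np : 0 < (m * q)%:R :> R by rewrite ltr0n.
have [ci co _] := P0 0 ltac:(by rewrite lexx ltW) m s km nb.
split=> //.
set W := graph_weight _.
have W0 G : 0 <= W G by exact: graph_weight_ge0 (edge_prob01 s hcin hcout ci co) G.
pose b_ (k : 'I_(m * q).+1) : R := k%:R / (m * q)%:R - q%:R^-1.
apply: (@le_trans _ _ (\sum_(k < (m * q).+1) \sum_(G : graph (m * q) |
   (0 <= b_ k <= beta) && `[< overlap_event cin cout (k0.+1%:R^-1) (b_ k) s G >]) W G)).
  apply: union_bound => // G /asboolP[t [wg ov]].
  have bt : balanced t by case: wg.
  have [rho [max_rho ovE]] := @overlap_balanced R m q s t n_gt0 bt.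
  have tr_le : (\sum_i cell s t i (rho i) < (m * q).+1)%N.
    rewrite ltnS trace_label -[X in (_ <= X)%N]card_ord -sum1_card leq_sum // => v _.
    exact: leq_b1.
  exists (Ordinal tr_le); rewrite /b_ /= -ovE (ltW ov) andbT; apply/andP; split.
    rewrite ovE subr_ge0 ler_pdivlMr // mulrC ler_pdivrMr ?ltr0n // -natrM ler_nat.
    by have := @max_trace_ge R _ _ s t _ max_rho; rewrite [X in (_ <= X)%N]mulnC.
  by apply/asboolP; exists t.
apply: (@le_trans _ _ (\sum_(k < (m * q).+1) ((m * q)%:R ^+ 2)^-1)).
  apply: ler_sum => k _; case: (boolP (0 <= b_ k <= beta)) => hb; last first.
    by rewrite big_pred0 // invr_ge0 sqr_ge0.
  by have [_ _] := P0 _ hb m s km nb.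
rewrite sumr_const card_ord -[leLHS]mulr_natl ler_pdivrMr ?exprn_gt0 //.
have mp : 0 < m%:R :> R by rewrite ltr0n.
have nE : (m * q)%:R = m%:R * q%:R :> R by rewrite natrM.
have -> : 2 / m%:R * (m * q)%:R ^+ 2 = 2 * q%:R * (m * q)%:R :> R.
  by rewrite nE; field; rewrite gt_eqF.
have N1 : 1 <= (m * q)%:R :> R by rewrite ler1n.
have NQ : 2 * (m * q)%:R <= q%:R * (m * q)%:R :> R by rewrite ler_wpM2r ?(ltW np) // ler_nat.
by rewrite -natr1 -mulrA; clear -N1 NQ; lra.
Qed.

End Global.

(** * From conditional bounds to high probability *)

Section Whp.
Local Open Scope classical_set_scope.
Variables (R : realType) (q : nat) (cin cout : R).
Local Notation d := (avg_degree q cin cout).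
Local Notation l := (snr q cin cout).

Lemma nat_above (x : R) : exists N : nat, x <= N%:R.
Proof. by exists (Num.truncn x).+1; apply/ltW/truncnS_gt. Qed.

Lemma sbm_probE n (A : graph n -> labelling n q -> Prop) :
  sbm_prob cin cout A = \sum_(s : labelling n q) (q%:R ^+ n)^-1 *
    \sum_(G : graph n | `[< A G s >]) graph_weight (edge_prob cin cout s) G.
Proof.
rewrite /sbm_prob -(pair_big_dep xpredT (fun G s => `[< A G s >])
   (fun G s => sbm_weight cin cout G s)) /=.
rewrite (exchange_big_dep xpredT) //=; apply: eq_bigr => s _.
by rewrite big_distrr.
Qed.

Lemma uniform_not_balanced (delta : R) m : (2 <= q)%N -> 0 < delta <= 1 ->
  \sum_(s : labelling (m * q) q | `[< ~ near_balanced delta s >]) (q%:R ^+ (m * q))^-1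
   <= q%:R * (2 * expR (- (delta ^+ 2 / 8 * (m * q)%:R))).
Proof.
move=> q2 dl; have Q0 : 0 < q%:R :> R by rewrite ltr0n; case: (q) q2.
pose w (v : 'I_(m * q)) (j : 'I_q) : R := q%:R^-1.
have w0 v j : 0 <= w v j by rewrite invr_ge0 ltW.
have w1 v : \sum_j w v j = 1.
  by rewrite sumr_const card_ord -[LHS]mulr_natl divff // gt_eqF.
have wE s : prod_weight w s = (q%:R ^+ (m * q))^-1.
  by rewrite /prod_weight prodr_const card_ord exprVn.
have devE i s : label_dev w [set: 'I_(m * q)]%SET i s = #|label_class s i|%:R - (m * q)%:R / q%:R.
  by rewrite /label_dev finset.setTI sumr_const cardsT card_ord -[q%:R^-1 *+ _]mulr_natl.
apply: (@le_trans _ _ (\sum_(i < q) \sum_(s : labelling (m * q) q |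
    delta * (m * q)%:R < `|label_dev w [set: 'I_(m * q)]%SET i s|) prod_weight w s)).
  rewrite (eq_bigr (prod_weight w)) => [|s _]; last by rewrite wE.
  apply: union_bound => [s|s /asboolP nb]; first by apply: prod_weight_ge0.
  move/existsNP: nb => [i /negP]; rewrite -ltNge => h.
  by exists i; rewrite devE.
have -> y : q%:R * y = \sum_(i < q) y :> R by rewrite sumr_const card_ord mulr_natl.
by apply: ler_sum => i _; apply: chernoff_tail.
Qed.

Lemma uniform_sum m : (2 <= q)%N ->
  \sum_(s : labelling (m * q) q) (q%:R ^+ (m * q))^-1 = 1 :> R.
Proof.
move=> q2; have Q0 : 0 < q%:R :> R by rewrite ltr0n; case: (q) q2.
rewrite sumr_const card_ffun !card_ord -[LHS]mulr_natl natrX divff //.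
by rewrite expf_neq0 // gt_eqF.
Qed.

(** Almost all labellings are near balanced, so a bound on the conditional
    probability of failure given such a labelling is enough. *)
Lemma whp_of_bound (A : forall n, graph n -> labelling n q -> Prop)
    (delta : R) (M : nat) (C : R) : (2 <= q)%N -> 0 <= cin -> 0 <= cout -> 0 < delta ->
  (forall m (s : labelling (m * q) q), (M <= m)%N -> near_balanced delta s ->
    \sum_(G : graph (m * q) | `[< ~ A _ G s >]) graph_weight (edge_prob cin cout s) G
      <= C / m%:R) ->
  whp cin cout A.
Proof.
move=> q2 hcin hcout dl0 H.
have Q0 : 0 < q%:R :> R by rewrite ltr0n; case: (q) q2.
wlog dl1 : delta dl0 H / delta <= 1.
  move=> /(_ (Num.min delta 1)); apply; rewrite ?lt_min ?dl0 ?ltr01 ?ge_min ?lexx ?orbT //.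
  move=> m s Mm nb; apply: H => // i; apply: le_trans (nb i) _.
  by rewrite ler_wpM2r // ge_min lexx.
have dl : 0 < delta <= 1 by rewrite dl0.
have [N1 hN1] := nat_above cin; have [N2 hN2] := nat_above cout.
pose D := `|C| + q%:R * 2 * 8 / delta ^+ 2.
have bound m : ((maxn M (maxn N1 N2)).+1 <= m)%N ->
    1 - D / m%:R <= sbm_prob cin cout (@A (m * q)%N) <= 1.
  move=> hm.
  have hM : (M <= m)%N by apply: leq_trans (ltnW hm); exact: leq_maxl.
  have h1 : (N1 <= m)%N by apply: leq_trans (ltnW hm); rewrite (leq_trans (leq_maxl _ N2)) // leq_maxr.
  have h2 : (N2 <= m)%N by apply: leq_trans (ltnW hm); rewrite (leq_trans (leq_maxr N1 _)) // leq_maxr.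
  have m0 : (0 < m)%N by exact: leq_ltn_trans hm.
  have q0 : (0 < q)%N by case: (q) q2.
  have mp : 0 < m%:R :> R by rewrite ltr0n.
  have ci : cin <= (m * q)%:R by apply: le_trans hN1 _; rewrite ler_nat (leq_trans h1) // leq_pmulr.
  have co : cout <= (m * q)%:R by apply: le_trans hN2 _; rewrite ler_nat (leq_trans h2) // leq_pmulr.
  have W0 (s : labelling (m * q) q) G : 0 <= graph_weight (edge_prob cin cout s) G.
    exact: graph_weight_ge0 (edge_prob01 s hcin hcout ci co) G.
  pose u : R := (q%:R ^+ (m * q))^-1.
  have u0 : 0 <= u by rewrite invr_ge0 exprn_ge0 // ltW.
  pose bad (s : labelling (m * q) q) :=
    \sum_(G : graph (m * q) | `[< ~ A _ G s >]) graph_weight (edge_prob cin cout s) G.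
  have split1 (s : labelling (m * q) q) :
     \sum_(G : graph (m * q) | `[< A _ G s >]) graph_weight (edge_prob cin cout s) G = 1 - bad s.
    have := sum_graph_weight (edge_prob cin cout s).
    rewrite (bigID (fun G => `[< A _ G s >])) /= => <-.
    rewrite /bad [X in _ - X](eq_bigl (fun G => ~~ `[< A _ G s >])) ?addrK // => G.
    by rewrite asbool_neg.
  have bad0 s : 0 <= bad s by apply: sumr_ge0.
  have bad1 s : bad s <= 1.
    by rewrite -subr_ge0 -split1; apply: sumr_ge0.
  have -> : sbm_prob cin cout (@A (m * q)%N) = 1 - \sum_(s : labelling (m * q) q) u * bad s.
    rewrite sbm_probE; under eq_bigr do rewrite split1 mulrBr mulr1.
    by rewrite sumrB uniform_sum.
  rewrite gerBl sumr_ge0 ?andbT => [|s _]; last by rewrite mulr_ge0.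
  rewrite lerD2l lerN2.
  have u1 : \sum_(s : labelling (m * q) q) u = 1 by exact: uniform_sum.
  apply: (@le_trans _ _ (\sum_(s : labelling (m * q) q)
     (u * (`|C| / m%:R) + (if `[< ~ near_balanced delta s >] then u else 0)))).
    apply: ler_sum => s _; case: asboolP => [_|/contrapT nb].
      apply: (@le_trans _ _ u); first by rewrite ler_piMr.
      by rewrite lerDr mulr_ge0 // divr_ge0 // ltW.
    rewrite addr0; apply: ler_wpM2l => //; apply: le_trans (H m s hM nb) _.
    by apply: ler_wpM2r; [rewrite invr_ge0 ltW|exact: ler_norm].
  rewrite big_split /= -big_distrl /= u1 mul1r -big_mkcond /D mulrDl lerD2l.
  apply: le_trans (uniform_not_balanced m q2 dl) _.
  have np : 0 < (m * q)%:R :> R by rewrite ltr0n muln_gt0 m0.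
  have d2 : 0 < delta ^+ 2 / 8 by rewrite divr_gt0 // exprn_gt0.
  apply: (@le_trans _ _ (q%:R * (2 * (delta ^+ 2 / 8 * m%:R)^-1))).
    rewrite ler_wpM2l ?(ltW Q0) // ler_wpM2l //.
    apply: le_trans (expRN_le_inv _) _; first by rewrite mulr_gt0.
    rewrite lef_pV2 ?posrE ?mulr_gt0 // ler_pM2l // ler_nat leq_pmulr //.
  have -> : q%:R * (2 * (delta ^+ 2 / 8 * m%:R)^-1) = q%:R * 2 * 8 / delta ^+ 2 / m%:R.
    by field; rewrite !gt_eqF.
  by [].
apply: (@squeeze_cvgr _ _ _ _ (fun m : nat => 1 - D / m%:R) (fun=> 1)).
- by near=> m; apply: bound; near: m; exact: nbhs_infty_ge.
- rewrite -[X in _ --> X]subr0; apply: cvgB; first exact: cvg_cst.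
  rewrite -(mulr0 D); apply: cvgM; first exact: cvg_cst.
  apply/gtr0_cvgV0; last exact: cvgr_idn.
  by near=> m; rewrite ltr0n; near: m; exact: nbhs_infty_gt.
- exact: cvg_cst.
Unshelve. all: by end_near.
Qed.

End Whp.

(** * A balanced partition near the planted one *)

Section Planted.
Variables (R : realType) (q : nat) (cin cout : R).
Local Notation d := (avg_degree q cin cout).
Local Notation l := (snr q cin cout).

(** Each diagonal cell has at least m - h elements, h being the distance. *)
Lemma cell2_hamming_ge m (s s' : labelling (m * q) q) : balanced s' ->
  (q * m ^ 2 <= cell2 s s' + 2 * m * (q * hamming s s'))%N.
Proof.
move=> bs'; set h := hamming s s'.
have hC : hamming s' s = h.
  by rewrite /h !hammingE; apply: eq_bigr => v _; rewrite eq_sym.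
have -> : (2 * m * (q * h) = \sum_(i < q) 2 * m * h)%N.
  by rewrite sum_nat_const card_ord; lia.
have -> : (q * m ^ 2 = \sum_(i < q) m ^ 2)%N by rewrite sum_nat_const card_ord.
rewrite /cell2 -big_split /=; apply: leq_sum => i _.
rewrite (bigD1 i) //= -addnA.
have : (m <= cell s s' i i + h)%N.
  have := cell_hamming s' s s' i i; rewrite hC.
  by rewrite {1}/cell finset.setIid balanced_mul.
move: (cell s s' i i) (\sum_(_ < _ | _) _)%N => c x le_m.
have h1 : (m * m <= (c + h) * m)%N by rewrite leq_mul2r le_m orbT.
case: (leqP c m) => cm; last first.
  have : (m * m <= c * c)%N by rewrite leq_mul // ltnW.
  by rewrite -!mulnn; lia.
have h2 : (c * m <= c * (c + h))%N by rewrite leq_mul2l le_m orbT.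
have h3 : (c * h <= m * h)%N by rewrite leq_mul2r cm orbT.
by rewrite -!mulnn; lia.
Qed.

(** The labelling s' depends on s only, so its edge counts are sums of
    independent variables; their means differ from those of good partitions by
    a small multiple of n, since s' is close to s. *)
Lemma near_planted_weakly_good (delta : R) : (2 <= q)%N -> 0 <= cin -> 0 <= cout ->
  ~ (cin = 0 /\ cout = 0) -> 0 < delta ->
  exists delta1 C : R, exists M : nat, 0 < delta1 /\
    forall m (s : labelling (m * q) q), (M <= m)%N -> near_balanced delta1 s ->
    exists s' : labelling (m * q) q, balanced s' /\
      \sum_(G : graph (m * q) | `[< ~ weakly_good cin cout delta G s' >])
         graph_weight (edge_prob cin cout s) G <= C / m%:R.
Proof.
move=> q2 hcin hcout hc dl0.
have [d0 cinE coutE ccE] := sbm_params q2 hcin hcout hc.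
have Q2 : 2 <= q%:R :> R by rewrite ler_nat.
have Q0 : 0 < q%:R :> R by lra.
have q0 : (0 < q)%N by case: (q) q2.
have [l1 lN1] : l <= 1 /\ -1 <= l.
  have a1 : 0 <= 1 - l by rewrite -(pmulr_rge0 _ d0) -coutE.
  have a2 : 0 <= 1 + (q%:R - 1) * l by rewrite -(pmulr_rge0 _ d0) -cinE.
  by move: (l) a1 a2 => x a1 a2; clear -Q2 a1 a2; split; nra.
pose K2 := q%:R + 2 * q%:R ^+ 2 + q%:R ^+ 5 : R.
have K2q : 2 * q%:R ^+ 2 <= K2.
  by have : 0 <= q%:R ^+ 5 :> R by []; rewrite /K2; clear -Q0; move: (_ ^+ 5) (_ ^+ 2) => *; lra.
have K20 : 0 < K2 by rewrite (lt_le_trans _ K2q) // mulr_gt0 // exprn_gt0.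
pose D := `|cin - cout|.
pose delta1 := Num.min 1 (delta / (8 * (D + 1) * (K2 + q%:R))).
have D0 : 0 <= D by exact: normr_ge0.
have Dp : 0 < D + 1 by clear -D0; move: D D0 => D D0; lra.
have Kq : 0 < K2 + q%:R by rewrite addr_gt0.
have dl10 : 0 < delta1 by rewrite lt_min ltr01 /= divr_gt0 // mulr_gt0 // mulr_gt0.
have dl11 : delta1 <= 1 by rewrite ge_min lexx.
have dl12 : (D + 1) * ((K2 + q%:R) * delta1) <= delta / 8.
  have : delta1 <= delta / (8 * (D + 1) * (K2 + q%:R)) by rewrite ge_min lexx orbT.
  by rewrite ler_pdivlMr ?mulr_gt0 //; clear; move: (D) (delta1) (K2) => *; lra.
(* C0 n bounds both means; u is the order of the exponential moments, chosen
   so that the second-order term 2 u^2 C0 n is at most u delta n / 4. *)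
pose C0 := cin + cout + delta + 1.
have C01 : 1 <= C0 by rewrite /C0; clear -hcin hcout dl0; lra.
pose u := delta / (8 * C0).
have C00 : 0 < C0 by exact: lt_le_trans C01.
have u0 : 0 < u by rewrite divr_gt0 // mulr_gt0.
have uE : u * C0 = delta / 8 by rewrite /u; field; rewrite gt_eqF.
have u12 : u <= 1 / 2.
  rewrite /u ler_pdivrMr ?mulr_gt0 //; rewrite /C0; clear -hcin hcout dl0; lra.
have [N1 hN1] := nat_above cin; have [N2 hN2] := nat_above cout.
have [N3 hN3] := nat_above (8 * cin / delta).
exists delta1, (2 * (2 / (u * delta))), (N1 + N2 + N3).+1; split=> // m s hm nb.
have [h1 h2 h3 m0] : [/\ (N1 <= m)%N, (N2 <= m)%N, (N3 <= m)%N & (0 < m)%N].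
  by split; move: hm; clear; lia.
have n_gt0 : (0 < m * q)%N by rewrite muln_gt0 m0.
have mn : m%:R <= (m * q)%:R :> R by rewrite ler_nat leq_pmulr.
have mp : 0 < m%:R :> R by rewrite ltr0n.
have np : 0 < (m * q)%:R :> R by rewrite ltr0n.
have ci : cin <= (m * q)%:R by apply: le_trans hN1 (le_trans _ mn); rewrite ler_nat.
have co : cout <= (m * q)%:R by apply: le_trans hN2 (le_trans _ mn); rewrite ler_nat.
have c8 : cin <= delta / 8 * (m * q)%:R.
  have : 8 * cin / delta <= (m * q)%:R by apply: le_trans hN3 (le_trans _ mn); rewrite ler_nat.
  by rewrite ler_pdivrMr //; clear; lra.
have [s' bs' hle] := near_balanced_hamming q2 (ltW dl10) nb.
exists s'; split=> //.
set N := (m * q)%:R in mn np ci co c8 hle.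
have NE : N = m%:R * q%:R by rewrite /N natrM.
have up : q%:R * (cell2 s s')%:R <= (1 + K2 * delta1) * N ^+ 2.
  have := @near_balanced_cell2_le R q delta1 m s s' (m * q) q2 m0.
  rewrite ltW // dl11 -/N divff ?gt_eqF // -/K2; apply => // rho.
  by rewrite trace_label -[X in (_ <= X)%N]card_ord -sum1_card leq_sum // => v _; exact: leq_b1.
have lo : (1 - K2 * delta1) * N ^+ 2 <= q%:R * (cell2 s s')%:R.
  have := cell2_hamming_ge s bs'; rewrite -(ler_nat R) natrD !natrM.
  move: hle; move: ((hamming s s')%:R : R) ((cell2 s s')%:R : R) => h c hle hc2.
  have t1 : q%:R * (q%:R * (m%:R * m%:R)) <= q%:R * (c + 2 * m%:R * (q%:R * h)).
    by rewrite ler_wpM2l // ltW.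
  have t2 : 2 * q%:R * N * h <= 2 * q%:R * N * (q%:R * delta1 * N).
    by rewrite ler_wpM2l // !mulr_ge0 // ltW.
  have t3 : 2 * q%:R ^+ 2 * (delta1 * N ^+ 2) <= K2 * (delta1 * N ^+ 2).
    by rewrite ler_wpM2r // mulr_ge0 ?sqr_ge0 // ltW.
  have e1 : q%:R * (c + 2 * m%:R * (q%:R * h)) = q%:R * c + 2 * q%:R * N * h by rewrite NE; ring.
  have e2 : q%:R * (q%:R * (m%:R * m%:R)) = N ^+ 2 by rewrite NE; ring.
  rewrite e1 e2 in t1; clear -t1 t2 t3.
  move: (q%:R : R) (K2) (delta1) N t1 t2 t3 => Q K dd N t1 t2 t3; lra.
have W0 G : 0 <= graph_weight (edge_prob cin cout s) G.
  exact: graph_weight_ge0 (edge_prob01 s hcin hcout ci co) G.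
have miE : mu_in cin cout s s' - mbar_in q cin (m * q)
  = ((cin - cout) * ((cell2 s s')%:R - N ^+ 2 / q%:R) - cin * N) / (2 * N).
  rewrite mu_inE // cell2_diag // /mbar_in -/N natrM natrX.
  have -> : q%:R * m%:R ^+ 2 = N ^+ 2 / q%:R by rewrite NE; field; rewrite gt_eqF.
  by field; rewrite !gt_eqF.
have mtE : mu_in cin cout s s' + mu_out cin cout s s'
    - (mbar_in q cin (m * q) + mbar_out q cout (m * q))
  = ((cin - cout) * ((cell2 s s)%:R - N ^+ 2 / q%:R) - cin * N) / (2 * N).
  by rewrite mu_totE // /mbar_in /mbar_out -/N natrX -/N; field; rewrite !gt_eqF.
have err (c e : R) : 0 <= e -> `|c - N ^+ 2 / q%:R| <= e * N ^+ 2 -> (D + 1) * e <= delta / 8 ->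
   `|((cin - cout) * (c - N ^+ 2 / q%:R) - cin * N) / (2 * N)| <= delta / 8 * N.
  move=> e0 hce he; rewrite normrM [`|_^-1|]gtr0_norm ?invr_gt0 ?mulr_gt0 //.
  rewrite ler_pdivrMr ?mulr_gt0 //; apply: le_trans (ler_normB _ _) _.
  rewrite normrM -/D [`|cin * N|]ger0_norm ?mulr_ge0 ?(ltW np) //.
  have t1 : D * `|c - N ^+ 2 / q%:R| <= D * (e * N ^+ 2) by rewrite ler_wpM2l.
  have t2 : cin * N <= delta / 8 * N * N by rewrite ler_wpM2r // ltW.
  have t3 : (D + 1) * e * N ^+ 2 <= delta / 8 * N ^+ 2 by rewrite ler_wpM2r // sqr_ge0.
  have t4 : 0 <= e * N ^+ 2 by rewrite mulr_ge0 // sqr_ge0.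
  by move: (`|c - _|) t1 t2 t3 t4 => x; clear; lra.
have de1 : (D + 1) * (K2 * delta1) <= delta / 8.
  apply: le_trans dl12; rewrite ler_pM2l // ler_pM2r // lerDl ltW //.
have de2 : (D + 1) * (q%:R * delta1 ^+ 2) <= delta / 8.
  apply: le_trans dl12; rewrite ler_pM2l //.
  have : q%:R * delta1 ^+ 2 <= q%:R * delta1 by rewrite ler_pM2l // expr2 ler_piMr // ltW.
  have : 0 <= K2 * delta1 by rewrite mulr_ge0 // ltW.
  by clear; lra.
have K2d : 0 <= K2 * delta1 by rewrite mulr_ge0 // ltW.
have dmi : `|mu_in cin cout s s' - mbar_in q cin (m * q)| <= delta / 8 * N.
  rewrite miE; apply: (err _ (K2 * delta1)) => //.
  have Nsq : 0 <= K2 * delta1 * N ^+ 2 by rewrite mulr_ge0 // sqr_ge0.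
  have N3' : K2 * delta1 * N ^+ 2 / q%:R <= K2 * delta1 * N ^+ 2.
    by rewrite ler_pdivrMr // ler_peMr //; clear -Q2; lra.
  rewrite ler_norml; apply/andP; split.
    have : (1 - K2 * delta1) * N ^+ 2 / q%:R <= (cell2 s s')%:R by rewrite ler_pdivrMr // [leRHS]mulrC.
    by move: N3'; clear; move: (K2 * delta1) => k; lra.
  have : (cell2 s s')%:R <= (1 + K2 * delta1) * N ^+ 2 / q%:R by rewrite ler_pdivlMr // [leLHS]mulrC.
  by move: N3'; clear; move: (K2 * delta1) => k; lra.
have dmt : `|mu_in cin cout s s' + mu_out cin cout s s'
    - (mbar_in q cin (m * q) + mbar_out q cout (m * q))| <= delta / 8 * N.
  rewrite mtE; apply: (err _ (q%:R * delta1 ^+ 2)) => //; first by rewrite mulr_ge0 ?sqr_ge0 // ltW.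
  by apply: le_trans (near_balanced_cell2 q2 nb) _; rewrite exprMn mulrA.
have dmo : `|mu_out cin cout s s' - mbar_out q cout (m * q)| <= delta / 4 * N.
  move: dmi dmt; rewrite !ler_norml => /andP[a1 a2] /andP[a3 a4].
  by clear -a1 a2 a3 a4; apply/andP; split; lra.
have dmi' : `|mu_in cin cout s s' - mbar_in q cin (m * q)| <= delta / 4 * N.
  apply: le_trans dmi _; rewrite ler_pM2r //; clear -dl0; lra.
have p01 := edge_prob01 s hcin hcout ci co.
have mui0 : 0 <= mu_in cin cout s s' by apply: sumr_ge0 => e _; case/andP: (p01 e).
have muo0 : 0 <= mu_out cin cout s s' by apply: sumr_ge0 => e _; case/andP: (p01 e).
have bi : mbar_in q cin (m * q) <= cin * N.
  rewrite /mbar_in -/N ler_pM2r // ler_pdivrMr ?mulr_gt0 // ler_peMr //; clear -Q2; lra.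
have bo : mbar_out q cout (m * q) <= cout * N.
  rewrite /mbar_out -/N ler_pM2r // ler_pdivrMr ?mulr_gt0 //.
  have : 0 <= q%:R * cout by rewrite mulr_ge0 // ltW.
  by clear -hcout; lra.
have tail (x mu mb : R) : `|x| <= u -> 0 <= mu -> `|mu - mb| <= delta / 4 * N -> mu <= C0 * N ->
   (expR x - 1) * mu - x * mb - u * delta * N <= - (u * delta / 2 * N).
  move=> xu mu0 dmu muC.
  have x12 : x <= 1 / 2 by apply: le_trans (ler_norm _) (le_trans xu u12).
  have t1 : (expR x - 1) * mu <= (x + 2 * x ^+ 2) * mu.
    by rewrite ler_wpM2r //; have := expR_le_quad x12; move: (expR x); clear -Q0 => y; lra.
  have t2 : x * (mu - mb) <= u * (delta / 4 * N).
    by apply: le_trans (ler_norm _) _; rewrite normrM ler_pM.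
  have t3 : x ^+ 2 * mu <= u ^+ 2 * (C0 * N).
    by apply: ler_pM; rewrite ?sqr_ge0 // -[x ^+ 2]real_normK ?num_real // ler_sqr ?nnegrE // ltW.
  have t4 : u ^+ 2 * (C0 * N) = u * (delta / 8) * N by rewrite -uE; ring.
  rewrite t4 in t3; move: t1 t2 t3; clear; move: (expR x) => y t1 t2 t3; lra.
have tailsum : expR (- (u * delta / 2 * N)) <= 2 / (u * delta) / m%:R.
  apply: le_trans (expRN_le_inv _) _; first by rewrite mulr_gt0 // divr_gt0 // mulr_gt0.
  have -> : 2 / (u * delta) / m%:R = (u * delta / 2 * m%:R)^-1 by field; rewrite !gt_eqF.
  have ud : 0 < u * delta / 2 by rewrite divr_gt0 // mulr_gt0.
  by rewrite lef_pV2 ?posrE; [rewrite ler_pM2l|rewrite mulr_gt0|rewrite mulr_gt0].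
have ul : `|- (u * l)| <= u.
  rewrite normrN normrM gtr0_norm // ler_piMr ?(ltW u0) // ler_norml lN1 l1 //.
have ul' : `|u * l| <= u by rewrite -normrN.
apply: (@le_trans _ _ (\sum_(b : bool) \sum_(G : graph (m * q) |
   if b then u * delta * N - u * l * mbar_in q cin (m * q)
        <= - (u * l) * (m_in G s')%:R + 0 * (m_out G s')%:R
   else u * delta * N + u * l * mbar_out q cout (m * q)
        <= 0 * (m_in G s')%:R + u * l * (m_out G s')%:R)
  graph_weight (edge_prob cin cout s) G)).
  apply: union_bound => // G /asboolP ng.
  case: (lerP (- (delta * N)) (l * ((m_in G s')%:R - mbar_in q cin (m * q)))) => hi.
    case: (lerP (l * ((m_out G s')%:R - mbar_out q cout (m * q))) (delta * N)) => ho.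
      by case: ng; split.
    exists false; have : u * (delta * N) <= u * (l * ((m_out G s')%:R - mbar_out q cout (m * q))).
      by rewrite ler_wpM2l ?(ltW u0) // ltW.
    by move: (m_out G s')%:R (m_in G s')%:R (l) => x y z; clear; lra.
  exists true; have : u * (l * ((m_in G s')%:R - mbar_in q cin (m * q))) <= u * - (delta * N).
    by rewrite ler_wpM2l ?(ltW u0) // ltW.
  by move: (m_out G s')%:R (m_in G s')%:R (l) => x y z; clear; lra.
have -> : 2 * (2 / (u * delta)) / m%:R = 2 / (u * delta) / m%:R + 2 / (u * delta) / m%:R by ring.
rewrite big_bool /=; apply: lerD.
  apply: le_trans (edge_count_tail s s' _ _ _ hcin hcout ci co) _.
  apply: le_trans tailsum; rewrite ler_expR.
  have := tail (- (u * l)) (mu_in cin cout s s') (mbar_in q cin (m * q)) ul mui0 dmi'.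
  have h : mu_in cin cout s s' <= C0 * N.
    have : mu_in cin cout s s' - mbar_in q cin (m * q) <= delta / 4 * N := le_trans (ler_norm _) dmi'.
    by move: bi np; rewrite /C0; clear -hcout dl0; nra.
  move=> /(_ h); rewrite expR0 subrr mul0r addr0.
  by move: (expR _) => y; lra.
apply: le_trans (edge_count_tail s s' _ _ _ hcin hcout ci co) _.
apply: le_trans tailsum; rewrite ler_expR.
have := tail (u * l) (mu_out cin cout s s') (mbar_out q cout (m * q)) ul' muo0 dmo.
have h : mu_out cin cout s s' <= C0 * N.
  have : mu_out cin cout s s' - mbar_out q cout (m * q) <= delta / 4 * N := le_trans (ler_norm _) dmo.
  by move: bo np; rewrite /C0; clear -hcin dl0; nra.
move=> /(_ h); rewrite expR0 subrr mul0r add0r.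
by move: (expR _) => y; lra.
Qed.

End Planted.

(** * Total correctness with running time *)

Local Notation eval := Pilot.Defs.eval.

Section Exec.
Local Open Scope nat_scope.

(** Weakest precondition: p, started in m, halts within K steps in a memory
    satisfying Q. *)
Definition exec (p : program) (m : memory) (K : nat) (Q : memory -> Prop) : Prop :=
  exists k m', [/\ runs p m k m', k <= K & Q m'].

Lemma exec_mono p m K K' (Q Q' : memory -> Prop) : exec p m K Q -> K <= K' ->
  (forall m', Q m' -> Q' m') -> exec p m K' Q'.
Proof.
move=> [k [m' [r le_k Qm]]] le_K QQ; exists k, m'; split=> //; last exact: QQ.
exact: leq_trans le_K.
Qed.

Lemma exec_skip m K (Q : memory -> Prop) : 0 < K -> Q m -> exec Skip m K Q.
Proof. by move=> K0 Qm; exists 1, m; split=> //; exact: RunSkip. Qed.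

Lemma exec_store a i e m K (Q : memory -> Prop) : 0 < K ->
  Q (update m a (eval m i) (eval m e)) -> exec (Store a i e) m K Q.
Proof. by move=> K0 Qm; exists 1, (update m a (eval m i) (eval m e)); split=> //; exact: RunStore. Qed.

Lemma exec_seq p1 p2 m K1 K2 K (Q : memory -> Prop) : (K1 + K2).+1 <= K ->
  exec p1 m K1 (fun m1 => exec p2 m1 K2 Q) -> exec (Seq p1 p2) m K Q.
Proof.
move=> le_K [k1 [m1 [r1 l1 [k2 [m2 [r2 l2 Qm]]]]]].
exists (k1 + k2).+1, m2; split=> //; first exact: RunSeq r1 r2.
by apply: leq_trans le_K; rewrite ltnS leq_add.
Qed.

Lemma exec_if e p1 p2 m K (Q : memory -> Prop) :
  (eval m e <> 0 -> exec p1 m K Q) -> (eval m e = 0 -> exec p2 m K Q) ->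
  exec (If e p1 p2) m K.+1 Q.
Proof.
move=> H1 H2; case: (eval m e =P 0) => e0.
  have [k [m' [r lk Qm]]] := H2 e0.
  by exists k.+1, m'; split=> //; exact: RunIfFalse.
have [k [m' [r lk Qm]]] := H1 e0.
by exists k.+1, m'; split=> //; exact: RunIfTrue.
Qed.

(** For loops whose number N of iterations is known in advance, with an
    invariant indexed by the iteration. *)
Lemma exec_while N (I : nat -> memory -> Prop) e p m K : I 0 m ->
  (forall j m, j < N -> I j m -> eval m e <> 0) ->
  (forall m, I N m -> eval m e = 0) ->
  (forall j m, j < N -> I j m -> exec p m K (I j.+1)) ->
  exec (While e p) m (N * K.+1).+1 (I N).
Proof.
move=> I0 neq0 eq0 body.
suff H j m1 : j <= N -> I (N - j) m1 -> exec (While e p) m1 (j * K.+1).+1 (I N).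
  by apply: H; rewrite ?leqnn // subnn.
elim: j m1 => [|j IH] m1 le_j Ij.
  rewrite subn0 in Ij; exists 1, m1; split=> //; exact: RunWhileFalse (eq0 _ Ij).
have lt_N : N - j.+1 < N by rewrite ltn_subrL (leq_ltn_trans _ le_j).
have [k1 [m2 [r1 l1 I2]]] := body _ _ lt_N Ij.
rewrite -subSn // subSS in I2.
have [k2 [m3 [r2 l2 I3]]] := IH m2 (ltnW le_j) I2.
exists (k1 + k2).+1, m3; split=> //.
  exact: RunWhileTrue (neq0 _ _ lt_N Ij) r1 r2.
by rewrite mulSn ltnS addSn -addnS leq_add.
Qed.

Definition frame (L : seq nat) (m m' : memory) : Prop :=
  forall a, a \notin L -> forall j, m' a j = m a j.

Lemma frame_sub L L' m m' : {subset L <= L'} -> frame L m m' -> frame L' m m'.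
Proof. by move=> sLL fr a aL; apply: fr; apply: contra aL; exact: sLL. Qed.

Lemma frame_trans L m1 m2 m3 : frame L m1 m2 -> frame L m2 m3 -> frame L m1 m3.
Proof. by move=> f1 f2 a aL j; rewrite f2 // f1. Qed.

Lemma frame_update L m m' a i v : a \in L -> frame L m m' -> frame L m (update m' a i v).
Proof.
move=> aL fr b bL j; rewrite /update; case: eqP => [ba|_] /=; last exact: fr.
by rewrite ba aL in bL.
Qed.

End Exec.

(** * Exhaustive search *)

Section Search.
Local Open Scope nat_scope.
Variables (q : nat) (same : bool).
Hypothesis q_gt0 : 0 < q.

Definition var a := Read a (Const 0).
Definition set_var a e := Store a (Const 0) e.
Definition incr a := set_var a (Plus (var a) (Const 1)).
Definition times (e : expr) := iter q (fun x => Plus e x) (Const 0).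
Definition less a b := Minus (var b) (var a).
Definition differ e1 e2 := Plus (Minus e1 e2) (Minus e2 e1).

Lemma eval_times m e : eval m (times e) = q * eval m e.
Proof. by rewrite /times; elim: q => //= k ->; rewrite mulSn. Qed.

(** Arrays of the program. Those other than the adjacency matrix, the output and
    the candidate labelling TAU are used as scalars, in their cell 0. *)
Notation N_ := 0 (only parsing).
Notation ADJ := 1 (only parsing).
Notation OUT := 2 (only parsing).
Notation TAU := 3 (only parsing).
Notation CODE := 4 (only parsing).
Notation POW := 5 (only parsing).
Notation IDX := 6 (only parsing).
Notation REM := 7 (only parsing).
Notation QUO := 8 (only parsing).
Notation BAD := 9 (only parsing).
Notation SCORE := 10 (only parsing).
Notation PTR := 11 (only parsing).
Notation U := 12 (only parsing).
Notation V := 13 (only parsing).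
Notation CNT := 14 (only parsing).
Notation BEST := 15 (only parsing).

Definition power_loop :=
  While (less IDX N_) (Seq (set_var POW (times (var POW))) (incr IDX)).

(** Division with remainder by repeated subtraction: its cost, up to q^n steps,
    is affordable. *)
Definition divide_loop :=
  While (Minus (Plus (var REM) (Const 1)) (Const q))
    (Seq (set_var REM (Minus (var REM) (Const q))) (incr QUO)).

Definition decode_loop :=
  While (less IDX N_)
    (Seq (set_var QUO (Const 0))
    (Seq divide_loop
    (Seq (Store TAU (var IDX) (var REM))
    (Seq (set_var REM (var QUO)) (incr IDX))))).

(** Each vertex in the group of U adds q to CNT, so that the group has n / q
    vertices if CNT ends at n. PTR follows U * n + V without multiplication. *)
Definition row_loop :=
  While (less V N_)
    (Seq (If (differ (Read TAU (var U)) (Read TAU (var V)))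
             (if same then Skip
              else set_var SCORE (Plus (var SCORE) (Read ADJ (var PTR))))
             (Seq (set_var CNT (Plus (var CNT) (Const q)))
                  (if same then set_var SCORE (Plus (var SCORE) (Read ADJ (var PTR)))
                   else Skip)))
    (Seq (incr PTR) (incr V))).

Definition score_loop :=
  While (less U N_)
    (Seq (set_var CNT (Const 0))
    (Seq (set_var V (Const 0))
    (Seq row_loop
    (Seq (If (differ (var CNT) (var N_)) (set_var BAD (Const 1)) Skip)
         (incr U))))).

Definition copy_loop :=
  While (less IDX N_)
    (Seq (Store OUT (var IDX) (Read TAU (var IDX))) (incr IDX)).

(** SCORE starts at 1: every balanced labelling beats the initial value 0 of
    BEST, even in a graph without edges. *)
Definition try_code :=
  Seq (set_var REM (var CODE))
  (Seq (set_var IDX (Const 0))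
  (Seq decode_loop
  (Seq (set_var BAD (Const 0))
  (Seq (set_var SCORE (Const 1))
  (Seq (set_var PTR (Const 0))
  (Seq (set_var U (Const 0))
  (Seq score_loop
  (Seq (If (var BAD) Skip
         (If (Minus (var SCORE) (var BEST))
            (Seq (set_var BEST (var SCORE))
            (Seq (set_var IDX (Const 0)) copy_loop))
            Skip))
       (incr CODE))))))))).

Definition search : program :=
  Seq (set_var POW (Const 1))
  (Seq power_loop (While (less CODE POW) try_code)).

Lemma exec_power m : m IDX 0 = 0 -> m POW 0 = 1 ->
  exec power_loop m (m N_ 0 * 4).+1
    (fun m' => frame [:: POW; IDX] m m' /\ m' POW 0 = q ^ m N_ 0).
Proof.
move=> i0 p1.
pose I j m' := [/\ frame [:: POW; IDX] m m', m' IDX 0 = j & m' POW 0 = q ^ j].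
apply: (@exec_mono _ _ (m N_ 0 * 4).+1 _ (I (m N_ 0))) => // [|m' [fr _ ->] //].
apply: (@exec_while _ I).
- by split=> //; rewrite expn0.
- by move=> j m' lt_j [fr idx _] /=; rewrite fr // idx; lia.
- by move=> m' [fr idx _] /=; rewrite fr // idx subnn.
move=> j m' lt_j [fr idx pow].
apply: (@exec_seq _ _ _ 1 1) => //; apply: exec_store => //; apply: exec_store => //.
split; first by do 2 apply: frame_update => //.
  by rewrite /update /= idx addn1.
by rewrite /update /= eval_times /= pow expnS.
Qed.

Lemma exec_divide m : m QUO 0 = 0 ->
  exec divide_loop m (m REM 0 * 4).+1
    (fun m' => [/\ frame [:: REM; QUO] m m', m' REM 0 = m REM 0 %% q &
                   m' QUO 0 = m REM 0 %/ q]).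
Proof.
move=> quo0; set r := m REM 0.
pose I j m' := [/\ frame [:: REM; QUO] m m', m' REM 0 = r - j * q & m' QUO 0 = j].
have rE := divn_eq r q; have rlt := ltn_pmod r q_gt0.
apply: (@exec_mono _ _ ((r %/ q) * 4).+1 _ (I (r %/ q))).
- apply: (@exec_while _ I).
  + by split=> //; rewrite subn0.
  + move=> j m' lt_j [_ rem _] /=; rewrite rem.
    have : j.+1 * q <= r %/ q * q by rewrite leq_mul2r lt_j orbT.
    by rewrite mulSn; lia.
  + move=> m' [_ rem _] /=; rewrite rem; lia.
  move=> j m' lt_j [fr rem quo].
  apply: (@exec_seq _ _ _ 1 1) => //; apply: exec_store => //; apply: exec_store => //.
  split; first by do 2 apply: frame_update => //.
    by rewrite /update /= rem mulSn; lia.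
  by rewrite /update /= quo addn1.
- by rewrite ltnS leq_mul2r leq_div.
by move=> m' [fr -> ->]; split=> //; lia.
Qed.

Definition digit c j := (c %/ q ^ j) %% q.

Lemma exec_decode c m : m IDX 0 = 0 -> m REM 0 = c ->
  exec decode_loop m (m N_ 0 * (c * 4 + 20)).+1
    (fun m' => frame [:: TAU; IDX; REM; QUO] m m' /\
               forall j, j < m N_ 0 -> m' TAU j = digit c j).
Proof.
move=> i0 r0.
pose I j m' := [/\ frame [:: TAU; IDX; REM; QUO] m m', m' IDX 0 = j,
  m' REM 0 = c %/ q ^ j & forall k, k < j -> m' TAU k = digit c k].
apply: (@exec_mono _ _ (m N_ 0 * (c * 4 + 19).+1).+1 _ (I (m N_ 0))); last first.
- by move=> m' [fr _ _ H].
- by rewrite ltnS leq_mul2l [c * 4 + 20]addnS leqnn orbT.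
apply: (@exec_while _ I).
- by split=> //; rewrite expn0 divn1.
- by move=> j m' lt_j [fr idx _ _] /=; rewrite fr // idx; lia.
- by move=> m' [fr idx _ _] /=; rewrite fr // idx subnn.
move=> j m' lt_j [fr idx rem tau].
apply: (@exec_seq _ _ _ 1 (c * 4 + 17)); first by lia.
apply: exec_store => //=.
apply: (@exec_seq _ _ _ (c * 4).+1 15); first by lia.
set m1 := update _ _ _ _.
apply: (exec_mono (exec_divide (m := m1) erefl)).
  by rewrite /m1 /update /= rem ltnS leq_mul2r leq_div.
move=> m2 [fr2]; have -> : m1 REM 0 = c %/ q ^ j by rewrite /m1 /update /= rem.
move=> rem2 quo2.
have fr2' : frame [:: TAU; IDX; REM; QUO] m m2.
  apply: frame_trans (frame_sub _ fr2); first exact: frame_update.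
  by move=> a; rewrite !inE => /orP[] ->; rewrite ?orbT.
have idx2 : m2 IDX 0 = j by rewrite fr2 // /m1 /update /= idx.
apply: (@exec_seq _ _ _ 1 10) => //; apply: exec_store => //.
apply: (@exec_seq _ _ _ 1 5) => //; apply: exec_store => //.
apply: exec_store => //.
split; first by do 3 apply: frame_update => //.
- by rewrite /update /= idx2 addn1.
- by rewrite /update /= quo2 expnSr divnMA.
move=> k; rewrite /update /= idx2 rem2 ltnS leq_eqVlt.
case: eqP => [-> _ //|/eqP ne /= lt_k].
by rewrite fr2 // /m1 /update /= tau.
Qed.


(** A is an adjacency matrix in row-major order. *)
Definition contrib (tau A : nat -> nat) n u v :=
  if (tau u == tau v) == same then A (u * n + v) else 0.

Definition cnt (tau : nat -> nat) n u := \sum_(v < n) (tau u == tau v).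

(** Balancedness, tested through the groups of the vertices; empty groups are
    excluded by counting ([equitableP]). *)
Definition equitable (tau : nat -> nat) n : bool :=
  [forall u : 'I_n, q * cnt tau n u == n].

Definition score (tau A : nat -> nat) n := \sum_(u < n) \sum_(v < n) contrib tau A n u v.

Lemma differ_eq0 a b : ((a - b) + (b - a) == 0) = (a == b).
Proof. by rewrite addn_eq0 !subn_eq0 eqn_leq. Qed.

Lemma exec_row m n p : m N_ 0 = n -> m V 0 = 0 -> m CNT 0 = 0 -> m PTR 0 = p ->
  exec row_loop m (n * 9).+1 (fun m' => [/\ frame [:: SCORE; PTR; V; CNT] m m',
    m' PTR 0 = p + n, m' CNT 0 = q * cnt (m TAU) n (m U 0) &
    m' SCORE 0 = m SCORE 0 + \sum_(v < n)
      (if (m TAU (m U 0) == m TAU v) == same then m ADJ (p + v) else 0)]).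
Proof.
move=> n0 v0 c0 p0; set tau := m TAU; set u := m U 0.
pose I v m' := [/\ frame [:: SCORE; PTR; V; CNT] m m' /\ m' V 0 = v,
  m' PTR 0 = p + v, m' CNT 0 = q * (\sum_(w < v) (tau u == tau w)) &
  m' SCORE 0 = m SCORE 0 + \sum_(w < v)
      (if (tau u == tau w) == same then m ADJ (p + w) else 0)].
apply: (@exec_mono _ _ (n * 9).+1 _ (I n)) => // [|m' [[fr _] -> -> ->] //].
apply: (@exec_while _ I).
- by split; rewrite ?big_ord0 ?muln0 ?addn0.
- by move=> j m' lt_j [[fr vE] _ _ _] /=; rewrite fr // vE n0; lia.
- by move=> m' [[fr vE] _ _ _] /=; rewrite fr // vE n0 subnn.
move=> j m' lt_j [[fr vE] ptr cn sc].
have tauE k : m' TAU k = tau k by rewrite fr.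
have uE : m' U 0 = u by rewrite fr.
have adjE k : m' ADJ k = m ADJ k by rewrite fr.
apply: (@exec_seq _ _ _ 4 3) => //.
pose Q m1 := [/\ frame [:: SCORE; PTR; V; CNT] m m1, m1 V 0 = j,
  m1 PTR 0 = p + j, m1 CNT 0 = q * (\sum_(w < j.+1) (tau u == tau w)) &
  m1 SCORE 0 = m SCORE 0 + \sum_(w < j.+1)
      (if (tau u == tau w) == same then m ADJ (p + w) else 0)].
apply: (@exec_mono _ _ 4 _ Q) => //; last first.
  move=> m1 [fr1 v1 p1 c1 s1].
  apply: (@exec_seq _ _ _ 1 1) => //; apply: exec_store => //; apply: exec_store => //.
  split; [split; first by do 2 apply: frame_update => //| | |] => //.
  - by rewrite /update /= v1 addn1.
  - by rewrite /update /= p1 addn1 addnS.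
apply: exec_if => /= /eqP; rewrite tauE tauE uE vE differ_eq0 => eqt.
  case sameE: same; [apply: exec_skip => //|apply: exec_store => //];
    split; rewrite ?big_ord_recr /= ?(negPf eqt) ?addn0 //.
  - by rewrite sameE /= addn0 sc sameE.
  - exact: frame_update.
  - by rewrite /update /= ptr adjE sc sameE /= addnA.
apply: (@exec_seq _ _ _ 1 1) => //; apply: exec_store => //.
have fr1 x : frame [:: SCORE; PTR; V; CNT] m (update m' CNT 0 x) by exact: frame_update.
case sameE: same; [apply: exec_store => //|apply: exec_skip => //];
  split; rewrite ?big_ord_recr /= ?eqt ?addn0 //.
- exact: frame_update.
- by rewrite /update /= cn mulnDr muln1.
- by rewrite /update /= ptr adjE sc sameE /= addnA.
- by rewrite /update /= cn mulnDr muln1.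
- by rewrite sameE /= addn0 /update /= sc sameE.
Qed.

Lemma exec_score m n : m N_ 0 = n -> m PTR 0 = 0 -> m U 0 = 0 -> m BAD 0 = 0 ->
  exec score_loop m (n * (n * 9 + 13)).+1
    (fun m' => [/\ frame [:: BAD; SCORE; PTR; U; V; CNT] m m',
      (m' BAD 0 == 0) = equitable (m TAU) n &
      m' SCORE 0 = m SCORE 0 + score (m TAU) (m ADJ) n]).
Proof.
move=> n0 p0 u0 b0; set tau := m TAU.
pose I u m' := [/\ frame [:: BAD; SCORE; PTR; U; V; CNT] m m' /\ m' U 0 = u,
  m' PTR 0 = u * n, (m' BAD 0 == 0) = [forall w : 'I_u, q * cnt tau n w == n] &
  m' SCORE 0 = m SCORE 0 + \sum_(w < u) \sum_(v < n) contrib tau (m ADJ) n w v].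
apply: (@exec_mono _ _ (n * (n * 9 + 12).+1).+1 _ (I n)); last first.
- by move=> m' [[fr _] _ -> ->].
- by rewrite ltnS leq_mul2l [_ + 13]addnS leqnn orbT.
apply: (@exec_while _ I).
- split; rewrite ?big_ord0 ?addn0 //; rewrite b0 eqxx; symmetry; apply/forallP => -[] //.
- by move=> j m' lt_j [[fr uE] _ _ _] /=; rewrite fr // uE n0; lia.
- by move=> m' [[fr uE] _ _ _] /=; rewrite fr // uE n0 subnn.
move=> u m' lt_u [[fr uE] ptr bad sc].
apply: (@exec_seq _ _ _ 1 (n * 9 + 10)); first by lia.
apply: exec_store => //=.
apply: (@exec_seq _ _ _ 1 (n * 9 + 8)); first by lia.
apply: exec_store => //=.
apply: (@exec_seq _ _ _ (n * 9).+1 6); first by lia.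
set m1 := update _ _ _ _.
have n1 : m1 N_ 0 = n by rewrite /m1 /update /= fr.
have p1 : m1 PTR 0 = u * n by rewrite /m1 /update /= ptr.
apply: (exec_mono (exec_row n1 erefl erefl p1)) => // m2 [fr2 ptr2 cnt2 sc2].
have tau1 k : m1 TAU k = tau k by rewrite /m1 /update /= fr.
have u1 : m1 U 0 = u by rewrite /m1 /update /= uE.
have fr3 : frame [:: BAD; SCORE; PTR; U; V; CNT] m m2.
  apply: (@frame_trans _ _ m1); first by do 2 apply: frame_update => //.
  by apply: frame_sub fr2 => a; rewrite !inE => /or4P[] ->; rewrite ?orbT.
have sc2' : m2 SCORE 0 = m SCORE 0 + \sum_(w < u.+1) \sum_(v < n) contrib tau (m ADJ) n w v.
  rewrite sc2 big_ord_recr /= {1}/m1 /update /= sc -addnA; congr (_ + (_ + _)).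
  apply: eq_bigr => v _; rewrite /contrib u1 !tau1.
  by case: ifP => // _; rewrite /m1 /update /= fr.
have cnt2' : m2 CNT 0 = q * cnt tau n u.
  by rewrite cnt2 u1 /cnt; congr (_ * _); apply: eq_bigr => v _; rewrite !tau1.
have u2 : m2 U 0 = u by rewrite fr2.
have bad2 : m2 BAD 0 = m' BAD 0 by rewrite fr2.
have n2 : m2 N_ 0 = n by rewrite fr3.
have badE : [forall w : 'I_u.+1, q * cnt tau n w == n]
   = [forall w : 'I_u, q * cnt tau n w == n] && (q * cnt tau n u == n).
  apply/forallP/andP => [H|[/forallP H1 H2] w].
    split; last exact: (H ord_max).
    by apply/forallP => w; exact: (H (widen_ord (leqnSn u) w)).
  have := ltn_ord w; rewrite ltnS leq_eqVlt => /predU1P[->//|lt_w].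
  exact: (H1 (Ordinal lt_w)).
apply: (@exec_seq _ _ _ 2 1) => //.
apply: exec_if => /= /eqP; rewrite cnt2' n2 differ_eq0 => eqc.
  apply: exec_store => //; apply: exec_store => //.
  split; rewrite ?badE ?(negPf eqc) ?andbF //.
  - by split; [do 2 apply: frame_update => //|rewrite /update /= u2 addn1].
  - by rewrite /update /= ptr2 mulSn addnC.
apply: exec_skip => //; apply: exec_store => //.
split; rewrite ?badE ?eqc ?andbT //.
- by split; [apply: frame_update|rewrite /update /= u2 addn1].
- by rewrite /update /= ptr2 mulSn addnC.
- by rewrite /update /= bad2.
Qed.

Lemma exec_copy m n : m N_ 0 = n -> m IDX 0 = 0 ->
  exec copy_loop m (n * 4).+1 (fun m' => frame [:: OUT; IDX] m m' /\
     forall j, j < n -> m' OUT j = m TAU j).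
Proof.
move=> n0 i0.
pose I j m' := [/\ frame [:: OUT; IDX] m m', m' IDX 0 = j &
   forall k, k < j -> m' OUT k = m TAU k].
apply: (@exec_mono _ _ (n * 4).+1 _ (I n)) => // [|m' [] //].
apply: (@exec_while _ I) => //.
- by move=> j m' lt_j [fr idx _] /=; rewrite fr // idx n0; lia.
- by move=> m' [fr idx _] /=; rewrite fr // idx n0 subnn.
move=> j m' lt_j [fr idx out].
apply: (@exec_seq _ _ _ 1 1) => //; apply: exec_store => //; apply: exec_store => //.
split; first by do 2 apply: frame_update => //.
  by rewrite /update /= idx addn1.
move=> k; rewrite /update /= idx ltnS leq_eqVlt.
case: eqP => [-> _ /=|/eqP ne /= lt_k]; first by rewrite fr.
exact: out.
Qed.

(** Everything that testing one code may change. *)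
Definition scratch := [:: OUT; TAU; CODE; IDX; REM; QUO; BAD; SCORE; PTR; U; V; CNT; BEST].

Definition improves A n c best :=
  equitable (digit c) n && (best < (score (digit c) A n).+1).

Lemma exec_try m n c : m N_ 0 = n -> m CODE 0 = c ->
  exec try_code m (n * (c * 4 + 20) + n * (n * 9 + 13) + n * 4 + 50)
    (fun m' => [/\ frame scratch m m', m' CODE 0 = c.+1,
      m' BEST 0 = (if improves (m ADJ) n c (m BEST 0) then (score (digit c) (m ADJ) n).+1
                   else m BEST 0) &
      forall j, j < n -> m' OUT j = (if improves (m ADJ) n c (m BEST 0) then digit c j
                                     else m OUT j)]).
Proof.
move=> n0 c0.
set D := n * (c * 4 + 20); set S := n * (n * 9 + 13).
apply: (@exec_seq _ _ _ 1 (D + S + n * 4 + 48)); first by lia.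
apply: exec_store => //=.
apply: (@exec_seq _ _ _ 1 (D + S + n * 4 + 46)); first by lia.
apply: exec_store => //=.
apply: (@exec_seq _ _ _ D.+1 (S + n * 4 + 44)); first by lia.
set m1 := update _ _ _ _.
have fr1 : frame scratch m m1 by do 2 apply: frame_update => //.
have r1 : m1 REM 0 = c by rewrite /m1 /update /= c0.
apply: (exec_mono (exec_decode erefl r1)).
  by rewrite /m1 /update /= n0.
move=> m2 [fr2 tau2].
have fr2' : frame scratch m m2.
  apply: frame_trans fr1 _; apply: frame_sub fr2 => a.
  by rewrite !inE => /or4P[] ->; rewrite ?orbT.
have n2 : m1 N_ 0 = n by rewrite /m1 /update /=.
rewrite n2 in tau2.
apply: (@exec_seq _ _ _ 1 (S + n * 4 + 42)); first by lia.
apply: exec_store => //=.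
apply: (@exec_seq _ _ _ 1 (S + n * 4 + 40)); first by lia.
apply: exec_store => //=.
apply: (@exec_seq _ _ _ 1 (S + n * 4 + 38)); first by lia.
apply: exec_store => //=.
apply: (@exec_seq _ _ _ 1 (S + n * 4 + 36)); first by lia.
apply: exec_store => //=.
apply: (@exec_seq _ _ _ S.+1 (n * 4 + 34)); first by lia.
set m3 := update _ _ _ _.
have fr3 : frame scratch m m3 by do 4 apply: frame_update => //.
have n3 : m3 N_ 0 = n by rewrite fr3.
apply: (exec_mono (exec_score n3 erefl erefl erefl)) => // m4 [fr4 bad4 sc4].
have fr4' : frame scratch m m4.
  apply: frame_trans fr3 _; apply: frame_sub fr4 => a.
  by rewrite !inE; do ![case/orP]; move=> ->; rewrite ?orbT.
have tau3 j : j < n -> m3 TAU j = digit c j by move=> lt_j; rewrite /m3 /update /= tau2.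
have adj3 : m3 ADJ =1 m ADJ by move=> j; rewrite fr3.
have eqE : equitable (m3 TAU) n = equitable (digit c) n.
  apply: eq_forallb => u; congr (_ * _ == _); apply: eq_bigr => v _.
  by rewrite !tau3.
have scE : score (m3 TAU) (m3 ADJ) n = score (digit c) (m ADJ) n.
  apply: eq_bigr => u _; apply: eq_bigr => v _.
  by rewrite /contrib !tau3 // adj3.
rewrite eqE in bad4; rewrite scE {1}/m3 /update /= add1n in sc4.
have best2 : m2 BEST 0 = m BEST 0 by rewrite fr2 // /m1 /update.
have best4 : m4 BEST 0 = m BEST 0 by rewrite fr4 // /m3 /update /= best2.
have code4 : m4 CODE 0 = c by rewrite fr4 // /m3 /update /= fr2 // /m1 /update /=.
have out4 j : m4 OUT j = m OUT j by rewrite fr4 // /m3 /update /= fr2.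
have tau4 j : j < n -> m4 TAU j = digit c j by move=> lt_j; rewrite fr4 // tau3.
apply: (@exec_seq _ _ _ (n * 4 + 20) 1); first by lia.
pose Q m' := [/\ frame scratch m m', m' CODE 0 = c,
      m' BEST 0 = (if improves (m ADJ) n c (m BEST 0) then (score (digit c) (m ADJ) n).+1
                   else m BEST 0) &
      forall j, j < n -> m' OUT j = (if improves (m ADJ) n c (m BEST 0) then digit c j
                                     else m OUT j)].
apply: (@exec_mono _ _ (n * 4 + 20) _ Q) => //; last first.
  move=> m5 [fr5 code5 best5 out5]; apply: exec_store => //.
  split; [exact: frame_update| |exact: best5|exact: out5].
  by rewrite /update /= code5 addn1.
rewrite addnS; apply: exec_if => /= /eqP; rewrite bad4 => eq4.
  apply: exec_skip; first by lia.
  by split; rewrite /improves ?(negPf eq4).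
rewrite addnS; apply: exec_if => /= /eqP; rewrite sc4 best4 subn_eq0 => lt4; last first.
  apply: exec_skip; first by lia.
  have nimp : improves (m ADJ) n c (m BEST 0) = false by rewrite /improves ltnNge lt4 andbF.
  by split; rewrite ?nimp.
rewrite -ltnNge in lt4.
have imp : improves (m ADJ) n c (m BEST 0) by rewrite /improves eq4 lt4.
apply: (@exec_seq _ _ _ 1 (n * 4 + 16)); first by lia.
apply: exec_store => //=.
apply: (@exec_seq _ _ _ 1 (n * 4 + 14)); first by lia.
apply: exec_store => //=.
set m5 := update _ _ _ _.
have fr5 : frame scratch m m5 by do 2 apply: frame_update => //.
have n5 : m5 N_ 0 = n by rewrite fr5.
apply: (exec_mono (exec_copy n5 erefl)); first by lia.
move=> m6 [fr6 out6]; rewrite /Q imp; split.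
- apply: frame_trans fr5 _; apply: frame_sub fr6 => a.
  by rewrite !inE => /orP[] ->; rewrite ?orbT.
- by rewrite fr6 // /m5 /update /= code4.
- by rewrite fr6 // /m5 /update /= sc4.
- by move=> j lt_j; rewrite out6 // /m5 /update /= tau4.
Qed.

(** The codes below q ^ n are tried in turn; the invariant records the best
    score so far and a code attaining it. *)
Lemma exec_search m n : m N_ 0 = n -> m CODE 0 = 0 -> m IDX 0 = 0 -> m BEST 0 = 0 ->
  exec search m
    (n * 4 + (q ^ n) * (n * ((q ^ n) * 4 + 20) + n * (n * 9 + 13) + n * 4 + 51) + 10)
    (fun m' => exists best : nat,
      [/\ best = 0 \/ exists c, [/\ c < q ^ n, equitable (digit c) n,
             best = (score (digit c) (m ADJ) n).+1 & forall j, j < n -> m' OUT j = digit c j] &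
          forall c, c < q ^ n -> equitable (digit c) n -> (score (digit c) (m ADJ) n).+1 <= best]).
Proof.
move=> n0 c0 i0 b0; set T := q ^ n.
set B := n * (T * 4 + 20) + n * (n * 9 + 13) + n * 4 + 50.
apply: (@exec_seq _ _ _ 1 (n * 4 + T * B.+1 + 8)); first by rewrite /B; lia.
apply: exec_store => //=.
apply: (@exec_seq _ _ _ (n * 4).+1 (T * B.+1).+1); first by lia.
set m1 := update _ _ _ _.
have fr1 : frame (POW :: IDX :: scratch) m m1 by apply: frame_update => //.
have n1 : m1 N_ 0 = n by rewrite fr1.
have i1 : m1 IDX 0 = 0 by rewrite /m1 /update.
apply: (exec_mono (exec_power i1 erefl)); first by rewrite n1.
move=> m2 [fr2 pow2]; rewrite n1 -/T in pow2.
have fr2' : frame (POW :: IDX :: scratch) m m2.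
  apply: frame_trans fr1 _; apply: frame_sub fr2 => a.
  by rewrite !inE => /orP[] ->; rewrite ?orbT.
pose I c m' := [/\ frame (POW :: IDX :: scratch) m m' /\ m' POW 0 = T, m' CODE 0 = c,
   m' BEST 0 = 0 \/ exists c', [/\ c' < T, equitable (digit c') n,
             m' BEST 0 = (score (digit c') (m ADJ) n).+1 & forall j, j < n -> m' OUT j = digit c' j] &
   forall c', c' < c -> equitable (digit c') n -> (score (digit c') (m ADJ) n).+1 <= m' BEST 0].
apply: (@exec_mono _ _ (T * B.+1).+1 _ (I T)) => //; last first.
  by move=> m' [_ _ H1 H2]; exists (m' BEST 0).
apply: (@exec_while _ I).
- split=> //; first by rewrite fr2 // /m1 /update /= c0.
  by left; rewrite fr2 // /m1 /update /= b0.
- by move=> c m' lt_c [[_ pE] cE _ _] /=; rewrite pE cE; lia.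
- by move=> m' [[_ pE] cE _ _] /=; rewrite pE cE subnn.
move=> c m' lt_c [[fr pE] cE best all].
have n' : m' N_ 0 = n by rewrite fr.
have adj' j : m' ADJ j = m ADJ j by rewrite fr.
have scE c' : score (digit c') (m' ADJ) n = score (digit c') (m ADJ) n.
  by apply: eq_bigr => u _; apply: eq_bigr => v _; rewrite /contrib adj'.
apply: (exec_mono (exec_try n' cE)).
  by rewrite /B !leq_add2r leq_mul2l leq_add2r leq_mul2r (ltnW lt_c) !orbT.
move=> m3 [fr3 code3 best3 out3].
rewrite /improves scE in best3 out3.
split=> //.
- split; last by rewrite fr3.
  apply: frame_trans fr _; apply: frame_sub fr3 => a.
  by rewrite !inE => ->; rewrite !orbT.
- case: ifP best3 out3 => [/andP[eqc lt_b]|_] best3 out3.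
    by right; exists c.
  case: best => [b|[c' [lt_c' eq' b out']]]; [left|right]; first by rewrite best3.
  by exists c'; split=> // [|j lt_j]; [rewrite best3|rewrite out3 // out'].
move=> c'; rewrite ltnS leq_eqVlt => /predU1P[->|lt_c'] eqc.
  by rewrite best3 eqc /=; case: ifP => // /negbT; rewrite -leqNgt.
have le_b := all c' lt_c' eqc.
rewrite best3; case: ifP => // /andP[_ lt_b].
exact: leq_trans le_b (ltnW lt_b).
Qed.

End Search.

(** * Correctness of the search *)

Local Notation adjacent := Pilot.Defs.adjacent.

Section SearchCorrect.
Local Open Scope nat_scope.
Variables (q : nat).
Hypothesis q_gt0 : 0 < q.

Lemma digit_surj n (f : nat -> nat) : (forall j, j < n -> f j < q) ->
  exists2 c, c < q ^ n & forall j, j < n -> digit q c j = f j.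
Proof.
elim: n f => [|n IH] f flt; first by exists 0; rewrite ?expn0.
have [j lt_j|c lt_c cE] := IH (fun j => f j.+1); first exact: flt.
exists (c * q + f 0).
  rewrite expnS; have := flt 0 (ltn0Sn n); nia.
have f0 := flt 0 (ltn0Sn n).
case=> [|j] lt_j; first by rewrite /digit expn0 divn1 modnMDl modn_small.
by rewrite -cE // /digit expnS divnMA divnMDl // (divn_small f0) addn0.
Qed.

Lemma cnt_class n (t : labelling n q) (tau : nat -> nat) (u : 'I_n) :
  (forall v : 'I_n, tau v = t v) -> cnt tau n u = #|label_class t (t u)|.
Proof.
move=> tauE; rewrite /cnt card_classE; apply: eq_bigr => v _.
by rewrite !tauE (inj_eq val_inj) eq_sym.
Qed.

(** A group that is not empty has m vertices, so none has more, and the sizes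
    sum to m q. *)
Lemma equitableP m (t : labelling (m * q) q) (tau : nat -> nat) :
  (forall v : 'I_(m * q), tau v = t v) ->
  reflect (balanced t) (equitable q tau (m * q)).
Proof.
move=> tauE; apply: (iffP forallP) => [eqt|bt u]; last first.
  by rewrite (cnt_class _ tauE) balanced_mul // mulnC.
apply: le_balanced => i; case: (posnP #|label_class t i|) => [-> //|].
move=> /card_gt0P[u]; rewrite inE => /eqP ti.
have := eqt u; rewrite (cnt_class _ tauE) ti; move: #|label_class t i| => k.
by rewrite [m * q]mulnC eqn_pmul2l // => /eqP ->.
Qed.

Lemma adjacentC n (G : graph n) u v : adjacent G u v = adjacent G v u.
Proof. by apply: eq_existsb => e; rewrite orbC. Qed.

Lemma adjacent_irr n (G : graph n) u : adjacent G u u = false.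
Proof.
apply/existsP => -[[[a b] /= lt_ab]] /= /andP[_]; rewrite orbb => /eqP[ea eb].
by rewrite ea eb ltnn in lt_ab.
Qed.

Lemma adjacent_edge n (G : graph n) (e : vpair n) :
  adjacent G (val e).1 (val e).2 = (e \in G).
Proof.
apply/existsP/idP => [[e' /andP[e'G /orP[] /eqP ee]]|eG].
- by rewrite -(_ : e' = e) //; apply: val_inj; rewrite ee; case: (val e).
- have := valP e; have := valP e'; rewrite ee /= => h1 h2.
  by have := ltn_trans h1 h2; rewrite ltnn.
by exists e; rewrite eG /=; case: (val e) => a b; rewrite eqxx.
Qed.

Lemma input_adj n (G : graph n) (u v : 'I_n) : input G 1 (u * n + v) = adjacent G u v.
Proof.
rewrite /input; congr nat_of_bool; apply/existsP/idP => [[u' /existsP[v' /andP[/eqP e]]]|uv].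
  have n0 : 0 < n by apply: leq_ltn_trans (ltn_ord u).
  have eu : u = u' :> nat.
    by have := congr1 (fun k => k %/ n) e; rewrite !divnMDl // !divn_small // !addn0.
  have ev : v = v' :> nat by move: e; rewrite eu => /addnI.
  by rewrite (val_inj eu) (val_inj ev).
by exists u; apply/existsP; exists v; rewrite eqxx.
Qed.

Definition m_sel (same : bool) n (G : graph n) (t : labelling n q) : nat :=
  if same then m_in G t else m_out G t.

Lemma score_m_sel same n (G : graph n) (t : labelling n q) (tau : nat -> nat) :
  (forall v : 'I_n, tau v = t v) -> score same tau (input G 1) n = 2 * m_sel same G t.
Proof.
move=> tauE.
have -> : score same tau (input G 1) n
    = \sum_u \sum_v (((t u == t v) == same) && adjacent G u v : nat).
  apply: eq_bigr => u _; apply: eq_bigr => v _; rewrite /contrib !tauE input_adj.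
  by rewrite (inj_eq val_inj); case: ifP.
rewrite sum_sym_pairs => [|u v]; last by rewrite [t u == _]eq_sym adjacentC.
rewrite big1 ?add0n => [|u _]; last by rewrite adjacent_irr andbF.
congr (2 * _); under eq_bigr do rewrite adjacent_edge.
have -> : m_sel same G t = #|[set e in G | same_group t e == same]%SET|.
  by rewrite /m_sel; case: same; rewrite /m_in /m_out; apply: eq_card => e; rewrite !inE ?eqb_id ?eqbF_neg.
rewrite -sum1_card [RHS]big_mkcond; apply: eq_bigr => e _.
by rewrite !inE andbC /same_group; case: andP.
Qed.

Lemma labelling_of n (f : nat -> nat) : (forall j, f j < q) ->
  exists t : labelling n q, forall v : 'I_n, f v = t v.
Proof. by move=> flt; exists [ffun v : 'I_n => Ordinal (flt v)] => v; rewrite ffunE. Qed.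

Lemma search_correct same m (G : graph (m * q)) :
  exists t : labelling (m * q) q, [/\ outputs (search q same) G t, balanced t &
    forall t', balanced t' -> m_sel same G t' <= m_sel same G t].
Proof.
have [k [m' [r _ [best [Hbest all]]]]] :=
  @exec_search q same q_gt0 (input G) (m * q) erefl erefl erefl erefl.
have digit_lt c j : digit q c j < q by rewrite ltn_mod.
have all' t' : balanced t' -> (2 * m_sel same G t').+1 <= best.
  move=> bt'.
  have [j lt_j|c lt_c cE] := @digit_surj (m * q)
     (fun j => if insub j is Some v then t' v : nat else 0).
    by rewrite insubT.
  have tauE (v : 'I_(m * q)) : digit q c v = t' v by rewrite cE // valK.
  rewrite -(score_m_sel _ _ tauE); apply: all => //.
  exact/(equitableP tauE).
have [t0 bt0 _] := balanced_near [ffun _ : 'I_(m * q) => Ordinal q_gt0].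
case: Hbest => [b0|[c [lt_c eqc bE out]]]; first by have := all' _ bt0; rewrite b0.
have [t tE] := labelling_of (m * q) (digit_lt c).
exists t; split; last first.
- by move=> t' /all'; rewrite bE (score_m_sel _ _ tE) ltnS leq_mul2l.
- exact/(equitableP tE).
by exists k, m'; split=> // v; rewrite out // tE.
Qed.

(** n <= 2^n and q^n <= 2^(q n) bound every term of the running time by
    2^((2 q + 2) n). *)
Lemma search_exponential same : exponential_time (search q same).
Proof.
exists (117 + 2 * q) => n G.
have [k [m' [r le_k _]]] := @exec_search q same q_gt0 (input G) n erefl erefl erefl erefl.
exists k, m'; split=> //; apply: leq_trans le_k _.
set x := 2 ^ n; set X := 2 ^ (q * n); set Y := X * X * (x * x).
have YE : 2 ^ ((2 * q + 2) * n) = Y.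
  by rewrite /Y /X /x -!expnD; congr (2 ^ _); lia.
have nx : n <= x by rewrite ltnW // ltn_expl.
have TX : q ^ n <= X by rewrite /X expnM; case: (n) => // n'; rewrite leq_exp2r // ltnW // ltn_expl.
have x0 : 0 < x by rewrite expn_gt0.
have X0 : 0 < X by rewrite expn_gt0.
have le_Y : 2 ^ ((2 * q + 2) * n) <= 2 ^ ((117 + 2 * q) * n).
  by rewrite leq_exp2l // leq_mul2r; lia.
apply: (@leq_trans (115 * Y)); last by rewrite -YE leq_mul //; lia.
set T := q ^ n in TX *.
have n1 : n <= x * x by apply: leq_trans nx _; rewrite leq_pmulr.
have n2 : n * n <= x * x by rewrite leq_mul.
have o1 : 1 <= x * x by rewrite muln_gt0 x0.
have T1 : T <= X * X by apply: leq_trans TX _; rewrite leq_pmulr.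
have T2 : T * T <= X * X by rewrite leq_mul.
have O1 : 1 <= X * X by rewrite muln_gt0 X0.
have := leq_mul O1 n1; have := leq_mul T2 n1; have := leq_mul T1 n1.
have := leq_mul T1 n2; have := leq_mul T1 o1; have := leq_mul O1 o1.
rewrite -/Y !mulnDr !mul1n !muln1 !mulnA.
have -> : T * n * T = T * T * n by rewrite mulnAC.
have -> : T * n * n * 9 = 9 * (T * n * n) by rewrite mulnC.
by move: (T * n * n) (T * n) (T * T * n) => a b c; lia.
Qed.

End SearchCorrect.

(** * The theorem *)

Section Final.
Variables (R : realType) (q : nat) (cin cout : R).
Local Notation d := (avg_degree q cin cout).
Local Notation l := (snr q cin cout).

Lemma good_weakly_good (delta : R) : 0 < delta -> `|l| <= 1 ->
  exists N : nat, forall n (G : graph n) (t : labelling n q), (N <= n)%N ->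
    good cin cout G t -> weakly_good cin cout delta G t.
Proof.
move=> dl0 l1; have [N hN] := nat_above ((delta ^+ 3)^-1).
exists N.+1 => n G t Nn [bt hi ho].
have np : 0 < n%:R :> R by rewrite ltr0n (leq_ltn_trans _ Nn).
have d3 : 0 < delta ^+ 3 by rewrite exprn_gt0.
have le_n : n%:R `^ (2 / 3) <= delta * n%:R :> R.
  rewrite -(@ler_pXn2r R 3) // ?nnegrE ?powR_ge0 ?mulr_ge0 ?(ltW dl0) //.
  rewrite -powR_mulrn ?powR_ge0 // -powRrM.
  have -> : 2 / 3 * 3 = 2%:R :> R by field.
  rewrite powR_mulrn // exprMn [n%:R ^+ 3]exprSr mulrCA ler_peMr ?sqr_ge0 //.
  by rewrite -ler_pdivrMl // mulr1 (le_trans hN) // ler_nat ltnW.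
have dev (x : R) : `|x| < n%:R `^ (2 / 3) -> `|l * x| <= delta * n%:R.
  move=> hx; rewrite normrM; apply: (@le_trans _ _ `|x|); first by rewrite ler_piMl.
  exact: le_trans (ltW hx) le_n.
by split=> //; [have := dev _ hi|have := dev _ ho]; rewrite ler_norml => /andP[].
Qed.

(** The total number of edges does not depend on the labelling, so more edges
    inside the groups means fewer between them. *)
Lemma weakly_good_maximal (delta : R) n (G : graph n) (t t' : labelling n q) :
  balanced t -> (m_sel (0 <= l)%R G t' <= m_sel (0 <= l)%R G t)%N ->
  weakly_good cin cout delta G t' -> weakly_good cin cout delta G t.
Proof.
move=> bt le_m [_ hi ho].
have tot (s : labelling n q) : (m_in G s + m_out G s = #|G|)%N.
  rewrite /m_in /m_out -(cardsID [set e | same_group s e] G); congr (_ + _)%N;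
    by apply: eq_card => e; rewrite !inE // andbC.
have totR (s : labelling n q) : (m_out G s)%:R = #|G|%:R - (m_in G s)%:R :> R.
  by rewrite -(tot s) natrD addrC addKr.
have le_l : l * (m_in G t')%:R <= l * (m_in G t)%:R.
  move: le_m; rewrite /m_sel; case: (lerP 0 l) => l0 le_m.
    by rewrite ler_wpM2l // ler_nat.
  rewrite -(ler_nat R) !totR in le_m.
  by apply: ler_wnM2l; [exact: ltW|lra].
split=> //.
  by apply: le_trans hi _; rewrite !mulrBr lerD2r.
apply: le_trans ho; rewrite !totR !mulrBr lerD2r lerD2l lerN2.
exact: le_l.
Qed.

End Final.

Theorem theorem3 (R : realType) (q : nat) (cin cout : R)
    (hq : (2 <= q)%N) (hcin : 0 <= cin) (hcout : 0 <= cout)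
    (hc : ~ (cin = 0 /\ cout = 0))
    (hd : (d_upper q (snr q cin cout) < (avg_degree q cin cout)%:E)%E) :
  exists beta : R,
    [/\ smallest_root q (avg_degree q cin cout) (snr q cin cout) beta,
        0 < beta,
        whp cin cout (fun n (G : graph n) (s : labelling n q) =>
          forall t : labelling n q, good cin cout G t ->
            beta <= overlap R s t) &
        exists p : program,
          exponential_time p /\
          whp cin cout (fun n (G : graph n) (s : labelling n q) =>
            exists t : labelling n q,
              outputs p G t /\ beta <= overlap R s t)].
Proof.
have [d0 cinE coutE ccE] := sbm_params hq hcin hcout hc.
set d := avg_degree q cin cout in hd d0 cinE coutE ccE *.
set l := snr q cin cout in hd cinE coutE ccE *.
have Q2 : 2 <= q%:R :> R by rewrite ler_nat.
have Q0 : 0 < q%:R :> R by lra.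
have q0 : (0 < q)%N by apply: leq_trans hq.
have l0 : l != 0.
  by apply: contraTneq hd => ->; rewrite /d_upper eqxx -leNgt leey.
have l1 : l <= 1 by rewrite -subr_ge0 -(pmulr_rge0 _ d0) -coutE.
have lA : 0 <= 1 + (q%:R - 1) * l by rewrite -(pmulr_rge0 _ d0) -cinE.
have ln1 : `|l| <= 1.
  by rewrite ler_norml l1 andbT; move: (l) lA l1 => x lA l1; clear -Q2 lA l1; nra.
pose B b := 1 + q%:R * b * l; pose B' b := q%:R - 1 - q%:R * b * l.
have z01 : 0 <= (0 : R) < 1 - q%:R^-1.
  by rewrite lexx subr_gt0 invf_lt1 //; lra.
have den0 : 0 < root_den q l 0.
  exact: (@root_den_gt0 R q l hq l0 l1 lA _ _ _ B B' erefl erefl erefl (fun=> erefl) (fun=> erefl)).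
have root0 : root_num q (0 : R) < d * root_den q l 0.
  move: hd; rewrite /d_upper (negPf l0) lte_fin -(root_den0 l hq erefl) ltr_pdivrMr //.
  by rewrite (root_num0 hq erefl).
have [beta [sr beta0 beta1 le_root]] := @exists_smallest_root R q l d hq l0 l1 lA d0 _ _ _
  B B' erefl erefl erefl (fun=> erefl) (fun=> erefl) root0.
have [delta [M [dl0 M0 rare]]] :=
  low_overlap_rare hq hcin hcout hc l0 beta0 beta1 le_root root0.
exists beta; split=> //.
  have [N gwg] := good_weakly_good dl0 ln1.
  apply: (@whp_of_bound _ _ _ _ _ delta (maxn M N) 2) => // m s hm nb.
  have hM : (M <= m)%N by apply: leq_trans hm; exact: leq_maxl.
  have hN : (N <= m * q)%N.
    by apply: leq_trans (leq_pmulr m q0); apply: leq_trans hm; exact: leq_maxr.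
  have [ci co bound] := rare m s hM nb.
  apply: le_trans bound; rewrite [leLHS]big_mkcond [leRHS]big_mkcond; apply: ler_sum => G _.
  have W0 := graph_weight_ge0 (edge_prob01 s hcin hcout ci co) G.
  case: asboolP => [ng|_]; last by case: ifP.
  rewrite ifT //; apply/asboolP; move/existsNP: ng => [t /not_implyP[gt /negP]].
  by rewrite -ltNge => ov; exists t; split=> //; exact: gwg.
exists (search q (0 <= l)); split; first exact: search_exponential.
have [delta1 [C [M1 [dl10 planted]]]] := near_planted_weakly_good hq hcin hcout hc dl0.
apply: (@whp_of_bound _ _ _ _ _ (Num.min delta delta1) (maxn M M1) (C + 2)) => //.
  by rewrite lt_min dl0.
move=> m s hm nb.
have hM : (M <= m)%N by apply: leq_trans hm; exact: leq_maxl.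
have hM1 : (M1 <= m)%N by apply: leq_trans hm; exact: leq_maxr.
have nb0 : near_balanced delta s.
  by move=> i; apply: le_trans (nb i) _; rewrite ler_wpM2r // ge_min lexx.
have nb1 : near_balanced delta1 s.
  by move=> i; apply: le_trans (nb i) _; rewrite ler_wpM2r // ge_min lexx orbT.
have [ci co bound] := rare m s hM nb0.
have [s' [bs' bound1]] := planted m s hM1 nb1.
rewrite mulrDl; apply: le_trans (lerD bound1 bound).
rewrite [leLHS]big_mkcond [X in _ <= X + _]big_mkcond [X in _ <= _ + X]big_mkcond -big_split /=.
apply: ler_sum => G _.
have W0 := graph_weight_ge0 (edge_prob01 s hcin hcout ci co) G.
case: asboolP => [ng|_]; last by rewrite addr_ge0 //; case: ifP.
case: asboolP => [_|/contrapT wg]; first by rewrite lerDl; case: ifP.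
rewrite add0r ifT //; apply/asboolP.
have [t [out bt max_t]] := search_correct q0 (0 <= l) G.
exists t; split; first exact: weakly_good_maximal (max_t _ bs') wg.
by rewrite ltNge; apply/negP => ov; apply: ng; exists t.
Qed.
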